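(* Let $A$ be a Dirac ring and $A^{\mathrm{ev}}\subset A$ the sub-Dirac ring of homogeneous elements of even degree. Then extension of scalars $B\mapsto A\otimes_{A^{\mathrm{ev}}}B$ along $A^{\mathrm{ev}}\to A$ induces an equivalence from the category of étale Dirac $A^{\mathrm{ev}}$-algebras to the category of étale Dirac $A$-algebras (full subcategories of the respective categories of Dirac algebras).
   Context: A Dirac ring is a $\mathbb{Z}$-graded ring $A=\bigoplus_d A_d$ with $ab=(-1)^{\deg(a)\deg(b)}ba$ for homogeneous $a,b$; maps are degree-preserving ring homomorphisms; a Dirac $A$-algebra is a map of Dirac rings $A\to B$. A Dirac $A$-algebra $B$ is finitely presented if there is a finite graded set $S$ of homogeneous generators such that the kernel of the induced map $A[S]\to B$ from the free Dirac $A$-algebra is generated (as graded ideal) by finitely many homogeneous elements. A map $\phi\colon A\to B$ is étale if it is finitely presented and for every commutative square of Dirac rings $A\to C$, $B\to C/I$ (with $A\to C\to C/I$ equal to $A\to B\to C/I$), where $I\subset C$ is a graded ideal with $I^2=0$, there exists a unique map of Dirac rings $B\to C$ compatible with both maps. *)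

(* Defs.v *)
From HB Require Import structures.
From mathcomp Require Import all_boot all_order all_algebra.
From mathcomp Require Import boolp.

Set Implicit Arguments.
Unset Strict Implicit.
Unset Printing Implicit Defensive.

Import GRing.Theory.

Local Open Scope ring_scope.
Local Open Scope quotient_scope.

Definition koszul (d e : int) : int := (-1) ^+ absz (d * e).

Lemma koszulE d e : koszul d e = (-1) ^+ (odd (absz d) && odd (absz e)).
Proof. by rewrite /koszul abszM -signr_odd oddM. Qed.

Lemma oddzD (d e : int) : odd (absz (d + e)) = odd (absz d) (+) odd (absz e).
Proof.
have h (n : nat) (m : nat) : odd (absz (n%:Z - m%:Z)) = odd n (+) odd m.
  case: (leqP m n) => hmn; first by rewrite distnEl // oddB.
  by rewrite distnEr 1?ltnW // oddB 1?ltnW // addbC.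
case: d e => [n|n] [m|m]; rewrite ?NegzE.
- by rewrite -PoszD !absz_nat oddD.
- by rewrite h abszN.
- by rewrite addrC h abszN addbC.
- by rewrite -opprD !abszN -PoszD absz_nat oddD.
Qed.

Lemma koszulC d e : koszul d e = koszul e d.
Proof. by rewrite /koszul mulrC. Qed.

Lemma koszulDl d e f : koszul (d + e) f = koszul d f * koszul e f.
Proof.
rewrite !koszulE oddzD; case: (odd (absz d)); case: (odd (absz e));
  by case: (odd (absz f)); rewrite ?mulr1 ?mul1r ?mulrNN.
Qed.

Lemma koszulDr d e f : koszul d (e + f) = koszul d e * koszul d f.
Proof. by rewrite koszulC koszulDl !(koszulC d). Qed.

Lemma koszul0l d : koszul 0 d = 1. Proof. by rewrite koszulE. Qed.
Lemma koszul0r d : koszul d 0 = 1. Proof. by rewrite koszulC koszul0l. Qed.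

Lemma koszulK d e : koszul d e * koszul d e = 1.
Proof. by rewrite koszulE -expr2 sqrr_sign. Qed.

(* [f] is the family of homogeneous components of [x] with respect to the
   family of subsets [hom]. *)
Definition is_decomposition (V : nmodType) (hom : int -> V -> Prop)
    (x : V) (f : int -> V) : Prop :=
  (forall d, hom d (f d)) /\
  exists s : seq int,
    [/\ uniq s, (forall d, d \notin s -> f d = 0) & x = \sum_(d <- s) f d].

(* A Dirac ring is a possibly trivial ring that is the direct sum of the
   subgroups [homog d]. *)
HB.mixin Record PzRing_isDirac R of GRing.PzRing R := {
  homog : int -> R -> Prop;
  homog0 : forall d, homog d 0;
  homogB : forall d x y, homog d x -> homog d y -> homog d (x - y);
  homog1 : homog 0 1;
  homogM : forall d e x y, homog d x -> homog e y -> homog (d + e) (x * y);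
  homog_decomp : forall x, exists! f, is_decomposition homog x f;
  homogC : forall d e x y,
    homog d x -> homog e y -> x * y = (y * x) *~ koszul d e
}.

#[short(type="diracRingType")]
HB.structure Definition DiracRing :=
  {R of GRing.PzRing R & PzRing_isDirac R}.

Section Components.
Variable A : diracRingType.
Implicit Types (x y : A) (d e : int).

Lemma homogN d x : homog d x -> homog d (- x).
Proof. by move=> hx; rewrite -sub0r; apply: homogB => //; apply: homog0. Qed.

Lemma homogD d x y : homog d x -> homog d y -> homog d (x + y).
Proof. by move=> hx hy; rewrite -[y]opprK; apply/homogB/homogN. Qed.

Lemma homog_sum d (I : Type) (s : seq I) (P : pred I) (F : I -> A) :
  (forall i, P i -> homog d (F i)) -> homog d (\sum_(i <- s | P i) F i).
Proof. by move=> h; elim/big_ind: _ => //; [apply: homog0|move=> ? ?; apply: homogD]. Qed.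

Lemma homogMz d x (n : int) : homog d x -> homog d (x *~ n).
Proof.
move=> hx; have h (m : nat) : homog d (x *+ m).
  by elim: m => [|m IH]; rewrite ?mulr0n ?mulrS; [apply: homog0|apply: homogD].
by case: n => n; [exact: h|rewrite NegzE mulrNz; apply: homogN; apply: h].
Qed.

Definition hcomp d x : A := sval (cid (homog_decomp x)) d.

Lemma hcompP x : is_decomposition homog x (hcomp^~ x).
Proof. by rewrite /hcomp; case: cid => f []. Qed.

Lemma hcompE x (f : int -> A) :
  is_decomposition homog x f -> forall d, hcomp d x = f d.
Proof.
by rewrite /hcomp; case: cid => g [/= ? hg] /hg -> d.
Qed.

Lemma homog_comp d x : homog d (hcomp d x).
Proof. by have [h _] := hcompP x; apply: h. Qed.

Lemma hcomp_finite x : exists s : seq int,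
  [/\ uniq s, (forall d, d \notin s -> hcomp d x = 0) &
   x = \sum_(d <- s) hcomp d x].
Proof. by have [_ h] := hcompP x; apply: h. Qed.

Definition hsupp x : seq int := sval (cid (hcomp_finite x)).

Lemma hsupp_uniq x : uniq (hsupp x).
Proof. by rewrite /hsupp; case: cid => s []. Qed.

Lemma hsuppN x d : d \notin hsupp x -> hcomp d x = 0.
Proof. by rewrite /hsupp; case: cid => s [? h ?]; apply: h. Qed.

Lemma sum_widen (V : nmodType) (F : int -> V) (s t : seq int) :
    uniq s -> uniq t -> {subset s <= t} -> (forall d, d \notin s -> F d = 0) ->
  \sum_(d <- s) F d = \sum_(d <- t) F d.
Proof.
move=> us ut st h0.
rewrite [RHS](bigID (mem s)) /= [X in _ = _ + X]big1 ?addr0; last by move=> i /h0.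
rewrite -[RHS]big_filter; apply: perm_big; apply: uniq_perm => //.
  by rewrite filter_uniq.
move=> d; rewrite mem_filter; case: (boolP (d \in s)) => //= /st ->//.
Qed.

Lemma hcomp_is_additive d : zmod_morphism (hcomp d).
Proof.
move=> x y; apply: (@hcompE (x - y) (fun d => hcomp d x - hcomp d y)); split.
  by move=> e; apply: homogB; apply: homog_comp.
have [s [us hs ex]] := hcomp_finite x; have [t [ut ht ey]] := hcomp_finite y.
exists (undup (s ++ t)); split; first exact: undup_uniq.
  by move=> e; rewrite mem_undup mem_cat => /norP[/hs -> /ht ->]; rewrite subr0.
rewrite sumrB {1}ex {1}ey; congr (_ - _).
  apply: sum_widen => //; first exact: undup_uniq.
  by move=> e he; rewrite mem_undup mem_cat he.
apply: sum_widen => //; first exact: undup_uniq.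
by move=> e he; rewrite mem_undup mem_cat he orbT.
Qed.

HB.instance Definition _ d :=
  GRing.isZmodMorphism.Build A A (hcomp d) (hcomp_is_additive d).

Lemma hcomp_homog d e x : homog d x -> hcomp e x = if e == d then x else 0.
Proof.
move=> hx; apply: (@hcompE x (fun e => if e == d then x else 0)); split.
  by move=> i; case: eqP => [->|_] //; apply: homog0.
exists [:: d]; split=> //; last by rewrite big_seq1 eqxx.
by move=> i; rewrite inE => /negbTE ->.
Qed.

(* For additive [F d], [hsum F] is the additive map equal to [F d] on the
   homogeneous elements of degree [d]. *)
Definition hsum (V : nmodType) (F : int -> A -> V) (x : A) : V :=
  \sum_(d <- hsupp x) F d (hcomp d x).

Lemma hsum_id x : x = hsum (fun _ => id) x.
Proof. by rewrite /hsum /hsupp; case: cid => s []. Qed.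

Lemma homog_ind (P : A -> Prop) :
    P 0 -> (forall x y, P x -> P y -> P (x + y)) ->
    (forall d x, homog d x -> P x) -> forall x, P x.
Proof.
move=> P0 PD Ph x; rewrite [x]hsum_id.
by rewrite /hsum; elim/big_ind: _ => // d _; apply: Ph (homog_comp _ _).
Qed.

End Components.

Section HSum.
Variables (A : diracRingType) (V : zmodType) (F : int -> A -> V).
Hypothesis FD : forall d x y, F d (x + y) = F d x + F d y.

Let F0 d : F d 0 = 0.
Proof. by apply: (addIr (F d 0)); rewrite -FD !add0r. Qed.

Lemma hsum_widen x (s : seq int) :
    uniq s -> (forall d, d \notin s -> hcomp d x = 0) ->
  hsum F x = \sum_(d <- s) F d (hcomp d x).
Proof.
move=> us hs; pose t := undup (hsupp x ++ s).
have ut : uniq t by apply: undup_uniq.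
rewrite /hsum (@sum_widen _ (fun d => F d (hcomp d x)) (hsupp x) t) ?hsupp_uniq //.
- by apply/esym/sum_widen => // d h; rewrite ?hs // mem_undup mem_cat h orbT.
- by move=> d h; rewrite mem_undup mem_cat h.
- by move=> d /hsuppN ->.
Qed.

Lemma hsumD x y : hsum F (x + y) = hsum F x + hsum F y.
Proof.
pose t := undup (hsupp x ++ hsupp y).
have hx d : d \notin t -> hcomp d x = 0.
  by rewrite mem_undup mem_cat => /norP[/hsuppN].
have hy d : d \notin t -> hcomp d y = 0.
  by rewrite mem_undup mem_cat => /norP[_ /hsuppN].
have ut : uniq t by apply: undup_uniq.
rewrite (@hsum_widen x t) // (@hsum_widen y t) // (@hsum_widen _ t) //.
  by rewrite -big_split /=; apply: eq_bigr => d _; rewrite raddfD FD.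
by move=> d h; rewrite raddfD /= hx // hy // addr0.
Qed.

Lemma hsum_homog d x : homog d x -> hsum F x = F d x.
Proof.
move=> hx; rewrite (@hsum_widen _ [:: d]) //.
  by rewrite big_seq1 (hcomp_homog _ hx) eqxx.
by move=> e; rewrite inE (hcomp_homog _ hx) => /negbTE ->.
Qed.

End HSum.

(* A grading is a direct sum as soon as the homogeneous elements generate and
   there are additive projections. *)
Lemma decomp_from_proj (V : zmodType) (hom : int -> V -> Prop)
    (p : int -> V -> V) :
  (forall d x y, p d (x + y) = p d x + p d y) ->
  (forall d x, hom d (p d x)) ->
  (forall d e x, hom d x -> p e x = if e == d then x else 0) ->
  (forall P : V -> Prop, P 0 -> (forall x y, P x -> P y -> P (x + y)) ->
    (forall d x, hom d x -> P x) -> forall x, P x) ->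
  forall x, exists! f, is_decomposition hom x f.
Proof.
move=> pD hp p_homog gen.
have p0 d : p d 0 = 0 by apply: (addIr (p d 0)); rewrite -pD !add0r.
have psum d (s : seq int) (f : int -> V) :
    p d (\sum_(i <- s) f i) = \sum_(i <- s) p d (f i).
  by elim: s => [|i s IH]; rewrite ?big_nil ?big_cons ?p0 // pD IH.
move=> x; exists (p^~ x); split; last first.
  move=> f [hf [s [us f0 ->]]]; apply: funext => d.
  rewrite psum (eq_bigr (fun i => if d == i then f i else 0)); last first.
    by move=> i _; rewrite (p_homog i).
  rewrite -big_mkcond /=; case: (boolP (d \in s)) => hd.
    by rewrite (big_rem d) //= eqxx big_seq_cond big1 ?addr0 // => i /andP[];
      rewrite mem_rem_uniq // inE => /andP[/negbTE]; rewrite eq_sym => ->.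
  rewrite f0 // big_seq_cond big1 // => i /andP[hi /eqP di].
  by rewrite di hi in hd.
split=> //; elim/gen: x => [|x y|d x hx].
- by exists [::]; split=> *; rewrite ?p0 ?big_nil.
- move=> [s [us hs ex]] [t [ut ht ey]]; exists (undup (s ++ t)); split.
  + exact: undup_uniq.
  + by move=> e; rewrite mem_undup mem_cat pD => /norP[/hs -> /ht ->]; rewrite addr0.
  under eq_bigr do rewrite pD.
  rewrite big_split /= {1}ex {1}ey; congr (_ + _).
    apply: sum_widen => //; first exact: undup_uniq.
    by move=> e he; rewrite mem_undup mem_cat he.
  apply: sum_widen => //; first exact: undup_uniq.
  by move=> e he; rewrite mem_undup mem_cat he orbT.
- exists [:: d]; split=> //; last by rewrite big_seq1 (p_homog d) // eqxx.
  by move=> e; rewrite inE (p_homog d) // => /negbTE ->.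
Qed.

Record diracHom (A B : diracRingType) := DiracHom {
  dirac_rmorphism :> {rmorphism A -> B};
  dirac_homog : forall d x, homog d x -> homog d (dirac_rmorphism x)
}.

Lemma diracHom_ext (A B : diracRingType) (f g : diracHom A B) :
  f =1 g -> f = g.
Proof.
case: f => f hf; case: g => g hg /= fg.
have e : f = g.
  move: f g fg {hf hg} => [f [[f1] [f2]]] [g [[g1] [g2]]] /= /funext fg.
  rewrite /= in f1 f2 g1 g2 *.
  by subst g; rewrite (Prop_irrelevance f1 g1) (Prop_irrelevance f2 g2).
by subst g; rewrite (Prop_irrelevance hf hg).
Qed.

Definition dirac_id (A : diracRingType) : diracHom A A :=
  @DiracHom A A idfun (fun _ _ h => h).

Definition dirac_comp (A B C : diracRingType)
    (g : diracHom B C) (f : diracHom A B) : diracHom A C :=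
  @DiracHom A C (g \o f) (fun d x h => dirac_homog g (dirac_homog f h)).

Section BuildHom.
Variables (A B : diracRingType) (f : A -> B).
Hypothesis fB : forall x y, f (x - y) = f x - f y.
Hypothesis f1 : f 1 = 1.
Hypothesis fM : forall x y, f (x * y) = f x * f y.
Hypothesis fh : forall d x, homog d x -> homog d (f x).

Definition build_fun : A -> B := f.
HB.instance Definition _ := GRing.isZmodMorphism.Build A B build_fun fB.
HB.instance Definition _ :=
  GRing.isMonoidMorphism.Build A B build_fun (conj f1 fM).

Definition build_hom : diracHom A B := @DiracHom A B build_fun fh.
Lemma build_homE x : build_hom x = f x. Proof. by []. Qed.
End BuildHom.

Lemma addr_of_subr (V : zmodType) (P : V -> Prop) : P 0 ->
  (forall x y, P x -> P y -> P (x - y)) -> forall x y, P x -> P y -> P (x + y).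
Proof. by move=> P0 PB x y hx hy; rewrite -[y]opprK -(sub0r y); apply/PB/PB. Qed.

Inductive zspan (V : zmodType) (G : V -> Prop) : V -> Prop :=
| zspan0 : zspan G 0
| zspan_gen x : G x -> zspan G x
| zspanB x y : zspan G x -> zspan G y -> zspan G (x - y).

Section Presentation.
Variables (X : choiceType) (rel : seq X -> seq X -> Prop).

(* Formal sums of signed elements of [X], where [true] is the sign minus, up to
   the congruence generated by [rel]. *)
Inductive pres_eq : seq (bool * X) -> seq (bool * X) -> Prop :=
| pres_refl s : pres_eq s s
| pres_sym s t : pres_eq s t -> pres_eq t s
| pres_trans s t u : pres_eq s t -> pres_eq t u -> pres_eq s u
| pres_cat s s' t t' :
    pres_eq s s' -> pres_eq t t' -> pres_eq (s ++ t) (s' ++ t')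
| pres_comm s t : pres_eq (s ++ t) (t ++ s)
| pres_cancel x : pres_eq [:: (false, x); (true, x)] [::]
| pres_base s t : rel s t -> pres_eq (map (pair false) s) (map (pair false) t).

Definition pres_eqb (s t : seq (bool * X)) : bool := `[< pres_eq s t >].

Lemma pres_eqb_equiv : equiv_class_of pres_eqb.
Proof.
split=> [s|s t|t s u].
- by apply/asboolP/pres_refl.
- by apply/asboolP/asboolP => /pres_sym.
- by move=> /asboolP h /asboolP h'; apply/asboolP/(pres_trans h h').
Qed.

Canonical pres_equiv := EquivRelPack pres_eqb_equiv.
Canonical pres_encModRel := defaultEncModRel pres_eqb.

(* The abelian group with generators [X] and relations [rel]. *)
Definition pres := {eq_quot pres_eqb}.

HB.instance Definition _ : EqQuotient _ pres_eqb pres := EqQuotient.on pres.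
HB.instance Definition _ := Choice.on pres.

Lemma pres_piP s t : pres_eq s t <-> \pi_pres s = \pi_pres t.
Proof. by split=> [h|/eqmodP /asboolP //]; apply/eqmodP/asboolP. Qed.

Definition pneg (s : seq (bool * X)) : seq (bool * X) :=
  [seq (~~ x.1, x.2) | x <- s].

Lemma pneg_cancel s : pres_eq (s ++ pneg s) [::].
Proof.
elim: s => [|[b x] s IH] /=; first exact: pres_refl.
have h : pres_eq [:: (b, x); (~~ b, x)] [::].
  case: b => /=; last exact: pres_cancel.
  exact: pres_trans (pres_comm [:: (true, x)] [:: (false, x)]) (pres_cancel x).
apply: (@pres_trans _ ([:: (b, x)] ++ ((~~ b, x) :: pneg s ++ s))).
  by apply: (@pres_cat [:: _] [:: _]); [apply: pres_refl|apply: pres_comm].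
apply: (@pres_trans _ ([::] ++ (s ++ pneg s))) IH.
by apply: (pres_cat h); apply: pres_comm.
Qed.

Lemma pres_eq_neg s t : pres_eq s t -> pres_eq (pneg s) (pneg t).
Proof.
move=> st.
have h1 : pres_eq (pneg s) (pneg s ++ (t ++ pneg t)).
  rewrite -[X in pres_eq X]cats0.
  by apply: pres_cat (pres_refl _) (pres_sym (pneg_cancel t)).
apply: pres_trans h1 _.
rewrite catA -[X in pres_eq _ X]cat0s; apply: pres_cat (pres_refl _).
apply: pres_trans (pres_cat (pres_refl _) (pres_sym st)) _.
exact: pres_trans (pres_comm _ _) (pneg_cancel s).
Qed.

Definition pres_add (p q : pres) : pres := \pi_pres (repr p ++ repr q).
Definition pres_opp (p : pres) : pres := \pi_pres (pneg (repr p)).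

Lemma pres_repr s : pres_eq (repr (\pi_pres s)) s.
Proof. by apply/pres_piP; rewrite reprK. Qed.

Lemma pi_add s t : pres_add (\pi s) (\pi t) = \pi_pres (s ++ t).
Proof. by apply/pres_piP/pres_cat; apply: pres_repr. Qed.

Lemma pi_opp s : pres_opp (\pi s) = \pi_pres (pneg s).
Proof. by apply/pres_piP/pres_eq_neg/pres_repr. Qed.

Lemma pres_addA : associative pres_add.
Proof. by elim/quotP => s _; elim/quotP => t _; elim/quotP => u _; rewrite !pi_add catA.
Qed.

Lemma pres_addC : commutative pres_add.
Proof.
elim/quotP => s _; elim/quotP => t _; rewrite !pi_add.
exact/pres_piP/pres_comm.
Qed.

Lemma pres_add0 : left_id (\pi_pres [::]) pres_add.
Proof. by elim/quotP => s _; rewrite pi_add. Qed.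

Lemma pres_addN : left_inverse (\pi_pres [::]) pres_opp pres_add.
Proof.
elim/quotP => s _; rewrite pi_opp pi_add; apply/pres_piP.
exact: pres_trans (pres_comm _ _) (pneg_cancel s).
Qed.

HB.instance Definition _ :=
  GRing.isZmodule.Build pres pres_addA pres_addC pres_add0 pres_addN.

Definition pgen (x : X) : pres := \pi_pres [:: (false, x)].

Lemma pi_sum s :
  \pi_pres s = \sum_(x <- s) (if x.1 then - pgen x.2 else pgen x.2).
Proof.
elim: s => [|[b x] s IH]; first by rewrite big_nil.
rewrite big_cons -IH /=; case: b.
  by rewrite /pgen -[- _]/(pres_opp _) pi_opp -[_ + _]/(pres_add _ _) pi_add.
by rewrite /pgen -[_ + _]/(pres_add _ _) pi_add.
Qed.

Lemma pgen_rel s t : rel s t -> \sum_(x <- s) pgen x = \sum_(x <- t) pgen x.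
Proof.
by move=> /pres_base /pres_piP; rewrite !pi_sum !big_map.
Qed.

Lemma pres_ind' (P : pres -> Prop) :
  P 0 -> (forall x, P (pgen x)) -> (forall p q, P p -> P q -> P (p - q)) ->
  forall p, P p.
Proof.
move=> P0 Pg PB; have PD := addr_of_subr P0 PB.
elim/quotP => s _; rewrite pi_sum; elim/big_ind: _ => // -[b x] _ /=.
by case: b => //; rewrite -sub0r; apply: PB.
Qed.

Section Lift.
Variables (V : zmodType) (f : X -> V).

Definition pres_eval (s : seq (bool * X)) : V :=
  \sum_(x <- s) (if x.1 then - f x.2 else f x.2).

Definition pres_lift (p : pres) : V := pres_eval (repr p).

Hypothesis frel : forall s t, rel s t -> \sum_(x <- s) f x = \sum_(x <- t) f x.

Lemma pres_eval_eq s t : pres_eq s t -> pres_eval s = pres_eval t.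
Proof.
rewrite /pres_eval; elim=> {s t} //.
- by move=> s t u _ -> _ ->.
- by move=> s s' t t' _ h _ h'; rewrite !big_cat h h'.
- by move=> s t; rewrite !big_cat /= addrC.
- by move=> x; rewrite big_cons big_seq1 big_nil /= subrr.
- by move=> s t /frel; rewrite !big_map.
Qed.

Lemma pres_lift_pi s : pres_lift (\pi s) = pres_eval s.
Proof. exact/pres_eval_eq/pres_repr. Qed.

Lemma pres_lift_gen x : pres_lift (pgen x) = f x.
Proof. by rewrite pres_lift_pi /pres_eval big_seq1. Qed.

Lemma pres_liftD p q : pres_lift (p + q) = pres_lift p + pres_lift q.
Proof.
elim/quotP: p => s _; elim/quotP: q => t _.
by rewrite -[_ + _]/(pres_add _ _) pi_add !pres_lift_pi /pres_eval big_cat.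
Qed.

Lemma pres_liftB p q : pres_lift (p - q) = pres_lift p - pres_lift q.
Proof.
by apply: (addIr (pres_lift q)); rewrite -pres_liftD !subrK.
Qed.

Lemma pres_lift0 : pres_lift 0 = 0.
Proof. by rewrite -[X in pres_lift X](subrr 0) pres_liftB subrr. Qed.
End Lift.

Section Mult.
Variable m : X -> X -> pres.
Hypothesis ml : forall s t y,
  rel s t -> \sum_(x <- s) m x y = \sum_(x <- t) m x y.
Hypothesis mr : forall s t x,
  rel s t -> \sum_(y <- s) m x y = \sum_(y <- t) m x y.

Definition pres_mul (p q : pres) : pres :=
  pres_lift (fun x => pres_lift (m x) q) p.

Let mr' x s t : rel s t -> \sum_(y <- s) m x y = \sum_(y <- t) m x y.
Proof. exact: mr. Qed.

Let mout q s t : rel s t ->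
  \sum_(x <- s) pres_lift (m x) q = \sum_(x <- t) pres_lift (m x) q.
Proof.
move=> st; elim/pres_ind': q => [|y|p q hp hq].
- by rewrite !big1 // => x _; rewrite pres_lift0 //; apply: mr'.
- transitivity (\sum_(x <- s) m x y).
    by apply: eq_bigr => x _; rewrite pres_lift_gen //; apply: mr'.
  rewrite (ml _ st).
  by apply: eq_bigr => x _; rewrite pres_lift_gen //; apply: mr'.
have e u : \sum_(x <- u) pres_lift (m x) (p - q) =
    \sum_(x <- u) pres_lift (m x) p - \sum_(x <- u) pres_lift (m x) q.
  by rewrite -sumrB; apply: eq_bigr => x _; rewrite pres_liftB //; apply: mr'.
by rewrite !e hp hq.
Qed.

Lemma pres_mulBl p p' q : pres_mul (p - p') q = pres_mul p q - pres_mul p' q.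
Proof. by apply: pres_liftB => s t; apply: mout. Qed.

Lemma pres_mul0l q : pres_mul 0 q = 0.
Proof. by apply: pres_lift0 => s t; apply: mout. Qed.

Lemma pres_mul_genl x q : pres_mul (pgen x) q = pres_lift (m x) q.
Proof. by rewrite /pres_mul pres_lift_gen // => s t; apply: mout. Qed.

Lemma pres_mul_gen x y : pres_mul (pgen x) (pgen y) = m x y.
Proof. by rewrite pres_mul_genl pres_lift_gen //; apply: mr'. Qed.

Lemma pres_mulBr p q q' : pres_mul p (q - q') = pres_mul p q - pres_mul p q'.
Proof.
elim/pres_ind': p => [|x|p p' h h'].
- by rewrite !pres_mul0l subrr.
- by rewrite !pres_mul_genl pres_liftB //; apply: mr'.
rewrite !pres_mulBl h h' !opprB addrACA [RHS]addrACA; congr (_ + _).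
exact: addrC.
Qed.

Lemma pres_mul0r p : pres_mul p 0 = 0.
Proof. by rewrite -[X in pres_mul _ X](subrr 0) pres_mulBr subrr. Qed.

Lemma pres_mulDl : left_distributive pres_mul +%R.
Proof. by move=> p q r; rewrite -{1}[q]opprK -(sub0r q) !pres_mulBl pres_mul0l sub0r opprK. Qed.

Lemma pres_mulDr : right_distributive pres_mul +%R.
Proof. by move=> r p q; rewrite -{1}[q]opprK -(sub0r q) !pres_mulBr pres_mul0r sub0r opprK. Qed.

Lemma pres_mulA_gen :
  (forall x y z, pres_mul (m x y) (pgen z) = pres_mul (pgen x) (m y z)) ->
  associative pres_mul.
Proof.
move=> h p q r; elim/pres_ind': p => [|x|p p' hp hp'].
- by rewrite !pres_mul0l.
- elim/pres_ind': q => [|y|q q' hq hq'].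
  + by rewrite !(pres_mul0l, pres_mul0r).
  + elim/pres_ind': r => [|z|r r' hr hr'].
    * by rewrite !pres_mul0r.
    * by rewrite !pres_mul_gen h.
    * by rewrite !pres_mulBr hr hr'.
  + by rewrite !(pres_mulBl, pres_mulBr) hq hq'.
- by rewrite !pres_mulBl hp hp'.
Qed.
End Mult.

End Presentation.

(* Graded ideals: two-sided, and containing the homogeneous components of their
   elements. *)
Record gradedIdeal (C : diracRingType) := GradedIdeal {
  gideal :> C -> Prop;
  gideal0 : gideal 0;
  gidealB : forall x y, gideal x -> gideal y -> gideal (x - y);
  gidealMl : forall a x, gideal x -> gideal (a * x);
  gidealMr : forall a x, gideal x -> gideal (x * a);
  gideal_comp : forall d x, gideal x -> gideal (hcomp d x)
}.

Definition gideal_gen (C : diracRingType) (r : seq C) (x : C) : Prop :=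
  forall I : gradedIdeal C, (forall y, y \in r -> I y) -> I x.

Section DiracQuotient.
Variables (C : diracRingType) (I : gradedIdeal C).

Definition gideal_pred (x : C) : bool := `[< I x >].

Lemma gideal_zmod_closed : zmod_closed gideal_pred.
Proof.
split; first by apply/asboolP/gideal0.
by move=> x y /asboolP hx /asboolP hy; apply/asboolP/gidealB.
Qed.

HB.instance Definition _ :=
  GRing.isZmodClosed.Build C gideal_pred gideal_zmod_closed.

Definition dquot := Quotient.quot (GRing.ZmodClosed.clone C gideal_pred _).

HB.instance Definition _ := GRing.Zmodule.on dquot.
HB.instance Definition _ := EqQuotient.on dquot.

Definition dproj (x : C) : dquot := \pi_dquot x.

Lemma dprojP x y : dproj x = dproj y <-> I (x - y).
Proof.
split=> [/eqP|h].
  by rewrite /dproj -Quotient.idealrBE => /asboolP.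
by apply/eqP; rewrite /dproj -Quotient.idealrBE; apply/asboolP.
Qed.

Lemma dproj_surj p : exists x, p = dproj x.
Proof. by exists (repr p); rewrite /dproj reprK. Qed.

Lemma dprojD x y : dproj (x + y) = dproj x + dproj y.
Proof. exact: Quotient.pi_add. Qed.

Lemma dprojN x : dproj (- x) = - dproj x.
Proof. exact: Quotient.pi_opp. Qed.

Lemma dprojB x y : dproj (x - y) = dproj x - dproj y.
Proof. by rewrite dprojD dprojN. Qed.

Lemma dproj0 : dproj 0 = 0.
Proof. by rewrite -(subrr 0) dprojB subrr. Qed.

Definition dquot_mul (p q : dquot) : dquot := dproj (repr p * repr q).

Lemma dprojM x y : dquot_mul (dproj x) (dproj y) = dproj (x * y).
Proof.
have h z : I (repr (dproj z) - z) by apply/dprojP; rewrite /dproj reprK.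
apply/dprojP; set x' := repr _; set y' := repr _.
have -> : x' * y' - x * y = (x' - x) * y' - x * (y - y').
  by rewrite mulrBl mulrBr opprB addrA subrK.
apply: gidealB; first by apply: gidealMr; apply: h.
apply: gidealMl; rewrite -opprB -sub0r; apply: gidealB; first exact: gideal0.
exact: h.
Qed.

Lemma dquot_mulA : associative dquot_mul.
Proof.
move=> p q r; have [x ->] := dproj_surj p; have [y ->] := dproj_surj q.
by have [z ->] := dproj_surj r; rewrite !dprojM mulrA.
Qed.

Lemma dquot_mul1l : left_id (dproj 1) dquot_mul.
Proof. by move=> p; have [x ->] := dproj_surj p; rewrite dprojM mul1r. Qed.

Lemma dquot_mul1r : right_id (dproj 1) dquot_mul.
Proof. by move=> p; have [x ->] := dproj_surj p; rewrite dprojM mulr1. Qed.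

Lemma dquot_mulDl : left_distributive dquot_mul +%R.
Proof.
move=> p q r; have [x ->] := dproj_surj p; have [y ->] := dproj_surj q.
by have [z ->] := dproj_surj r; rewrite -dprojD !dprojM mulrDl dprojD.
Qed.

Lemma dquot_mulDr : right_distributive dquot_mul +%R.
Proof.
move=> r p q; have [x ->] := dproj_surj p; have [y ->] := dproj_surj q.
by have [z ->] := dproj_surj r; rewrite -dprojD !dprojM mulrDr dprojD.
Qed.

HB.instance Definition _ := GRing.Zmodule_isPzRing.Build dquot
  dquot_mulA dquot_mul1l dquot_mul1r dquot_mulDl dquot_mulDr.

Definition dquot_homog (d : int) (p : dquot) : Prop :=
  exists2 x : C, homog d x & p = dproj x.

Definition dquot_comp d (p : dquot) : dquot := dproj (hcomp d (repr p)).

Lemma dquot_comp_proj d x : dquot_comp d (dproj x) = dproj (hcomp d x).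
Proof.
apply/dprojP; rewrite -raddfB; apply: gideal_comp.
by apply/dprojP; rewrite /dproj reprK.
Qed.

Lemma dquot_homog0 d : dquot_homog d 0.
Proof. by exists 0; [apply: homog0|rewrite dproj0]. Qed.

Lemma dquot_homogB d p q :
  dquot_homog d p -> dquot_homog d q -> dquot_homog d (p - q).
Proof.
move=> [x hx ->] [y hy ->]; exists (x - y); first exact: homogB.
by rewrite dprojB.
Qed.

Lemma dquot_homog1 : dquot_homog 0 1.
Proof. by exists 1; first exact: homog1. Qed.

Lemma dquot_homogM d e p q :
  dquot_homog d p -> dquot_homog e q -> dquot_homog (d + e) (p * q).
Proof.
move=> [x hx ->] [y hy ->]; exists (x * y); first exact: homogM.
exact: dprojM.
Qed.

Lemma dquot_decomp p : exists! f, is_decomposition dquot_homog p f.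
Proof.
apply: (decomp_from_proj (p := dquot_comp)) => {p}.
- move=> d p q; have [x ->] := dproj_surj p; have [y ->] := dproj_surj q.
  by rewrite -dprojD !dquot_comp_proj raddfD dprojD.
- move=> d p; have [x ->] := dproj_surj p; rewrite dquot_comp_proj.
  by exists (hcomp d x) => //; apply: homog_comp.
- move=> d e _ [x hx ->]; rewrite dquot_comp_proj (hcomp_homog _ hx).
  by case: ifP => // _; apply: dproj0.
- move=> P P0 PD Ph p; have [x ->] := dproj_surj p.
  elim/homog_ind: x => [|x y hx hy|d x hx]; first by rewrite dproj0.
  + by rewrite dprojD; apply: PD.
  + by apply: (Ph d); exists x.
Qed.

Lemma dquot_homogC d e p q :
  dquot_homog d p -> dquot_homog e q -> p * q = (q * p) *~ koszul d e.
Proof.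
move=> [x hx ->] [y hy ->].
have hM u v : dproj u * dproj v = dproj (u * v) by exact: dprojM.
rewrite !hM (homogC _ _ _ _ hx hy) koszulE.
by case: (_ && _); rewrite /= ?expr0 ?expr1 ?mulr1z // !mulrN1z dprojN.
Qed.

HB.instance Definition _ := PzRing_isDirac.Build dquot
  dquot_homog0 dquot_homogB dquot_homog1 dquot_homogM dquot_decomp dquot_homogC.

Definition dproj_hom : diracHom C dquot.
Proof.
refine (@build_hom C dquot dproj dprojB erefl _ _).
- by move=> x y; rewrite -dprojM.
- by move=> d x hx; exists x.
Defined.

End DiracQuotient.

Section EvenPart.
Variable A : diracRingType.

Definition even_pred (x : A) : bool :=
  `[< forall d, odd (absz d) -> hcomp d x = 0 >].

Lemma even_zmod_closed : zmod_closed even_pred.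
Proof.
split; first by apply/asboolP => d _; rewrite raddf0.
move=> x y /asboolP hx /asboolP hy; apply/asboolP => d hd.
by rewrite raddfB /= hx // hy // subrr.
Qed.

Lemma even_pred_homog d (x : A) : ~~ odd (absz d) -> homog d x -> even_pred x.
Proof.
move=> hd hx; apply/asboolP => e he; rewrite (hcomp_homog _ hx).
by case: eqP => // ed; rewrite -ed he in hd.
Qed.

Lemma even_pred_comp d (x : A) : even_pred x -> even_pred (hcomp d x).
Proof.
move=> /asboolP hx; case: (boolP (odd (absz d))) => hd.
  by rewrite hx //; have [] := even_zmod_closed.
exact/(even_pred_homog hd)/homog_comp.
Qed.

Lemma even_pred_sum (I : Type) (s : seq I) (F : I -> A) :
  (forall i, even_pred (F i)) -> even_pred (\sum_(i <- s) F i).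
Proof.
move=> h; have [h0 hB] := even_zmod_closed.
elim/big_ind: _ => // x y hx hy; rewrite -[y]opprK -(sub0r y).
by do 2!apply: (hB) => //.
Qed.

Lemma even_predM x y : even_pred x -> even_pred y -> even_pred (x * y).
Proof.
move=> hx hy; rewrite [x]hsum_id [y]hsum_id /hsum mulr_suml.
apply: even_pred_sum => d; rewrite mulr_sumr; apply: even_pred_sum => e.
have [h0 _] := even_zmod_closed.
move: hx hy => /asboolP hx /asboolP hy.
case: (boolP (odd (absz d))) => hd; first by rewrite hx // mul0r.
case: (boolP (odd (absz e))) => he; first by rewrite hy // mulr0.
apply: (@even_pred_homog (d + e)); first by rewrite oddzD (negbTE hd).
exact/homogM/homog_comp/homog_comp.
Qed.

Lemma even_subring_closed : subring_closed even_pred.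
Proof.
split; [|by have [] := even_zmod_closed|exact: even_predM].
by rewrite unfold_in; apply: (@even_pred_homog 0) => //; apply: homog1.
Qed.

HB.instance Definition _ :=
  GRing.isSubringClosed.Build A even_pred even_subring_closed.

(* The subring of the elements whose homogeneous components of odd degree
   vanish, that is, the sums of homogeneous elements of even degree. *)
Record even_part : Type := EvenPart {even_val :> A; _ : even_pred even_val}.

HB.instance Definition _ := [isSub for even_val].
HB.instance Definition _ := [Choice of even_part by <:].
HB.instance Definition _ :=
  GRing.SubChoice_isSubPzRing.Build A even_pred even_part even_subring_closed.

Definition even_homog (d : int) (x : even_part) : Prop := homog d (even_val x).

Definition even_comp d (x : even_part) : even_part :=
  EvenPart (even_pred_comp d (valP x)).

Lemma even_decomp x : exists! f, is_decomposition even_homog x f.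
Proof.
apply: (decomp_from_proj (p := even_comp)) => {x}.
- by move=> d x y; apply: val_inj; rewrite /= raddfD.
- by move=> d x; apply: homog_comp.
- move=> d e x hx; apply: val_inj; rewrite /= (hcomp_homog _ hx).
  by case: ifP.
- move=> P P0 PD Ph x.
  have -> : x = \sum_(d <- hsupp (even_val x)) even_comp d x.
    apply: val_inj; rewrite raddf_sum /= {1}[even_val x]hsum_id.
    by apply: eq_bigr.
  by elim/big_ind: _ => // d _; apply: (Ph d); apply: homog_comp.
Qed.

Lemma even_homog0 d : even_homog d 0.
Proof. exact: homog0. Qed.

Lemma even_homogB d x y : even_homog d x -> even_homog d y -> even_homog d (x - y).
Proof. exact: homogB. Qed.

Lemma even_homog1 : even_homog 0 1.
Proof. exact: homog1. Qed.

Lemma even_homogM d e x y :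
  even_homog d x -> even_homog e y -> even_homog (d + e) (x * y).
Proof. exact: homogM. Qed.

Lemma even_homogC d e x y :
  even_homog d x -> even_homog e y -> x * y = (y * x) *~ koszul d e.
Proof.
move=> hx hy; apply: val_inj; rewrite raddfMz /=.
exact: (homogC _ _ _ _ hx hy).
Qed.

HB.instance Definition _ := PzRing_isDirac.Build even_part
  even_homog0 even_homogB even_homog1 even_homogM even_decomp even_homogC.

Lemma even_valB (x y : even_part) : even_val (x - y) = even_val x - even_val y.
Proof. by []. Qed.

Definition even_incl : diracHom even_part A :=
  @build_hom even_part A even_val even_valB erefl (fun _ _ => erefl)
    (fun _ _ h => h).
End EvenPart.

Lemma add_fun0 (U V : zmodType) (f : U -> V) :
  (forall x y, f (x + y) = f x + f y) -> f 0 = 0.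
Proof. by move=> fD; apply: (addIr (f 0)); rewrite -fD !add0r. Qed.

Lemma add_funN (U V : zmodType) (f : U -> V) :
  (forall x y, f (x + y) = f x + f y) -> forall x, f (- x) = - f x.
Proof.
by move=> fD x; apply: (addIr (f x)); rewrite -fD !addNr; apply: add_fun0.
Qed.

Lemma add_funMz (U V : zmodType) (f : U -> V) :
  (forall x y, f (x + y) = f x + f y) ->
  forall x (n : int), f (x *~ n) = f x *~ n.
Proof.
move=> fD x n; have h (m : nat) : f (x *+ m) = f x *+ m.
  by elim: m => [|m IH]; rewrite ?mulr0n ?mulrS ?(add_fun0 fD) // fD IH.
by case: n => n; [apply: h|rewrite NegzE !mulrNz (add_funN fD); congr (- _); apply: h].
Qed.

Lemma homog_ext (A : diracRingType) (V : zmodType) (f g : A -> V) :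
  (forall x y, f (x + y) = f x + f y) -> (forall x y, g (x + y) = g x + g y) ->
  (forall d x, homog d x -> f x = g x) -> f =1 g.
Proof.
move=> fD gD h x; elim/homog_ind: x => [|x y hx hy|d x]; last exact: h.
  by rewrite !add_fun0.
by rewrite fD gD hx hy.
Qed.

Section Tensor.
Variables (R A B : diracRingType) (f : diracHom R A) (g : diracHom R B).

Inductive tensor_rel : seq (A * B) -> seq (A * B) -> Prop :=
| tensor_addl a a' b : tensor_rel [:: (a + a', b)] [:: (a, b); (a', b)]
| tensor_addr a b b' : tensor_rel [:: (a, b + b')] [:: (a, b); (a, b')]
| tensor_bal a r b : tensor_rel [:: (a * f r, b)] [:: (a, g r * b)].

(* The tensor product of [A] and [B] over [R]; see [tens_desc] and
   [tens_hom_ext] for its universal property as a Dirac ring. *)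
Definition tensor := pres tensor_rel.
HB.instance Definition _ := GRing.Zmodule.on tensor.

Definition tens (a : A) (b : B) : tensor := pgen tensor_rel (a, b).

Lemma tensDl a a' b : tens (a + a') b = tens a b + tens a' b.
Proof. by have := pgen_rel (tensor_addl a a' b); rewrite !big_cons !big_nil !addr0. Qed.

Lemma tensDr a b b' : tens a (b + b') = tens a b + tens a b'.
Proof. by have := pgen_rel (tensor_addr a b b'); rewrite !big_cons !big_nil !addr0. Qed.

Lemma tens_bal a r b : tens (a * f r) b = tens a (g r * b).
Proof. by have := pgen_rel (tensor_bal a r b); rewrite !big_seq1. Qed.

Lemma tens0l b : tens 0 b = 0.
Proof. exact: (add_fun0 (f := tens^~ b) (fun x y => tensDl x y b)). Qed.
Lemma tens0r a : tens a 0 = 0.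
Proof. exact: (add_fun0 (tensDr a)). Qed.
Lemma tensMzl a b n : tens (a *~ n) b = tens a b *~ n.
Proof. exact: (add_funMz (f := tens^~ b) (fun x y => tensDl x y b)). Qed.
Lemma tensMzr a b n : tens a (b *~ n) = tens a b *~ n.
Proof. exact: (add_funMz (tensDr a)). Qed.

Section TLift.
Variables (V : zmodType) (k : A -> B -> V).
Hypothesis kDl : forall a a' b, k (a + a') b = k a b + k a' b.
Hypothesis kDr : forall a b b', k a (b + b') = k a b + k a b'.
Hypothesis kbal : forall a r b, k (a * f r) b = k a (g r * b).

Lemma tensor_rel_lift s t : tensor_rel s t ->
  \sum_(x <- s) k x.1 x.2 = \sum_(x <- t) k x.1 x.2.
Proof. by case=> *; rewrite ?big_cons ?big_nil /= ?addr0; auto. Qed.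
End TLift.

Lemma tensor_ind (P : tensor -> Prop) :
  P 0 -> (forall a b, P (tens a b)) -> (forall p q, P p -> P q -> P (p - q)) ->
  forall p, P p.
Proof. move=> P0 Pg PB; apply: pres_ind' => //; by [move=> [a b]; apply: Pg|apply: PB]. Qed.

(* (a ⊗ b) (a' ⊗ b') = (-1)^(|b| |a'|) aa' ⊗ bb' for homogeneous b and a' *)
Definition tens_mul (x y : A * B) : tensor :=
  hsum (fun i b => hsum (fun j a' =>
    tens (x.1 * a') (b * y.2) *~ koszul i j) y.1) x.2.

Let F1 (a a' : A) (b' : B) (i : int) (b : B) : tensor :=
  hsum (fun j a' => tens (a * a') (b * b') *~ koszul i j) a'.

Let in1D a b b' i j x y : tens (a * (x + y)) (b * b') *~ koszul i j =
  tens (a * x) (b * b') *~ koszul i j + tens (a * y) (b * b') *~ koszul i j.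
Proof. by rewrite mulrDr tensDl mulrzDl. Qed.

Let F1D a a' b' i b1 b2 : F1 a a' b' i (b1 + b2) = F1 a a' b' i b1 + F1 a a' b' i b2.
Proof.
rewrite /F1 /hsum -big_split /=; apply: eq_bigr => j _.
by rewrite mulrDl tensDr mulrzDl.
Qed.

Let tmulE a b a' b' : tens_mul (a, b) (a', b') = hsum (F1 a a' b') b.
Proof. by []. Qed.

Lemma tens_mul_homog i j a b a' b' : homog i b -> homog j a' ->
  tens_mul (a, b) (a', b') = tens (a * a') (b * b') *~ koszul i j.
Proof.
move=> hb ha'; rewrite tmulE (hsum_homog _ hb); last exact: F1D.
by rewrite /F1 (hsum_homog _ ha') //; exact: in1D.
Qed.

Let M1 a1 a2 b x : tens_mul (a1 + a2, b) x = tens_mul (a1, b) x + tens_mul (a2, b) x.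
Proof.
rewrite /tens_mul /hsum -big_split /=; apply: eq_bigr => i _.
rewrite -big_split /=; apply: eq_bigr => j _.
by rewrite mulrDl tensDl mulrzDl.
Qed.

Let M2 a b1 b2 x : tens_mul (a, b1 + b2) x = tens_mul (a, b1) x + tens_mul (a, b2) x.
Proof. by case: x => a' b'; rewrite !tmulE hsumD //; exact: F1D. Qed.

Let M3 x a1 a2 b : tens_mul x (a1 + a2, b) = tens_mul x (a1, b) + tens_mul x (a2, b).
Proof.
case: x => a' b'; rewrite !tmulE /hsum -big_split /=; apply: eq_bigr => i _.
by rewrite /F1 hsumD //; exact: in1D.
Qed.

Let M4 x a b1 b2 : tens_mul x (a, b1 + b2) = tens_mul x (a, b1) + tens_mul x (a, b2).
Proof.
rewrite /tens_mul /hsum -big_split /=; apply: eq_bigr => i _.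
rewrite -big_split /=; apply: eq_bigr => j _.
by rewrite mulrDr tensDr mulrzDl.
Qed.

Let mull s t y : tensor_rel s t ->
  \sum_(x <- s) tens_mul x y = \sum_(x <- t) tens_mul x y.
Proof.
case: y => a' b'; case=> [a1 a2 b|a b1 b2|a r b].
- by rewrite !big_cons !big_nil !addr0 M1.
- by rewrite !big_cons !big_nil !addr0 M2.
rewrite !big_seq1.
move: r; apply: (homog_ext (f := fun r => tens_mul (a * f r, b) (a', b'))
  (g := fun r => tens_mul (a, g r * b) (a', b'))) => [r r'|r r'|k r hr].
- by rewrite rmorphD mulrDr M1.
- by rewrite rmorphD mulrDl M2.
move: b; apply: (homog_ext (f := fun b => tens_mul (a * f r, b) (a', b'))
  (g := fun b => tens_mul (a, g r * b) (a', b'))) => [c c'|c c'|i b hb].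
- by rewrite M2.
- by rewrite mulrDr M2.
move: a'; apply: (homog_ext (f := fun a' => tens_mul (a * f r, b) (a', b'))
  (g := fun a' => tens_mul (a, g r * b) (a', b'))) => [c c'|c c'|j a' ha'].
- by rewrite M3.
- by rewrite M3.
have hfr := dirac_homog f hr; have hgr := dirac_homog g hr.
rewrite (tens_mul_homog _ _ hb ha') (tens_mul_homog _ _ (homogM _ _ _ _ hgr hb) ha').
rewrite -[a * f r * a']mulrA (homogC _ _ _ _ hfr ha') mulrzAr mulrA tensMzl tens_bal.
by rewrite koszulDl mulrzA -mulrA.
Qed.

Let mulr s t x : tensor_rel s t ->
  \sum_(y <- s) tens_mul x y = \sum_(y <- t) tens_mul x y.
Proof.
case: x => a' b'; case=> [a1 a2 b|a b1 b2|a r b].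
- by rewrite !big_cons !big_nil !addr0 M3.
- by rewrite !big_cons !big_nil !addr0 M4.
rewrite !big_seq1.
move: r; apply: (homog_ext (f := fun r => tens_mul (a', b') (a * f r, b))
  (g := fun r => tens_mul (a', b') (a, g r * b))) => [r r'|r r'|k r hr].
- by rewrite rmorphD mulrDr M3.
- by rewrite rmorphD mulrDl M4.
move: a; apply: (homog_ext (f := fun a => tens_mul (a', b') (a * f r, b))
  (g := fun a => tens_mul (a', b') (a, g r * b))) => [c c'|c c'|i a ha].
- by rewrite mulrDl M3.
- by rewrite M3.
move: b'; apply: (homog_ext (f := fun b' => tens_mul (a', b') (a * f r, b))
  (g := fun b' => tens_mul (a', b') (a, g r * b))) => [c c'|c c'|j b' hb'].
- by rewrite M2.
- by rewrite M2.
have hfr := dirac_homog f hr; have hgr := dirac_homog g hr.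
rewrite (tens_mul_homog _ _ hb' ha) (tens_mul_homog _ _ hb' (homogM _ _ _ _ ha hfr)).
rewrite [a' * (a * _)]mulrA tens_bal [b' * (_ * _)]mulrA (homogC _ _ _ _ hb' hgr) mulrzAl tensMzr.
by rewrite koszulDr mulrzA mulrzAC -(mulrA (g r)).
Qed.

Definition tensor_mul : tensor -> tensor -> tensor := pres_mul tens_mul.

Lemma tensor_mul_tens a b a' b' :
  tensor_mul (tens a b) (tens a' b') = tens_mul (a, b) (a', b').
Proof. exact: (pres_mul_gen mull mulr). Qed.

Lemma tensor_mulDl : left_distributive tensor_mul +%R.
Proof. exact: (pres_mulDl mull mulr). Qed.

Lemma tensor_mulDr : right_distributive tensor_mul +%R.
Proof. exact: (pres_mulDr mull mulr). Qed.

Let tmMzl p q n : tensor_mul (p *~ n) q = tensor_mul p q *~ n.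
Proof. exact: (add_funMz (f := tensor_mul^~ q) (fun x y => tensor_mulDl x y q)). Qed.
Let tmMzr p q n : tensor_mul p (q *~ n) = tensor_mul p q *~ n.
Proof. exact: (add_funMz (fun x y => tensor_mulDr p x y)). Qed.

Lemma tensor_mulA : associative tensor_mul.
Proof.
apply: (pres_mulA_gen mull mulr) => -[a b] [a' b'] [a'' b''].
rewrite -/tensor_mul -![pgen _ _]/(tens _ _).
move: b; apply: (homog_ext
  (f := fun b => tensor_mul (tens_mul (a, b) (a', b')) (tens a'' b''))
  (g := fun b => tensor_mul (tens a b) (tens_mul (a', b') (a'', b''))))
  => [c c'|c c'|i b hb].
- by rewrite M2 tensor_mulDl.
- by rewrite tensDr tensor_mulDl.
move: a'; apply: (homog_ext
  (f := fun a' => tensor_mul (tens_mul (a, b) (a', b')) (tens a'' b''))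
  (g := fun a' => tensor_mul (tens a b) (tens_mul (a', b') (a'', b''))))
  => [c c'|c c'|j a' ha'].
- by rewrite M3 tensor_mulDl.
- by rewrite M1 tensor_mulDr.
move: b'; apply: (homog_ext
  (f := fun b' => tensor_mul (tens_mul (a, b) (a', b')) (tens a'' b''))
  (g := fun b' => tensor_mul (tens a b) (tens_mul (a', b') (a'', b''))))
  => [c c'|c c'|k b' hb'].
- by rewrite M4 tensor_mulDl.
- by rewrite M2 tensor_mulDr.
move: a''; apply: (homog_ext
  (f := fun a'' => tensor_mul (tens_mul (a, b) (a', b')) (tens a'' b''))
  (g := fun a'' => tensor_mul (tens a b) (tens_mul (a', b') (a'', b''))))
  => [c c'|c c'|l a'' ha''].
- by rewrite tensDl tensor_mulDr.
- by rewrite M3 tensor_mulDr.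
rewrite (tens_mul_homog _ _ hb ha') (tens_mul_homog _ _ hb' ha'').
rewrite tmMzl tmMzr !tensor_mul_tens.
rewrite (tens_mul_homog _ _ (homogM _ _ _ _ hb hb') ha'').
rewrite (tens_mul_homog _ _ hb (homogM _ _ _ _ ha' ha'')).
rewrite -!mulrzA !mulrA; congr (_ *~ _).
rewrite koszulDl koszulDr -mulrA [RHS]mulrC mulrCA; congr (_ * _).
exact: mulrC.
Qed.

Lemma tensor_mul1l : left_id (tens 1 1) tensor_mul.
Proof.
elim/tensor_ind => [|a b|p q hp hq].
- exact: (add_fun0 (tensor_mulDr _)).
- rewrite tensor_mul_tens.
  move: a; apply: (homog_ext (f := fun a => tens_mul (1, 1) (a, b))
    (g := tens^~ b)) => [c c'|c c'|i a ha].
  + exact: M3.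
  + exact: tensDl.
  by rewrite (tens_mul_homog _ _ (@homog1 B) ha) koszul0l !mul1r.
- have h := add_funN (tensor_mulDr (tens 1 1)).
  by rewrite tensor_mulDr h hp hq.
Qed.

Lemma tensor_mul1r : right_id (tens 1 1) tensor_mul.
Proof.
elim/tensor_ind => [|a b|p q hp hq].
- exact: (add_fun0 (f := tensor_mul^~ _) (fun x y => tensor_mulDl x y _)).
- rewrite tensor_mul_tens.
  move: b; apply: (homog_ext (f := fun b => tens_mul (a, b) (1, 1))
    (g := tens a)) => [c c'|c c'|i b hb].
  + exact: M2.
  + exact: tensDr.
  by rewrite (tens_mul_homog _ _ hb (@homog1 A)) koszul0r !mulr1.
- have h := add_funN (f := tensor_mul^~ (tens 1 1)) (fun x y => tensor_mulDl x y _).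
  by rewrite tensor_mulDl h hp hq.
Qed.

HB.instance Definition _ := GRing.Zmodule_isPzRing.Build tensor
  tensor_mulA tensor_mul1l tensor_mul1r tensor_mulDl tensor_mulDr.

Lemma tensM i j a b a' b' : homog i b -> homog j a' ->
  tens a b * tens a' b' = tens (a * a') (b * b') *~ koszul i j.
Proof.
by move=> hb ha'; rewrite -[LHS]/(tensor_mul _ _) tensor_mul_tens; apply: tens_mul_homog.
Qed.

Definition tens_homog (d : int) (p : tensor) : Prop :=
  exists i j a b, [/\ homog i a, homog j b, i + j = d & p = tens a b].

Definition tensor_homog (d : int) : tensor -> Prop := zspan (tens_homog d).

Lemma tens_homog_in i j a b : homog i a -> homog j b ->
  tensor_homog (i + j) (tens a b).
Proof. by move=> ha hb; apply: zspan_gen; exists i, j, a, b. Qed.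

Lemma tensor_homog0 d : tensor_homog d 0.
Proof. exact: zspan0. Qed.

Lemma tensor_homogB d p q :
  tensor_homog d p -> tensor_homog d q -> tensor_homog d (p - q).
Proof. exact: zspanB. Qed.

Lemma tensor_homog1 : tensor_homog 0 1.
Proof. by rewrite -[X in tensor_homog X]addr0; apply: tens_homog_in; apply: homog1. Qed.

Lemma tensor_homogMz d p n : tensor_homog d p -> tensor_homog d (p *~ n).
Proof.
move=> hp; have hD := addr_of_subr (tensor_homog0 d) (@tensor_homogB d).
have h (m : nat) : tensor_homog d (p *+ m).
  by elim: m => [|m IH]; rewrite ?mulr0n ?mulrS; [apply: zspan0|apply: hD].
case: n => n; first exact: h.
by rewrite NegzE mulrNz -sub0r; apply: zspanB; [apply: zspan0|apply: h].
Qed.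

Lemma tensor_homogM d e p q :
  tensor_homog d p -> tensor_homog e q -> tensor_homog (d + e) (p * q).
Proof.
move=> hp hq; elim: hp => [|{}p [i [j [a [b [ha hb <- ->]]]]]|p1 p2 _ h1 _ h2].
- by rewrite mul0r; apply: zspan0.
- elim: hq => [|{}q [i' [j' [a' [b' [ha' hb' <- ->]]]]]|q1 q2 _ h1 _ h2].
  + by rewrite mulr0; apply: zspan0.
  + rewrite (tensM _ _ hb ha'); apply: tensor_homogMz.
    by rewrite addrACA; apply: tens_homog_in; apply: homogM.
  + by rewrite mulrBr; apply: zspanB.
- by rewrite mulrBl; apply: zspanB.
Qed.

Lemma tensor_homogC d e p q :
  tensor_homog d p -> tensor_homog e q -> p * q = (q * p) *~ koszul d e.
Proof.
move=> hp hq; elim: hp => [|{}p [i [j [a [b [ha hb <- ->]]]]]|p1 p2 _ h1 _ h2].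
- by rewrite mul0r mulr0 mul0rz.
- elim: hq => [|{}q [i' [j' [a' [b' [ha' hb' <- ->]]]]]|q1 q2 _ h1 _ h2].
  + by rewrite mul0r mulr0 mul0rz.
  + rewrite (tensM _ _ hb ha') (tensM _ _ hb' ha).
    rewrite (homogC _ _ _ _ ha ha') (homogC _ _ _ _ hb hb').
    rewrite tensMzl tensMzr -!mulrzA; congr (_ *~ _).
    rewrite !koszulDl !koszulDr (koszulC j' i).
    rewrite [RHS]mulrA [koszul i i' * koszul i j']mulrC [koszul i j' * (_ * _)]mulrA koszulK mul1r.
    by rewrite [LHS]mulrC -mulrA.
  + by rewrite mulrBr mulrBl mulrzBl h1 h2.
- by rewrite mulrBr mulrBl mulrzBl h1 h2.
Qed.

Definition tens_proj (d : int) (a : A) (b : B) : tensor :=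
  hsum (fun i a => tens a (hcomp (d - i) b)) a.

Let PJ1 d a a' b : tens_proj d (a + a') b = tens_proj d a b + tens_proj d a' b.
Proof. by apply: hsumD => *; apply: tensDl. Qed.

Let PJ2 d a b b' : tens_proj d a (b + b') = tens_proj d a b + tens_proj d a b'.
Proof.
rewrite /tens_proj /hsum -big_split; apply: eq_bigr => i _.
by rewrite raddfD tensDr.
Qed.

Let PJh d i a b : homog i a -> tens_proj d a b = tens a (hcomp (d - i) b).
Proof. by move=> ha; rewrite /tens_proj (hsum_homog _ ha) // => *; apply: tensDl. Qed.

Let PJ3 d a r b : tens_proj d (a * f r) b = tens_proj d a (g r * b).
Proof.
move: r; apply: (homog_ext (f := fun r => tens_proj d (a * f r) b)
  (g := fun r => tens_proj d a (g r * b))) => [r r'|r r'|k r hr].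
- by rewrite rmorphD mulrDr PJ1.
- by rewrite rmorphD mulrDl PJ2.
move: a; apply: (homog_ext (f := fun a => tens_proj d (a * f r) b)
  (g := fun a => tens_proj d a (g r * b))) => [c c'|c c'|i a ha].
- by rewrite mulrDl PJ1.
- by rewrite PJ1.
have hfr := dirac_homog f hr; have hgr := dirac_homog g hr.
rewrite (PJh _ _ ha) (PJh _ _ (homogM _ _ _ _ ha hfr)) tens_bal; congr tens.
move: b; apply: (homog_ext (f := fun b => g r * hcomp _ b)
  (g := fun b => hcomp _ (g r * b))) => [c c'|c c'|j b hb].
- by rewrite raddfD mulrDr.
- by rewrite mulrDr raddfD.
rewrite (hcomp_homog _ hb) (hcomp_homog _ (homogM _ _ _ _ hgr hb)).
have -> : (d - i == k + j) = (d - (i + k) == j).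
  by rewrite opprD addrA [RHS]subr_eq [j + k]addrC.
by case: ifP => // _; rewrite mulr0.
Qed.

Definition tensor_proj (d : int) : tensor -> tensor :=
  pres_lift (fun x => tens_proj d x.1 x.2).

Let prel d := tensor_rel_lift (@PJ1 d) (@PJ2 d) (@PJ3 d).

Lemma tensor_projD d p q : tensor_proj d (p + q) = tensor_proj d p + tensor_proj d q.
Proof. by apply: pres_liftD => s t; apply: prel. Qed.

Lemma tensor_proj_tens d a b : tensor_proj d (tens a b) = tens_proj d a b.
Proof. by rewrite /tensor_proj pres_lift_gen // => s t; apply: prel. Qed.

Let projN d := add_funN (tensor_projD d).

Lemma tensor_decomp p : exists! c, is_decomposition tensor_homog p c.
Proof.
apply: (decomp_from_proj (p := tensor_proj)) => {p}.
- exact: tensor_projD.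
- move=> d; elim/tensor_ind => [|a b|p q hp hq].
  + by rewrite (add_fun0 (tensor_projD d)); apply: zspan0.
  + rewrite tensor_proj_tens; elim/homog_ind: a => [|a a' ha ha'|i a ha].
    * by rewrite (PJh _ _ (homog0 0)) tens0l; apply: zspan0.
    * by rewrite PJ1; apply: (addr_of_subr (tensor_homog0 d) (@tensor_homogB d)).
    * rewrite (PJh _ _ ha) -[X in tensor_homog X](subrK i) addrC.
      exact/tens_homog_in/homog_comp.
  + by rewrite tensor_projD projN; apply: zspanB.
- move=> d e p; elim=> [|{}p [i [j [a [b [ha hb <- ->]]]]]|p1 p2 _ h1 _ h2].
  + by rewrite (add_fun0 (tensor_projD e)); case: ifP.
  + rewrite tensor_proj_tens (PJh _ _ ha) (hcomp_homog _ hb) subr_eq [j + i]addrC.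
    by case: ifP => // _; rewrite tens0r.
  + by rewrite tensor_projD projN h1 h2; case: ifP => // _; rewrite subr0.
- move=> P P0 PD Ph p.
  have Pt a b : P (tens a b).
    elim/homog_ind: a => [|a a' ha ha'|i a ha]; first by rewrite tens0l.
      by rewrite tensDl; apply: PD.
    elim/homog_ind: b => [|b b' hb hb'|j b hb]; first by rewrite tens0r.
      by rewrite tensDr; apply: PD.
    by apply: (Ph (i + j)); apply: tens_homog_in.
  suff [] : P p /\ P (- p) by [].
  elim/tensor_ind: p => [|a b|p q [hp hp'] [hq hq']].
  + by rewrite oppr0.
  + split=> //; rewrite -[tens a b]/((tens^~ b) a).
    by rewrite -(add_funN (f := tens^~ b) (fun x y => tensDl x y b)).
  + by rewrite opprB; split; apply: PD.
Qed.

HB.instance Definition _ := PzRing_isDirac.Build tensor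
  tensor_homog0 tensor_homogB tensor_homog1 tensor_homogM tensor_decomp
  tensor_homogC.

Lemma tens1M a b : tens a 1 * tens 1 b = tens a b.
Proof. by rewrite (tensM _ _ (@homog1 B) (@homog1 A)) koszul0l mulr1 mul1r. Qed.

Let inlB x y : tens (x - y) 1 = tens x 1 - tens y 1.
Proof.
by rewrite tensDl; congr (_ + _); exact: (add_funN (f := tens^~ 1) (fun x y => tensDl x y 1)).
Qed.

Let inlM x y : tens (x * y) 1 = tens x 1 * tens y 1.
Proof.
move: y; apply: (homog_ext (f := fun y => tens (x * y) 1)
  (g := fun y => tens x 1 * tens y 1)) => [c c'|c c'|d y hy].
- by rewrite mulrDr tensDl.
- by rewrite tensDl mulrDr.
by rewrite (tensM _ _ (@homog1 B) hy) koszul0l mulr1.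
Qed.

Let inlh d x : homog d x -> homog d (tens x 1).
Proof. by move=> hx; rewrite -[d]addr0; apply: tens_homog_in (@homog1 B). Qed.

Definition tens_inl : diracHom A tensor :=
  @build_hom A tensor (fun a => tens a 1) inlB erefl inlM inlh.

Let inrB x y : tens 1 (x - y) = tens 1 x - tens 1 y.
Proof. by rewrite tensDr; congr (_ + _); apply: (add_funN (tensDr 1)). Qed.

Let inrM x y : tens 1 (x * y) = tens 1 x * tens 1 y.
Proof.
move: x; apply: (homog_ext (f := fun x => tens 1 (x * y))
  (g := fun x => tens 1 x * tens 1 y)) => [c c'|c c'|d x hx].
- by rewrite mulrDl tensDr.
- by rewrite tensDr mulrDl.
by rewrite (tensM _ _ hx (@homog1 A)) koszul0r mulr1.
Qed.

Let inrh d x : homog d x -> homog d (tens 1 x).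
Proof. by move=> hx; rewrite -[d]add0r; apply: tens_homog_in (@homog1 A) _. Qed.

Definition tens_inr : diracHom B tensor :=
  @build_hom B tensor (fun b => tens 1 b) inrB erefl inrM inrh.

Lemma tens_inlr r : tens_inl (f r) = tens_inr (g r).
Proof.
by rewrite /= /build_fun /= -[f r]mul1r tens_bal mulr1.
Qed.

Section UniversalProperty.
Variables (C : diracRingType) (h : diracHom A C) (k : diracHom B C).
Hypothesis hk : forall r, h (f r) = k (g r).

Let L (a : A) (b : B) : C := h a * k b.
Let L1 a a' b : L (a + a') b = L a b + L a' b.
Proof. by rewrite /L rmorphD mulrDl. Qed.
Let L2 a b b' : L a (b + b') = L a b + L a b'.
Proof. by rewrite /L rmorphD mulrDr. Qed.
Let L3 a r b : L (a * f r) b = L a (g r * b).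
Proof. by rewrite /L !rmorphM hk mulrA. Qed.
Let Lrel := tensor_rel_lift L1 L2 L3.

Definition tens_desc_fun : tensor -> C := pres_lift (fun x => h x.1 * k x.2).

Lemma tens_desc_tens a b : tens_desc_fun (tens a b) = h a * k b.
Proof. exact: (pres_lift_gen Lrel). Qed.

Lemma tens_descB p q : tens_desc_fun (p - q) = tens_desc_fun p - tens_desc_fun q.
Proof. exact: (pres_liftB Lrel). Qed.

Let descD p q : tens_desc_fun (p + q) = tens_desc_fun p + tens_desc_fun q.
Proof. exact: (pres_liftD Lrel). Qed.

Lemma tens_desc1 : tens_desc_fun 1 = 1.
Proof. by rewrite -[X in tens_desc_fun X = _]/(tens 1 1) tens_desc_tens !rmorph1 mulr1. Qed.

Lemma tens_descM p q : tens_desc_fun (p * q) = tens_desc_fun p * tens_desc_fun q.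
Proof.
have d0 : tens_desc_fun 0 = 0 by exact: (pres_lift0 Lrel).
elim/tensor_ind: p => [|a b|p p' hp hp'].
- by rewrite mul0r d0 mul0r.
- elim/tensor_ind: q => [|a' b'|q q' hq hq'].
  + by rewrite mulr0 d0 mulr0.
  + move: b; apply: (homog_ext
      (f := fun b => tens_desc_fun (tens a b * tens a' b'))
      (g := fun b => tens_desc_fun (tens a b) * tens_desc_fun (tens a' b')))
      => [c c'|c c'|i b hb].
    * by rewrite tensDr mulrDl descD.
    * by rewrite tensDr descD mulrDl.
    move: a'; apply: (homog_ext
      (f := fun a' => tens_desc_fun (tens a b * tens a' b'))
      (g := fun a' => tens_desc_fun (tens a b) * tens_desc_fun (tens a' b')))
      => [c c'|c c'|j a' ha'].
    * by rewrite tensDl mulrDr descD.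
    * by rewrite tensDl descD mulrDr.
    rewrite (tensM _ _ hb ha') (add_funMz descD) !tens_desc_tens !rmorphM.
    rewrite -!mulrA [k b * (_ * _)]mulrA.
    rewrite (homogC _ _ _ _ (dirac_homog k hb) (dirac_homog h ha')).
    by rewrite mulrzAl !mulrzAr -!mulrA.
  + by rewrite mulrBr !tens_descB hq hq' mulrBr.
- by rewrite mulrBl !tens_descB hp hp' mulrBl.
Qed.

Lemma tens_desc_homog d p : homog d p -> homog d (tens_desc_fun p).
Proof.
elim=> [|{}p [i [j [a [b [ha hb <- ->]]]]]|p1 p2 _ h1 _ h2].
- by rewrite (pres_lift0 Lrel : tens_desc_fun 0 = 0); apply: homog0.
- by rewrite tens_desc_tens; apply: homogM; apply: dirac_homog.
- by rewrite tens_descB; apply: homogB.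
Qed.

Definition tens_desc : diracHom tensor C :=
  @build_hom tensor C tens_desc_fun tens_descB tens_desc1 tens_descM
    tens_desc_homog.

Lemma tens_desc_inl a : tens_desc (tens_inl a) = h a.
Proof. by rewrite /= /build_fun tens_desc_tens rmorph1 mulr1. Qed.

Lemma tens_desc_inr b : tens_desc (tens_inr b) = k b.
Proof. by rewrite /= /build_fun tens_desc_tens rmorph1 mul1r. Qed.
End UniversalProperty.

Lemma tens_hom_ext (C : diracRingType) (u v : diracHom tensor C) :
  (forall a, u (tens_inl a) = v (tens_inl a)) ->
  (forall b, u (tens_inr b) = v (tens_inr b)) -> u = v.
Proof.
move=> hl hr; apply: diracHom_ext => p; elim/tensor_ind: p => [|a b|p q hp hq].
- by rewrite !rmorph0.
- by rewrite -tens1M !rmorphM; congr (_ * _); [apply: hl|apply: hr].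
- by rewrite !rmorphB hp hq.
Qed.
End Tensor.

Section FreeAlgebra.
Variables (A : diracRingType) (S : choiceType) (deg : S -> int).

Definition wdeg (w : seq S) : int := \sum_(x <- w) deg x.

Lemma wdeg_nil : wdeg [::] = 0.
Proof. exact: big_nil. Qed.

Lemma wdeg_cat v w : wdeg (v ++ w) = wdeg v + wdeg w.
Proof. exact: big_cat. Qed.

Lemma wdeg_swap u s t v : wdeg (u ++ s :: t :: v) = wdeg (u ++ t :: s :: v).
Proof. by rewrite !wdeg_cat /wdeg !big_cons (addrCA (deg s)). Qed.

(* Formal sums of pairs (a, [:: s1; ...; sn]) stand for sums of monomials
   a s1 ... sn. *)
Inductive free_rel : seq (A * seq S) -> seq (A * seq S) -> Prop :=
| free_add a b w : free_rel [:: (a + b, w)] [:: (a, w); (b, w)]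
| free_swap a u s t v :
    free_rel [:: (a, u ++ s :: t :: v)]
             [:: (a *~ koszul (deg s) (deg t), u ++ t :: s :: v)].

(* The free Dirac [A]-algebra on the graded set [S]; see [free_desc] and
   [free_hom_ext] for its universal property. *)
Definition free_alg := pres free_rel.
HB.instance Definition _ := GRing.Zmodule.on free_alg.

Definition mono (a : A) (w : seq S) : free_alg := pgen free_rel (a, w).

Lemma monoD a b w : mono (a + b) w = mono a w + mono b w.
Proof. by have := pgen_rel (free_add a b w); rewrite !big_cons !big_nil !addr0. Qed.

Lemma mono_swap a u s t v :
  mono a (u ++ s :: t :: v) =
  mono (a *~ koszul (deg s) (deg t)) (u ++ t :: s :: v).
Proof. by have := pgen_rel (free_swap a u s t v); rewrite !big_seq1. Qed.

Let mD w x y := monoD x y w.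

Lemma mono0 w : mono 0 w = 0.
Proof. exact: (add_fun0 (@mD w)). Qed.
Lemma monoN a w : mono (- a) w = - mono a w.
Proof. exact: (add_funN (@mD w)). Qed.
Lemma monoMz a w n : mono (a *~ n) w = mono a w *~ n.
Proof. exact: (add_funMz (@mD w)). Qed.

Lemma free_ind (P : free_alg -> Prop) :
  P 0 -> (forall a w, P (mono a w)) -> (forall p q, P p -> P q -> P (p - q)) ->
  forall p, P p.
Proof. move=> P0 Pg PB; apply: pres_ind' => //; by [move=> [a b]; apply: Pg|apply: PB]. Qed.

(* (a w) (a' w') = (-1)^(|w| |a'|) aa' ww' for homogeneous a' *)
Definition mono_mul (x y : A * seq S) : free_alg :=
  hsum (fun j a' => mono (x.1 * a') (x.2 ++ y.2) *~ koszul (wdeg x.2) j) y.1.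

Let in1D a w w' j x y : mono (a * (x + y)) w *~ koszul w' j =
  mono (a * x) w *~ koszul w' j + mono (a * y) w *~ koszul w' j.
Proof. by rewrite mulrDr monoD mulrzDl. Qed.

Lemma mono_mul_homog j a w a' w' : homog j a' ->
  mono_mul (a, w) (a', w') = mono (a * a') (w ++ w') *~ koszul (wdeg w) j.
Proof. by move=> ha'; rewrite /mono_mul (hsum_homog _ ha') // => *; apply: in1D. Qed.

Let M1 a1 a2 w x : mono_mul (a1 + a2, w) x = mono_mul (a1, w) x + mono_mul (a2, w) x.
Proof.
rewrite /mono_mul /hsum -big_split /=; apply: eq_bigr => i _.
by rewrite mulrDl monoD mulrzDl.
Qed.

Let M3 x a1 a2 w : mono_mul x (a1 + a2, w) = mono_mul x (a1, w) + mono_mul x (a2, w).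
Proof. by rewrite /mono_mul hsumD // => *; apply: in1D. Qed.

Let mull s t y : free_rel s t ->
  \sum_(x <- s) mono_mul x y = \sum_(x <- t) mono_mul x y.
Proof.
case: y => a' w'; case=> [a1 a2 w|a u s' t' v].
  by rewrite !big_cons !big_nil !addr0 M1.
rewrite !big_seq1; move: a'; apply: (homog_ext
  (f := fun a' => mono_mul (a, u ++ s' :: t' :: v) (a', w'))
  (g := fun a' => mono_mul (_, u ++ t' :: s' :: v) (a', w')))
  => [x y|x y|j a' ha'].
- exact: M3.
- exact: M3.
rewrite !(mono_mul_homog _ _ _ ha') wdeg_swap -!catA /= mono_swap.
by rewrite mulrzAl.
Qed.

Let mulr s t x : free_rel s t ->
  \sum_(y <- s) mono_mul x y = \sum_(y <- t) mono_mul x y.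
Proof.
case: x => a' w'; case=> [a1 a2 w|a u s' t' v].
  by rewrite !big_cons !big_nil !addr0 M3.
rewrite !big_seq1; move: a; apply: (homog_ext
  (f := fun a => mono_mul (a', w') (a, u ++ s' :: t' :: v))
  (g := fun a => mono_mul (a', w') (a *~ _, u ++ t' :: s' :: v)))
  => [x y|x y|j a ha].
- exact: M3.
- by rewrite mulrzDl M3.
rewrite (mono_mul_homog _ _ _ ha) (mono_mul_homog _ _ _ (homogMz _ ha)).
by rewrite catA mono_swap -catA mulrzAr.
Qed.

Definition free_mul : free_alg -> free_alg -> free_alg := pres_mul mono_mul.

Lemma free_mul_mono a w a' w' :
  free_mul (mono a w) (mono a' w') = mono_mul (a, w) (a', w').
Proof. exact: (pres_mul_gen mull mulr). Qed.

Lemma free_mulDl : left_distributive free_mul +%R.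
Proof. exact: (pres_mulDl mull mulr). Qed.

Lemma free_mulDr : right_distributive free_mul +%R.
Proof. exact: (pres_mulDr mull mulr). Qed.

Let fmDl q x y : free_mul (x + y) q = free_mul x q + free_mul y q.
Proof. exact: free_mulDl. Qed.
Let fmDr p x y : free_mul p (x + y) = free_mul p x + free_mul p y.
Proof. exact: free_mulDr. Qed.

Let fmNl q x : free_mul (- x) q = - free_mul x q.
Proof. exact: (add_funN (@fmDl q)). Qed.
Let fmNr p x : free_mul p (- x) = - free_mul p x.
Proof. exact: (add_funN (@fmDr p)). Qed.
Let fmMzl p q n : free_mul (p *~ n) q = free_mul p q *~ n.
Proof. exact: (add_funMz (@fmDl q)). Qed.
Let fmMzr p q n : free_mul p (q *~ n) = free_mul p q *~ n.
Proof. exact: (add_funMz (@fmDr p)). Qed.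

Lemma free_mulA : associative free_mul.
Proof.
apply: (pres_mulA_gen mull mulr) => -[a w] [a' w'] [a'' w''].
rewrite -/free_mul -![pgen _ _]/(mono _ _).
move: a'; apply: (homog_ext
  (f := fun a' => free_mul (mono_mul (a, w) (a', w')) (mono a'' w''))
  (g := fun a' => free_mul (mono a w) (mono_mul (a', w') (a'', w''))))
  => [x y|x y|i a' ha'].
- by rewrite M3 fmDl.
- by rewrite M1 fmDr.
move: a''; apply: (homog_ext
  (f := fun a'' => free_mul (mono_mul (a, w) (a', w')) (mono a'' w''))
  (g := fun a'' => free_mul (mono a w) (mono_mul (a', w') (a'', w''))))
  => [x y|x y|j a'' ha''].
- by rewrite monoD fmDr.
- by rewrite M3 fmDr.
rewrite (mono_mul_homog _ _ _ ha') (mono_mul_homog _ _ _ ha'').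
rewrite fmMzl fmMzr !free_mul_mono (mono_mul_homog _ _ _ ha'').
rewrite (mono_mul_homog _ _ _ (homogM _ _ _ _ ha' ha'')).
rewrite -!mulrzA mulrA catA; congr (_ *~ _).
by rewrite wdeg_cat koszulDl koszulDr [LHS]mulrC mulrA.
Qed.

Lemma free_mul1l : left_id (mono 1 [::]) free_mul.
Proof.
elim/free_ind => [|a w|p q hp hq].
- exact: (add_fun0 (@fmDr _)).
- rewrite free_mul_mono.
  move: a; apply: (homog_ext (f := fun a => mono_mul (1, [::]) (a, w))
    (g := mono^~ w)) => [x y|x y|i a ha].
  + exact: M3.
  + exact: monoD.
  by rewrite (mono_mul_homog _ _ _ ha) wdeg_nil koszul0l mul1r.
- by rewrite fmDr fmNr hp hq.
Qed.

Lemma free_mul1r : right_id (mono 1 [::]) free_mul.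
Proof.
elim/free_ind => [|a w|p q hp hq].
- exact: (add_fun0 (@fmDl _)).
- rewrite free_mul_mono (mono_mul_homog _ _ _ (@homog1 A)).
  by rewrite koszul0r mulr1 cats0.
- by rewrite fmDl fmNl hp hq.
Qed.

HB.instance Definition _ := GRing.Zmodule_isPzRing.Build free_alg
  free_mulA free_mul1l free_mul1r free_mulDl free_mulDr.

Lemma monoM j a w a' w' : homog j a' ->
  mono a w * mono a' w' = mono (a * a') (w ++ w') *~ koszul (wdeg w) j.
Proof.
by move=> ha'; rewrite -[LHS]/(free_mul _ _) free_mul_mono (mono_mul_homog _ _ _ ha').
Qed.

Definition mono_homog (d : int) (p : free_alg) : Prop :=
  exists i a w, [/\ homog i a, i + wdeg w = d & p = mono a w].

Definition free_homog (d : int) : free_alg -> Prop := zspan (mono_homog d).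

Lemma mono_homog_in i a w : homog i a -> free_homog (i + wdeg w) (mono a w).
Proof. by move=> ha; apply: zspan_gen; exists i, a, w. Qed.

Lemma free_homog0 d : free_homog d 0.
Proof. exact: zspan0. Qed.

Lemma free_homogB d p q :
  free_homog d p -> free_homog d q -> free_homog d (p - q).
Proof. exact: zspanB. Qed.

Lemma free_homog1 : free_homog 0 1.
Proof.
by rewrite -[X in free_homog X]addr0 -{2}wdeg_nil; apply: mono_homog_in; apply: homog1.
Qed.

Lemma free_homogMz d p n : free_homog d p -> free_homog d (p *~ n).
Proof.
move=> hp; have hD := addr_of_subr (free_homog0 d) (@free_homogB d).
have h (m : nat) : free_homog d (p *+ m).
  by elim: m => [|m IH]; rewrite ?mulr0n ?mulrS; [apply: zspan0|apply: hD].
case: n => n; first exact: h.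
by rewrite NegzE mulrNz -sub0r; apply: zspanB; [apply: zspan0|apply: h].
Qed.

Lemma free_homogM d e p q :
  free_homog d p -> free_homog e q -> free_homog (d + e) (p * q).
Proof.
move=> hp hq; elim: hp => [|{}p [i [a [w [ha <- ->]]]]|p1 p2 _ h1 _ h2].
- by rewrite mul0r; apply: zspan0.
- elim: hq => [|{}q [i' [a' [w' [ha' <- ->]]]]|q1 q2 _ h1 _ h2].
  + by rewrite mulr0; apply: zspan0.
  + rewrite (monoM _ _ _ ha'); apply: free_homogMz.
    by rewrite addrACA -wdeg_cat; apply: mono_homog_in; apply: homogM.
  + by rewrite mulrBr; apply: zspanB.
- by rewrite mulrBl; apply: zspanB.
Qed.

Lemma mono_insert a u v s w :
  mono a (u ++ v ++ s :: w) = mono (a *~ koszul (wdeg v) (deg s)) (u ++ s :: v ++ w).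
Proof.
elim/last_ind: v w a => [|v t IH] w a; first by rewrite wdeg_nil koszul0l.
rewrite -cats1 -catA catA /= mono_swap -catA IH -mulrzA -catA wdeg_cat koszulDl.
by rewrite /(wdeg [:: t]) big_seq1 [koszul (wdeg v) _ * _]mulrC.
Qed.

Lemma mono_catC a u v w :
  mono a (u ++ v ++ w) = mono (a *~ koszul (wdeg v) (wdeg w)) (u ++ w ++ v).
Proof.
elim: w u a => [|s w IH] u a; first by rewrite wdeg_nil koszul0r cats0.
rewrite mono_insert -cat_rcons IH cat_rcons -mulrzA -koszulDr.
by rewrite /wdeg big_cons.
Qed.

Lemma free_homogC d e p q :
  free_homog d p -> free_homog e q -> p * q = (q * p) *~ koszul d e.
Proof.
move=> hp hq; elim: hp => [|{}p [i [a [w [ha <- ->]]]]|p1 p2 _ h1 _ h2].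
- by rewrite mul0r mulr0 mul0rz.
- elim: hq => [|{}q [i' [a' [w' [ha' <- ->]]]]|q1 q2 _ h1 _ h2].
  + by rewrite mul0r mulr0 mul0rz.
  + rewrite (monoM _ _ _ ha) (monoM _ _ _ ha') (homogC _ _ _ _ ha ha').
    rewrite (@mono_catC _ [::]) /= !monoMz -!mulrzA; congr (_ *~ _).
    rewrite !koszulDl !koszulDr (koszulC i (wdeg w')).
    set x := koszul i i'; set y := koszul _ i; set z := koszul _ i'.
    rewrite [RHS]mulrA [y * _]mulrA [y * x]mulrC -[x * y * y]mulrA koszulK mulr1.
    by rewrite [z * _]mulrC mulrA.
  + by rewrite mulrBr mulrBl mulrzBl h1 h2.
- by rewrite mulrBr mulrBl mulrzBl h1 h2.
Qed.

Definition mono_proj (d : int) (x : A * seq S) : free_alg :=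
  mono (hcomp (d - wdeg x.2) x.1) x.2.

Definition free_proj (d : int) : free_alg -> free_alg := pres_lift (mono_proj d).

Let prel d s t : free_rel s t ->
  \sum_(x <- s) mono_proj d x = \sum_(x <- t) mono_proj d x.
Proof.
case=> [a b w|a u x y v]; rewrite !big_cons !big_nil !addr0 /mono_proj /=.
  by rewrite raddfD monoD.
by rewrite mono_swap wdeg_swap raddfMz.
Qed.

Lemma free_projD d p q : free_proj d (p + q) = free_proj d p + free_proj d q.
Proof. exact: (pres_liftD (@prel d)). Qed.

Lemma free_proj_mono d a w : free_proj d (mono a w) = mono (hcomp (d - wdeg w) a) w.
Proof. exact: (pres_lift_gen (@prel d)). Qed.

Let projN d := add_funN (free_projD d).

Lemma free_decomp p : exists! c, is_decomposition free_homog p c.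
Proof.
apply: (decomp_from_proj (p := free_proj)) => {p}.
- exact: free_projD.
- move=> d; elim/free_ind => [|a w|p q hp hq].
  + by rewrite (add_fun0 (free_projD d)); apply: zspan0.
  + rewrite free_proj_mono -[X in free_homog X](subrK (wdeg w)).
    exact/mono_homog_in/homog_comp.
  + by rewrite free_projD projN; apply: zspanB.
- move=> d e p; elim=> [|{}p [i [a [w [ha <- ->]]]]|p1 p2 _ h1 _ h2].
  + by rewrite (add_fun0 (free_projD e)); case: ifP.
  + rewrite free_proj_mono (hcomp_homog _ ha) subr_eq.
    by case: ifP => // _; rewrite mono0.
  + by rewrite free_projD projN h1 h2; case: ifP => // _; rewrite subr0.
- move=> P P0 PD Ph p.
  have Pt a w : P (mono a w).
    elim/homog_ind: a => [|a a' ha ha'|i a ha]; first by rewrite mono0.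
      by rewrite monoD; apply: PD.
    by apply: (Ph (i + wdeg w)); apply: mono_homog_in.
  suff [] : P p /\ P (- p) by [].
  elim/free_ind: p => [|a w|p q [hp hp'] [hq hq']].
  + by rewrite oppr0.
  + by split=> //; rewrite -monoN.
  + by rewrite opprB; split; apply: PD.
Qed.

HB.instance Definition _ := PzRing_isDirac.Build free_alg
  free_homog0 free_homogB free_homog1 free_homogM free_decomp free_homogC.

Let inclB x y : mono (x - y) [::] = mono x [::] - mono y [::].
Proof. by rewrite monoD monoN. Qed.

Let inclM x y : mono (x * y) [::] = mono x [::] * mono y [::].
Proof.
move: y; apply: (homog_ext (f := fun y => mono (x * y) [::])
  (g := fun y => mono x [::] * mono y [::])) => [c c'|c c'|d y hy].
- by rewrite mulrDr monoD.
- by rewrite monoD mulrDr.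
by rewrite (monoM _ _ _ hy) wdeg_nil koszul0l.
Qed.

Let inclh d x : homog d x -> homog d (mono x [::]).
Proof. by move=> hx; rewrite -[d]addr0 -wdeg_nil; apply: mono_homog_in. Qed.

Definition free_const : diracHom A free_alg :=
  @build_hom A free_alg (fun a => mono a [::]) inclB erefl inclM inclh.

Definition free_var (s : S) : free_alg := mono 1 [:: s].

Lemma free_var_homog s : homog (deg s) (free_var s).
Proof.
have := @mono_homog_in 0 1 [:: s] (@homog1 A).
by rewrite add0r /wdeg big_seq1.
Qed.

Lemma monoE a w : mono a w = free_const a * \prod_(s <- w) free_var s.
Proof.
rewrite /= /build_fun.
have -> : \prod_(s <- w) free_var s = mono 1 w.
  elim: w => [|s w IH]; first by rewrite big_nil.
  by rewrite big_cons IH (monoM _ _ _ (@homog1 A)) koszul0r mulr1z mulr1.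
by rewrite (monoM _ _ _ (@homog1 A)) koszul0r mulr1z mulr1.
Qed.

Section UniversalProperty.
Variables (B : diracRingType) (h : diracHom A B) (v : S -> B).
Hypothesis hv : forall s, homog (deg s) (v s).

Let wprod (w : seq S) : B := \prod_(s <- w) v s.

Let wprod_homog w : homog (wdeg w) (wprod w).
Proof.
elim: w => [|s w IH]; first by rewrite wdeg_nil /wprod big_nil; apply: homog1.
by rewrite /wprod /wdeg !big_cons; apply: homogM.
Qed.

Definition free_desc_fun : free_alg -> B :=
  pres_lift (fun x => h x.1 * \prod_(s <- x.2) v s).

Let Lrel s t : free_rel s t ->
  \sum_(x <- s) (h x.1 * \prod_(s <- x.2) v s) =
  \sum_(x <- t) (h x.1 * \prod_(s <- x.2) v s).
Proof.
case=> [a b w|a u x y w]; rewrite !big_cons !big_nil !addr0 /=.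
  by rewrite rmorphD mulrDl.
rewrite !big_cat /= !big_cons raddfMz /= mulrzAl -mulrzAr; congr (_ * _).
rewrite -mulrzAr; congr (_ * _); rewrite !mulrA (homogC _ _ _ _ (hv x) (hv y)).
by rewrite mulrzAl.
Qed.

Lemma free_desc_mono a w :
  free_desc_fun (mono a w) = h a * \prod_(s <- w) v s.
Proof. exact: (pres_lift_gen Lrel). Qed.

Lemma free_descB p q : free_desc_fun (p - q) = free_desc_fun p - free_desc_fun q.
Proof. exact: (pres_liftB Lrel). Qed.

Let descD p q : free_desc_fun (p + q) = free_desc_fun p + free_desc_fun q.
Proof. exact: (pres_liftD Lrel). Qed.

Let desc0 : free_desc_fun 0 = 0.
Proof. exact: (pres_lift0 Lrel). Qed.

Lemma free_desc1 : free_desc_fun 1 = 1.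
Proof.
by rewrite -[X in free_desc_fun X = _]/(mono 1 [::]) free_desc_mono rmorph1 big_nil mulr1.
Qed.

Lemma free_descM p q : free_desc_fun (p * q) = free_desc_fun p * free_desc_fun q.
Proof.
elim/free_ind: p => [|a w|p p' hp hp'].
- by rewrite mul0r desc0 mul0r.
- elim/free_ind: q => [|a' w'|q q' hq hq'].
  + by rewrite mulr0 desc0 mulr0.
  + move: a'; apply: (homog_ext
      (f := fun a' => free_desc_fun (mono a w * mono a' w'))
      (g := fun a' => free_desc_fun (mono a w) * free_desc_fun (mono a' w')))
      => [c c'|c c'|j a' ha'].
    * by rewrite monoD mulrDr descD.
    * by rewrite monoD descD mulrDr.
    rewrite (monoM _ _ _ ha') (add_funMz descD) !free_desc_mono !rmorphM.
    rewrite big_cat /= -!mulrA [X in _ = _ * X]mulrA.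
    rewrite (homogC _ _ _ _ (wprod_homog w) (dirac_homog h ha')).
    by rewrite mulrzAl !mulrzAr -!mulrA.
  + by rewrite mulrBr !free_descB hq hq' mulrBr.
- by rewrite mulrBl !free_descB hp hp' mulrBl.
Qed.

Lemma free_desc_homog d p : homog d p -> homog d (free_desc_fun p).
Proof.
elim=> [|{}p [i [a [w [ha <- ->]]]]|p1 p2 _ h1 _ h2].
- by rewrite desc0; apply: homog0.
- by rewrite free_desc_mono; apply: homogM; [apply: dirac_homog|apply: wprod_homog].
- by rewrite free_descB; apply: homogB.
Qed.

Definition free_desc : diracHom free_alg B :=
  @build_hom free_alg B free_desc_fun free_descB free_desc1 free_descM
    free_desc_homog.

Lemma free_desc_const a : free_desc (free_const a) = h a.
Proof. by rewrite /= /build_fun free_desc_mono big_nil mulr1. Qed.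

Lemma free_desc_var s : free_desc (free_var s) = v s.
Proof. by rewrite /= /build_fun free_desc_mono big_seq1 rmorph1 mul1r. Qed.
End UniversalProperty.

Lemma free_hom_ext (B : diracRingType) (u v : diracHom free_alg B) :
  (forall a, u (free_const a) = v (free_const a)) ->
  (forall s, u (free_var s) = v (free_var s)) -> u = v.
Proof.
move=> hc hs; apply: diracHom_ext => p; elim/free_ind: p => [|a w|p q hp hq].
- by rewrite !rmorph0.
- rewrite monoE !rmorphM !rmorph_prod; congr (_ * _); first exact: hc.
  by apply: eq_bigr => s _; apply: hs.
- by rewrite !rmorphB hp hq.
Qed.
End FreeAlgebra.

(* [S] with [deg] is the graded set of generators, sent to [B] by [v]; the last
   clause says that the finitely many homogeneous elements [r] generate the kernel
   of the induced map. *)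
Definition finitely_presented (A B : diracRingType) (phi : diracHom A B) : Prop :=
  exists (S : finType) (deg : S -> int) (v : S -> B)
         (hv : forall s, homog (deg s) (v s)),
    let ev := free_desc phi hv in
    (forall b, exists p, ev p = b) /\
    exists r : seq (free_alg A deg),
      (forall p, p \in r -> exists d, homog d p) /\
      (forall p, ev p = 0 <-> gideal_gen r p).

Definition etale (A B : diracRingType) (phi : diracHom A B) : Prop :=
  finitely_presented phi /\
  forall (C : diracRingType) (I : gradedIdeal C),
    (forall x y, I x -> I y -> x * y = 0) ->
    forall (f : diracHom A C) (g : diracHom B (dquot I)),
      (forall a, g (phi a) = dproj_hom I (f a)) ->
      exists! h : diracHom B C,
        (forall a, h (phi a) = f a) /\ (forall b, dproj_hom I (h b) = g b).

Record category := Category {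
  obj :> Type;
  hom : obj -> obj -> Type;
  idm : forall X, hom X X;
  compm : forall X Y Z, hom Y Z -> hom X Y -> hom X Z;
  compm_idl : forall X Y (f : hom X Y), compm (idm Y) f = f;
  compm_idr : forall X Y (f : hom X Y), compm f (idm X) = f;
  compm_assoc : forall X Y Z W (f : hom Z W) (g : hom Y Z) (h : hom X Y),
    compm f (compm g h) = compm (compm f g) h
}.
Arguments hom {c} X Y.
Arguments idm {c} X.
Arguments compm {c X Y Z} f g.

Record functor (C D : category) := Functor {
  fobj :> C -> D;
  fmap : forall X Y : C, hom X Y -> hom (fobj X) (fobj Y);
  fmap_id : forall X, fmap (idm X) = idm (fobj X);
  fmap_comp : forall X Y Z (f : hom Y Z) (g : hom X Y),
    fmap (compm f g) = compm (fmap f) (fmap g)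
}.
Arguments fmap {C D} _ {X Y} _.

Definition functor_id (C : category) : functor C C :=
  @Functor C C id (fun _ _ => id) (fun _ => erefl) (fun _ _ _ _ _ => erefl).

Section CompFunctor.
Variables (C D E : category) (G : functor D E) (F : functor C D).

Lemma functor_comp_id (X : C) : fmap G (fmap F (idm X)) = idm (G (F X)).
Proof. by rewrite !fmap_id. Qed.

Lemma functor_comp_comp (X Y Z : C) (f : hom Y Z) (g : hom X Y) :
  fmap G (fmap F (compm f g)) = compm (fmap G (fmap F f)) (fmap G (fmap F g)).
Proof. by rewrite !fmap_comp. Qed.

Definition functor_comp : functor C E :=
  @Functor C E (fun X => G (F X)) (fun X Y f => fmap G (fmap F f))
    functor_comp_id functor_comp_comp.
End CompFunctor.

Record natural_iso (C D : category) (F G : functor C D) := NaturalIso {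
  niso : forall X : C, hom (F X) (G X);
  niso_inv : forall X : C, hom (G X) (F X);
  niso_natural : forall (X Y : C) (f : hom X Y),
    compm (niso Y) (fmap F f) = compm (fmap G f) (niso X);
  nisoK : forall X, compm (niso_inv X) (niso X) = idm (F X);
  niso_invK : forall X, compm (niso X) (niso_inv X) = idm (G X)
}.

Definition is_equivalence (C D : category) (F : functor C D) : Prop :=
  exists G : functor D C,
    inhabited (natural_iso (functor_id C) (functor_comp G F)) /\
    inhabited (natural_iso (functor_comp F G) (functor_id D)).

Definition full_subcategory (C : category) (P : C -> Prop) : category :=
  @Category {X : C | P X} (fun X Y => hom (sval X) (sval Y))
    (fun X => idm (sval X)) (fun X Y Z f g => compm f g)
    (fun X Y f => compm_idl f) (fun X Y f => compm_idr f)
    (fun X Y Z W f g h => compm_assoc f g h).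

(* The functor induced by [F] on full subcategories that it respects. *)
Definition functor_restrict (C D : category) (F : functor C D)
    (P : C -> Prop) (Q : D -> Prop) (h : forall X, P X -> Q (F X)) :
    functor (full_subcategory P) (full_subcategory Q) :=
  @Functor (full_subcategory P) (full_subcategory Q)
    (fun X => exist Q (F (sval X)) (h (sval X) (svalP X)))
    (fun X Y f => fmap F f) (fun X => fmap_id F (sval X))
    (fun X Y Z f g => fmap_comp F f g).

Arguments functor_restrict {C D} F {P Q} h.

Record diracAlg (A : diracRingType) := DiracAlg {
  alg_ring :> diracRingType;
  alg_map : diracHom A alg_ring
}.

Record algHom (A : diracRingType) (B C : diracAlg A) := AlgHom {
  alg_hom :> diracHom B C;
  alg_homE : forall a, alg_hom (alg_map B a) = alg_map C a
}.

Lemma algHom_ext (A : diracRingType) (B C : diracAlg A) (u v : algHom B C) :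
  u =1 v -> u = v.
Proof.
case: u v => [u hu] [v hv] /= /diracHom_ext uv.
by subst v; rewrite (Prop_irrelevance hu hv).
Qed.

Section DiracAlgCategory.
Variable A : diracRingType.

Definition alg_id (B : diracAlg A) : algHom B B :=
  @AlgHom A B B (dirac_id B) (fun _ => erefl).

Lemma alg_compE (B C D : diracAlg A) (u : algHom C D) (v : algHom B C) a :
  dirac_comp u v (alg_map B a) = alg_map D a.
Proof. by rewrite /= !alg_homE. Qed.

Definition alg_comp (B C D : diracAlg A) (u : algHom C D) (v : algHom B C) :
    algHom B D :=
  AlgHom (alg_compE u v).

Lemma alg_comp_idl (B C : diracAlg A) (u : algHom B C) :
  alg_comp (alg_id C) u = u.
Proof. exact: algHom_ext. Qed.

Lemma alg_comp_idr (B C : diracAlg A) (u : algHom B C) :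
  alg_comp u (alg_id B) = u.
Proof. exact: algHom_ext. Qed.

Lemma alg_comp_assoc (B C D E : diracAlg A)
    (u : algHom D E) (v : algHom C D) (w : algHom B C) :
  alg_comp u (alg_comp v w) = alg_comp (alg_comp u v) w.
Proof. exact: algHom_ext. Qed.

Definition dirac_alg : category :=
  @Category (diracAlg A) (@algHom A) alg_id alg_comp alg_comp_idl alg_comp_idr
    alg_comp_assoc.
End DiracAlgCategory.

Definition etale_alg (A : diracRingType) (B : dirac_alg A) : Prop :=
  etale (alg_map B).

Definition etale_category (A : diracRingType) : category :=
  full_subcategory (@etale_alg A).

Section ExtensionOfScalars.
Variables (R A : diracRingType) (f : diracHom R A).

Definition ext_obj (B : diracAlg R) : diracAlg A :=
  @DiracAlg A (tensor f (alg_map B)) (tens_inl f (alg_map B)).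

Section ExtMap.
Variables (B C : diracAlg R) (u : algHom B C).

Lemma ext_map_bal r :
  tens_inl f (alg_map C) (f r) =
  dirac_comp (tens_inr f (alg_map C)) u (alg_map B r).
Proof. by rewrite /dirac_comp [RHS]/= alg_homE -tens_inlr. Qed.

Definition ext_map_hom : diracHom (ext_obj B) (ext_obj C) :=
  tens_desc ext_map_bal.

Lemma ext_map_tens a b :
  ext_map_hom (tens f (alg_map B) a b) = tens f (alg_map C) a (u b).
Proof. by rewrite [LHS](tens_desc_tens ext_map_bal) -[RHS]tens1M. Qed.

Definition ext_map : algHom (ext_obj B) (ext_obj C) :=
  @AlgHom A (ext_obj B) (ext_obj C) ext_map_hom (tens_desc_inl ext_map_bal).
End ExtMap.

Lemma ext_map_id (B : diracAlg R) : ext_map (alg_id B) = alg_id (ext_obj B).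
Proof.
apply: algHom_ext; elim/tensor_ind => [|a b|p q hp hq].
- by rewrite !rmorph0.
- exact: ext_map_tens.
- by rewrite !rmorphB hp hq.
Qed.

Lemma ext_map_comp (B C D : diracAlg R) (u : algHom C D) (v : algHom B C) :
  ext_map (alg_comp u v) = alg_comp (ext_map u) (ext_map v).
Proof.
apply: algHom_ext; elim/tensor_ind => [|a b|p q hp hq].
- by rewrite !rmorph0.
- rewrite [LHS]ext_map_tens [RHS]/=.
  by rewrite -[RHS]/(ext_map_hom u (ext_map_hom v _)) !ext_map_tens.
- by rewrite !rmorphB hp hq.
Qed.

Definition ext_scalars : functor (dirac_alg R) (dirac_alg A) :=
  @Functor (dirac_alg R) (dirac_alg A) ext_obj ext_map ext_map_id ext_map_comp.
End ExtensionOfScalars.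

(* Main.v *)
From HB Require Import structures.
From mathcomp Require Import all_boot all_order all_algebra.
From mathcomp Require Import boolp.
Require Import Defs.

(** The inverse functor is [B |-> B^ev].  The generators [a (x) 1 - 1 (x) a], with
    [a] odd, of the kernel of [A (x)_{A^ev} B -> B] square to zero, because [a]
    anticommutes with its copy and [2 a^2 = 0].  Etale algebras lift uniquely along
    such kernels, so this map has an [A]-linear section [rho].  For [b] odd, the
    element [(e - 1) b] of [B[e] / (e^2 - 1)] squares to zero for the same reason;
    hence an [A]-linear map out of [B] is invariant under any parity coaction that
    fixes [A].  Applied to [rho], this puts its image into [A (x) B^ev] and gives
    [A (x)_{A^ev} B^ev = B]; applied to an etale algebra over an even ring, it shows
    that the algebra is even.  Conversely, [(A (x)_{A^ev} C)^ev = C] for [C] even,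
    and since [A^ev] is a direct summand of [A], finite presentation and unique
    lifting descend from [B] to [B^ev]. *)

Set Implicit Arguments.
Unset Strict Implicit.
Unset Printing Implicit Defensive.

Import GRing.Theory.

Local Open Scope ring_scope.

(** * Homomorphisms and generated ideals *)

(** The equation [2 a^2 = 0] does not give [a^2 = 0]: in characteristic 2 an odd element need not be
    nilpotent, so killing the odd elements of [A] is not a nilpotent thickening and cannot serve to
    compare [A] with [A^ev]. What remains usable is the difference of two copies of an odd element:
    its square is a multiple of [2 a^2] as soon as the cross terms cancel. For the same reason
    parity is encoded by a coaction and not by the involution [b |-> -b] on odd [b], which is
    trivial in characteristic 2. The ring generated by [e] with [e^2 = 1] is the function ring of
    the group scheme of square roots of unity, whose coactions are the gradings by parity in every
    characteristic. The kernels that occur are generated by possibly infinitely many square-zero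
    elements and need not be nilpotent, while the definition of etale speaks only of ideals of
    square zero. Finitely many generators (for uniqueness) and finitely many relations (for
    existence) confine each lifting problem to a finite list of such elements. *)

Section HomBasics.
Variables (X Y : diracRingType) (f : diracHom X Y).

Lemma hom_hcomp d x : f (hcomp d x) = hcomp d (f x).
Proof.
move: x; apply: homog_ext => [x y|x y|e x hx]; try by rewrite !raddfD.
rewrite (hcomp_homog _ hx) (hcomp_homog _ (dirac_homog f hx)).
by case: ifP; rewrite ?raddf0.
Qed.

Section Preimage.
Variable I : gradedIdeal Y.

Let P (x : X) : Prop := I (f x).

Lemma preim_ideal0 : P 0.
Proof. by rewrite /P raddf0; apply: gideal0. Qed.

Lemma preim_idealB x y : P x -> P y -> P (x - y).
Proof. by rewrite /P raddfB; apply: gidealB. Qed.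

Lemma preim_idealMl a x : P x -> P (a * x).
Proof. by rewrite /P rmorphM; apply: gidealMl. Qed.

Lemma preim_idealMr a x : P x -> P (x * a).
Proof. by rewrite /P rmorphM; apply: gidealMr. Qed.

Lemma preim_ideal_comp d x : P x -> P (hcomp d x).
Proof. by rewrite /P hom_hcomp; apply: gideal_comp. Qed.

Definition preim_ideal : gradedIdeal X :=
  GradedIdeal preim_ideal0 preim_idealB preim_idealMl preim_idealMr
    preim_ideal_comp.
End Preimage.

Lemma homog_lift d y : (exists x, f x = y) -> homog d y ->
  exists2 x, homog d x & f x = y.
Proof.
move=> [x <-] hy; exists (hcomp d x); first exact: homog_comp.
by rewrite hom_hcomp (hcomp_homog _ hy) eqxx.
Qed.
End HomBasics.

Section ZeroIdeal.
Variable X : diracRingType.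

Let P (x : X) : Prop := x = 0.

Lemma zero_idealB x y : P x -> P y -> P (x - y).
Proof. by rewrite /P => -> ->; rewrite subrr. Qed.

Lemma zero_idealMl a x : P x -> P (a * x).
Proof. by rewrite /P => ->; rewrite mulr0. Qed.

Lemma zero_idealMr a x : P x -> P (x * a).
Proof. by rewrite /P => ->; rewrite mul0r. Qed.

Lemma zero_ideal_comp d x : P x -> P (hcomp d x).
Proof. by rewrite /P => ->; rewrite raddf0. Qed.

Definition zero_ideal : gradedIdeal X :=
  @GradedIdeal X P erefl zero_idealB zero_idealMl zero_idealMr zero_ideal_comp.
End ZeroIdeal.

Definition ker_ideal (X Y : diracRingType) (f : diracHom X Y) : gradedIdeal X :=
  preim_ideal f (zero_ideal Y).

(** This serves as the universal property of a quotient for any surjection, so that no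
    identification with [dquot] is needed. The chosen section of [q] is not additive, but [f] does
    not depend on the choice of preimages; a homogeneous element has a homogeneous preimage, so the
    degree is kept. *)
Lemma hom_factor (P X Y : diracRingType) (q : diracHom P X) (f : diracHom P Y) :
    (forall x, exists p, q p = x) -> (forall p, q p = 0 -> f p = 0) ->
  exists h : diracHom X Y, forall p, h (q p) = f p.
Proof.
move=> sq kq; have [s sK] := choice sq.
have E p p' : q p = q p' -> f p = f p'.
  move=> e; apply/eqP; rewrite -subr_eq0 -raddfB; apply/eqP/kq.
  by rewrite raddfB /= e subrr.
pose k x := f (s x).
have kB x y : k (x - y) = k x - k y.
  by rewrite /k -raddfB; apply: E; rewrite raddfB /= !sK.
have k1 : k 1 = 1 by rewrite /k -(rmorph1 f); apply: E; rewrite sK rmorph1.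
have kM x y : k (x * y) = k x * k y.
  by rewrite /k -rmorphM; apply: E; rewrite rmorphM /= !sK.
have kh d x : homog d x -> homog d (k x).
  move=> hx; have [p hp e] := homog_lift (sq x) hx.
  by rewrite /k (E _ p) ?sK //; apply: dirac_homog.
by exists (build_hom kB k1 kM kh) => p; rewrite build_homE; apply: E; rewrite sK.
Qed.

Lemma hom_bij_inv (X Y : diracRingType) (f : diracHom X Y) :
    (forall y, exists x, f x = y) -> (forall x, f x = 0 -> x = 0) ->
  exists h : diracHom Y X, (forall x, h (f x) = x) /\ (forall y, f (h y) = y).
Proof.
move=> sf kf; have [h hK] := hom_factor (f := dirac_id X) sf kf.
by exists h; split=> // y; have [x <-] := sf y; rewrite hK.
Qed.

Lemma hcomp_mul_homog (X : diracRingType) d e (a g : X) : homog e g ->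
  hcomp d (a * g) = hcomp (d - e) a * g.
Proof.
move=> hg; move: a; apply: homog_ext => [x y|x y|i x hx].
- by rewrite mulrDl raddfD.
- by rewrite raddfD mulrDl.
rewrite (hcomp_homog _ hx) (hcomp_homog _ (homogM _ _ _ _ hx hg)) -subr_eq.
by case: ifP; rewrite ?mul0r.
Qed.

Section GeneratedIdeal.
Variables (X : diracRingType) (G : X -> Prop).
Hypothesis hG : forall g, G g -> exists d, homog d g.

(** Left multiples already form a two-sided ideal, since a homogeneous factor moves past a
    homogeneous generator at the cost of a sign. Unlike the intersection [gideal_gen], this form
    allows induction on the members. *)
Let P : X -> Prop := zspan (fun y => exists a g, G g /\ y = a * g).

Lemma hom_ideal0 : P 0.
Proof. exact: zspan0. Qed.

Lemma hom_idealB x y : P x -> P y -> P (x - y).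
Proof. exact: zspanB. Qed.

Let PD := addr_of_subr hom_ideal0 hom_idealB.

Let PMz x n : P x -> P (x *~ n).
Proof.
move=> hx; have h (m : nat) : P (x *+ m).
  by elim: m => [|m IH]; rewrite ?mulr0n ?mulrS; [exact: zspan0|exact: PD].
case: n => n; first exact: h.
by rewrite NegzE mulrNz -sub0r; apply: zspanB; [exact: zspan0|exact: h].
Qed.

Lemma hom_idealMl a x : P x -> P (a * x).
Proof.
elim=> [|{}x [b [g [hg ->]]]|x1 x2 _ h1 _ h2].
- by rewrite mulr0; apply: zspan0.
- by rewrite mulrA; apply: zspan_gen; exists (a * b), g.
- by rewrite mulrBr; apply: zspanB.
Qed.

Lemma hom_idealMr a x : P x -> P (x * a).
Proof.
elim=> [|{}x [b [g [hg ->]]]|x1 x2 _ h1 _ h2].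
- by rewrite mul0r; apply: zspan0.
- elim/homog_ind: a => [|a a' ha ha'|d a ha].
  + by rewrite mulr0; apply: zspan0.
  + by rewrite mulrDr; apply: PD.
  + have [e he] := hG hg.
    rewrite -mulrA (homogC _ _ _ _ he ha) mulrzAr mulrA.
    by apply: PMz; apply: zspan_gen; exists (b * a), g.
- by rewrite mulrBl; apply: zspanB.
Qed.

Lemma hom_ideal_comp d x : P x -> P (hcomp d x).
Proof.
elim=> [|{}x [b [g [hg ->]]]|x1 x2 _ h1 _ h2].
- by rewrite raddf0; apply: zspan0.
- have [e he] := hG hg; rewrite (hcomp_mul_homog _ _ he).
  by apply: zspan_gen; exists (hcomp (d - e) b), g.
- by rewrite raddfB; apply: zspanB.
Qed.

Definition hom_ideal : gradedIdeal X :=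
  GradedIdeal hom_ideal0 hom_idealB hom_idealMl hom_idealMr hom_ideal_comp.

Lemma hom_ideal_gen g : G g -> hom_ideal g.
Proof. by move=> hg; apply: zspan_gen; exists 1, g; rewrite mul1r. Qed.

Lemma hom_ideal_min (I : gradedIdeal X) :
  (forall g, G g -> I g) -> forall x, hom_ideal x -> I x.
Proof.
move=> GI x; elim=> [|{}x [b [g [/GI hg ->]]]|x1 x2 _ h1 _ h2].
- exact: gideal0.
- exact: gidealMl.
- exact: gidealB.
Qed.

Lemma hom_ideal_sq0 : (forall g g', G g -> G g' -> g * g' = 0) ->
  forall x y, hom_ideal x -> hom_ideal y -> x * y = 0.
Proof.
move=> G0 x y; elim=> [|{}x [b [g [hg ->]]]|x1 x2 _ h1 _ h2] hy.
- by rewrite mul0r.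
- elim: hy => [|{}y [b' [g' [hg' ->]]]|y1 y2 _ h1 _ h2].
  + by rewrite mulr0.
  + rewrite -mulrA; have -> : g * (b' * g') = 0; last by rewrite mulr0.
    elim/homog_ind: b' => [|c c' hc hc'|d c hc].
    * by rewrite mul0r mulr0.
    * by rewrite mulrDl mulrDr hc hc' addr0.
    have [e he] := hG hg.
    by rewrite mulrA (homogC _ _ _ _ he hc) mulrzAl -mulrA (G0 _ _ hg hg') mulr0 mul0rz.
  + by rewrite mulrBr h1 h2 subrr.
- by rewrite mulrBl h1 // h2 // subrr.
Qed.
End GeneratedIdeal.

Section ListIdeal.
Variable X : diracRingType.
Implicit Types (l : seq X) (x y : X).

Definition list_ideal l : gradedIdeal X.
Proof.
apply: (@GradedIdeal X (gideal_gen l)).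
- by move=> I _; apply: gideal0.
- by move=> x y hx hy I hI; apply: gidealB; [apply: hx|apply: hy].
- by move=> a x hx I hI; apply: gidealMl; apply: hx.
- by move=> a x hx I hI; apply: gidealMr; apply: hx.
- by move=> d x hx I hI; apply: gideal_comp; apply: hx.
Defined.

Lemma list_ideal_mem l x : x \in l -> list_ideal l x.
Proof. by move=> hx I; apply. Qed.

Lemma gideal_gen_sub l l' x : {subset l <= l'} ->
  gideal_gen l x -> gideal_gen l' x.
Proof. by move=> ll h I hI; apply: h => y /ll; apply: hI. Qed.

Lemma gideal_gen_nil x : gideal_gen [::] x -> x = 0.
Proof. by move=> /(_ (zero_ideal X)); apply. Qed.

Section Support.
Variable G : X -> Prop.

(** With [G] the homogeneous elements of square zero, this is the local nilpotence used below: each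
    element needs its own finite list, and no list has to serve for all. *)
Definition fin_gen x :=
  exists l : seq X, (forall y, y \in l -> G y) /\ gideal_gen l x.

Lemma fin_gen0 : fin_gen 0.
Proof. by exists [::]; split=> //; apply: gideal0 (list_ideal _). Qed.

Lemma fin_genB x y : fin_gen x -> fin_gen y -> fin_gen (x - y).
Proof.
move=> [l [hl gl]] [l' [hl' gl']]; exists (l ++ l'); split.
  by move=> z; rewrite mem_cat => /orP[/hl|/hl'].
apply: (gidealB (g := list_ideal _)).
  by apply: gideal_gen_sub gl => z hz; rewrite mem_cat hz.
by apply: gideal_gen_sub gl' => z hz; rewrite mem_cat hz orbT.
Qed.

Definition fin_genD := addr_of_subr fin_gen0 fin_genB.

Lemma fin_genMl a x : fin_gen x -> fin_gen (a * x).
Proof. by move=> [l [hl gl]]; exists l; split=> //; apply: (gidealMl (g := list_ideal l)). Qed.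

Lemma fin_genMr a x : fin_gen x -> fin_gen (x * a).
Proof. by move=> [l [hl gl]]; exists l; split=> //; apply: (gidealMr (g := list_ideal l)). Qed.

Lemma fin_gen_mem x : G x -> fin_gen x.
Proof.
move=> hx; exists [:: x]; split; first by move=> y; rewrite inE => /eqP ->.
by apply: (@list_ideal_mem [:: x]); rewrite inE.
Qed.

Lemma fin_gen_hom_ideal (hG : forall g, G g -> exists d, homog d g) x :
  hom_ideal hG x -> fin_gen x.
Proof.
elim=> [|{}x [b [g [/fin_gen_mem hg ->]]]|x1 x2 _ h1 _ h2].
- exact: fin_gen0.
- exact: fin_genMl.
- exact: fin_genB.
Qed.

Lemma fin_gen_uniform (I : finType) (F : I -> X) : (forall i, fin_gen (F i)) ->
  exists l : seq X, (forall y, y \in l -> G y) /\ forall i, gideal_gen l (F i).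
Proof.
move=> /choice[L hL]; exists (flatten [seq L i | i <- enum I]); split.
  by move=> y /flatten_mapP[i _]; apply: (hL i).1.
move=> i; apply: gideal_gen_sub (hL i).2 => y hy.
by apply/flatten_mapP; exists i; rewrite ?mem_enum.
Qed.
End Support.
End ListIdeal.

Lemma fin_gen_seq (X Y : diracRingType) (G : X -> Prop) (r : seq Y) (F : Y -> X) :
    (forall y, y \in r -> fin_gen G (F y)) ->
  exists l : seq X, (forall y, y \in l -> G y) /\
    forall y, y \in r -> gideal_gen l (F y).
Proof.
move=> h; have [i|l [hl gl]] := @fin_gen_uniform X G _ (fun i : 'I_(size r) => F r`_i).
  by apply: h; apply: mem_nth.
exists l; split=> // y /(nthP 0)[i hi <-]; exact: (gl (Ordinal hi)).
Qed.

Lemma gideal_gen_sub_ideal (X : diracRingType) (l : seq X) (I : gradedIdeal X) x :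
  (forall y, y \in l -> I y) -> gideal_gen l x -> I x.
Proof. by move=> hl; apply. Qed.

Lemma gideal_gen_map (X Y : diracRingType) (f : diracHom X Y) (l : seq X) x :
  gideal_gen l x -> gideal_gen [seq f y | y <- l] (f x).
Proof.
move=> gl I hI; apply: (gl (preim_ideal f I)) => y hy.
by apply: hI; apply: map_f.
Qed.

(** * Lifting of etale algebras along nil ideals *)

Lemma dirac_compE (X Y Z : diracRingType) (g : diracHom Y Z) (f : diracHom X Y) x :
  dirac_comp g f x = g (f x).
Proof. by []. Qed.

Lemma dproj_homE (X : diracRingType) (I : gradedIdeal X) x :
  dproj_hom I x = dproj I x.
Proof. by []. Qed.

Lemma dproj_eq0 (X : diracRingType) (I : gradedIdeal X) x :
  dproj_hom I x = 0 <-> I x.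
Proof. by rewrite dproj_homE -(dproj0 I) dprojP subr0. Qed.

Lemma dproj_hom_eq (X : diracRingType) (I : gradedIdeal X) x y :
  dproj_hom I x = dproj_hom I y <-> I (x - y).
Proof. exact: dprojP. Qed.

Lemma dproj_hom_surj (X : diracRingType) (I : gradedIdeal X) p :
  exists x, dproj_hom I x = p.
Proof. by have [x ->] := dproj_surj p; exists x. Qed.

Definition hom_sqz (X : diracRingType) (x : X) : Prop :=
  (exists d, homog d x) /\ x * x = 0.

Lemma hom_sqz_map (X Y : diracRingType) (f : diracHom X Y) x :
  hom_sqz x -> hom_sqz (f x).
Proof.
move=> [[d hd] x0]; split; first by exists d; apply: dirac_homog.
by rewrite -rmorphM x0 rmorph0.
Qed.

Section SquareZeroIdeal.
Variables (X : diracRingType) (x : X) (hx : hom_sqz x).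

Lemma sqz_ideal_homog g : g = x -> exists d, homog d g.
Proof. by move=> ->; exact: hx.1. Qed.

Definition sqz_ideal : gradedIdeal X := hom_ideal sqz_ideal_homog.

Lemma sqz_ideal_mem : sqz_ideal x.
Proof. exact: hom_ideal_gen. Qed.

Lemma sqz_ideal_sq0 y z : sqz_ideal y -> sqz_ideal z -> y * z = 0.
Proof. by apply: hom_ideal_sq0 => g g' -> ->; exact: hx.2. Qed.

(** The inductive step for lists: modulo the head, what is left is generated by the images of the
    tail. *)
Lemma gideal_gen_cons_dproj l y : gideal_gen (x :: l) y ->
  gideal_gen [seq dproj_hom sqz_ideal z | z <- l] (dproj_hom sqz_ideal y).
Proof.
move=> h I hI; apply: (h (preim_ideal _ I)) => z; rewrite inE => /orP[/eqP->|hz].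
  have -> : preim_ideal (dproj_hom sqz_ideal) I x = I (dproj_hom sqz_ideal x) by [].
  have /dproj_eq0 -> := sqz_ideal_mem; exact: gideal0.
by apply: hI; apply: map_f.
Qed.
End SquareZeroIdeal.

Lemma ev_surj_hom_ext (A B X : diracRingType) (phi : diracHom A B) (S : finType)
    (deg : S -> int) (v : S -> B) (hv : forall s, homog (deg s) (v s))
    (h1 h2 : diracHom B X) :
  (forall b, exists p, free_desc phi hv p = b) ->
  (forall a, h1 (phi a) = h2 (phi a)) -> (forall s, h1 (v s) = h2 (v s)) ->
  h1 =1 h2.
Proof.
move=> sv ha hs b; have [p <-] := sv b.
suff e : dirac_comp h1 (free_desc phi hv) = dirac_comp h2 (free_desc phi hv).
  by rewrite -[LHS]/(dirac_comp h1 _ p) e.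
apply: free_hom_ext => [a|s].
  by rewrite !dirac_compE free_desc_const.
by rewrite !dirac_compE free_desc_var.
Qed.

Section EtaleLifting.
Variables (A B : diracRingType) (phi : diracHom A B).
Hypothesis phi_etale : etale phi.

Lemma etale_square_uniq (X : diracRingType) (I : gradedIdeal X)
    (h1 h2 : diracHom B X) :
  (forall x y, I x -> I y -> x * y = 0) ->
  (forall a, h1 (phi a) = h2 (phi a)) -> (forall b, I (h1 b - h2 b)) ->
  h1 =1 h2.
Proof.
move=> I0 ha hI.
have [|h [_ hu]] := phi_etale.2 X I I0 (dirac_comp h1 phi)
  (dirac_comp (dproj_hom I) h1) => //.
have e1 : h = h1 by apply: hu.
have e2 : h = h2.
  apply: hu; split=> [a|b]; first by rewrite -ha.
  by rewrite dirac_compE; apply/esym/dproj_hom_eq.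
by rewrite -e1 -e2.
Qed.

(** Modulo the head of the list the two maps agree by induction, so they differ by elements of an
    ideal of square zero, where uniqueness is part of the definition. The ring changes along with
    the list, hence the induction on the length. *)
Lemma etale_list_uniq (X : diracRingType) (l : seq X) (h1 h2 : diracHom B X) :
  (forall x, x \in l -> hom_sqz x) ->
  (forall a, h1 (phi a) = h2 (phi a)) ->
  (forall b, gideal_gen l (h1 b - h2 b)) -> h1 =1 h2.
Proof.
move: {2}(size l) (erefl (size l)) => n.
elim: n X l h1 h2 => [|n IH] X [|x l] h1 h2 //= => [_|[sl]] hl ha hI.
  by move=> b; apply/eqP; rewrite -subr_eq0; apply/eqP/gideal_gen_nil.
have hx : hom_sqz x by apply: hl; rewrite inE eqxx.
apply: (etale_square_uniq (sqz_ideal_sq0 (hx := hx))) => // b.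
apply/dproj_hom_eq.
pose k := dirac_comp (dproj_hom (sqz_ideal hx)).
apply: (IH _ [seq dproj_hom (sqz_ideal hx) z | z <- l] (k _ h1) (k _ h2)) => [|y /mapP[z hz ->]|a|c].
- by rewrite size_map.
- by apply: hom_sqz_map; apply: hl; rewrite inE hz orbT.
- by rewrite !dirac_compE ha.
- by have := gideal_gen_cons_dproj (hx := hx) (hI c); rewrite raddfB.
Qed.

(** The differences on the finitely many generators of [B] lie in the ideal of a single list; modulo
    that ideal the maps agree on generators, hence everywhere. *)
Lemma etale_uniq (X : diracRingType) (h1 h2 : diracHom B X) :
  (forall a, h1 (phi a) = h2 (phi a)) ->
  (forall b, fin_gen (@hom_sqz X) (h1 b - h2 b)) -> h1 =1 h2.
Proof.
move=> ha hN; have [S [deg [v [hv [sv _]]]]] := phi_etale.1.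
have [l [hl gl]] := fin_gen_uniform (fun s => hN (v s)).
apply: (etale_list_uniq hl ha) => b.
apply/(dproj_hom_eq (list_ideal l)).
pose k := dirac_comp (dproj_hom (list_ideal l)).
apply: (ev_surj_hom_ext (h1 := k _ h1) (h2 := k _ h2) sv) => [a|s].
  by rewrite !dirac_compE ha.
by rewrite !dirac_compE; apply/(dproj_hom_eq (list_ideal l)); apply: gl.
Qed.

Lemma etale_square_lift (X Q : diracRingType) (q : diracHom X Q)
    (f : diracHom A X) (g : diracHom B Q) :
  (forall y, exists x, q x = y) ->
  (forall x y, q x = 0 -> q y = 0 -> x * y = 0) ->
  (forall a, g (phi a) = q (f a)) ->
  exists h : diracHom B X, (forall a, h (phi a) = f a) /\ forall b, q (h b) = g b.
Proof.
move=> sq q0 gf; pose I := ker_ideal q.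
have [x hx|u hu] := hom_factor (f := dproj_hom I) sq; first exact/dproj_eq0.
have [a|h [[hf hg] _]] := phi_etale.2 X I q0 f (dirac_comp u g).
  by rewrite -hu -gf.
exists h; split=> // b; have [x hx] := sq (g b); rewrite -hx.
apply/eqP; rewrite -subr_eq0 -raddfB; apply/eqP.
by apply/(dproj_hom_eq I); rewrite hg -hu hx.
Qed.

(** The map is lifted to [X] modulo the head of the list by induction, and from there to [X] along
    an ideal of square zero. For the empty list [q] is injective, and its kernel has square zero
    trivially. *)
Lemma etale_list_lift (X Q : diracRingType) (l : seq X) (q : diracHom X Q)
    (f : diracHom A X) (g : diracHom B Q) :
  (forall x, x \in l -> hom_sqz x /\ q x = 0) ->
  (forall y, exists x, q x = y) ->
  (forall x, q x = 0 -> gideal_gen l x) ->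
  (forall a, g (phi a) = q (f a)) ->
  exists h : diracHom B X, (forall a, h (phi a) = f a) /\ forall b, q (h b) = g b.
Proof.
move: {2}(size l) (erefl (size l)) => n.
elim: n X l q f => [|n IH] X [|x l] q f //= => [_|[sl]] hl sq kq gf.
  apply: etale_square_lift => // x y hx _.
  by rewrite (gideal_gen_nil (kq _ hx)) mul0r.
have [hx qx] : hom_sqz x /\ q x = 0 by apply: hl; rewrite inE eqxx.
pose I := sqz_ideal hx.
have Iq y : I y -> q y = 0.
  by apply: (hom_ideal_min (I := ker_ideal q)) => z ->.
have [|y /dproj_eq0 /Iq //|q' hq'] := hom_factor (q := dproj_hom I) (f := q).
  exact: dproj_hom_surj.
have [|y /mapP[z hz ->]|y|y|a|h' [hf' hg']] :=
  IH _ [seq dproj_hom I z | z <- l] q' (dirac_comp (dproj_hom I) f).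
- by rewrite size_map.
- have [h0 h1] : hom_sqz z /\ q z = 0 by apply: hl; rewrite inE hz orbT.
  by rewrite hq'; split=> //; apply: hom_sqz_map.
- by have [z <-] := sq y; exists (dproj_hom I z).
- have [z <-] := dproj_hom_surj y; rewrite hq' => /kq.
  exact: gideal_gen_cons_dproj.
- by rewrite gf dirac_compE hq'.
have [a|h [[hf hg] _]] := phi_etale.2 X I (sqz_ideal_sq0 (hx := hx)) f h'.
  by rewrite hf'.
by exists h; split=> // b; rewrite -hq' hg hg'.
Qed.

(* Finite presentation reduces the kernel of [q] to an ideal generated by a
   finite list of square-zero elements, which are then killed one at a time. *)
Lemma etale_lift (X Q : diracRingType) (q : diracHom X Q)
    (f : diracHom A X) (g : diracHom B Q) :
  (forall y, exists x, q x = y) ->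
  (forall x, q x = 0 -> fin_gen (fun y => hom_sqz y /\ q y = 0) x) ->
  (forall a, g (phi a) = q (f a)) ->
  exists h : diracHom B X, (forall a, h (phi a) = f a) /\ forall b, q (h b) = g b.
Proof.
move=> sq kq gf.
have [S [deg [v [hv [sv [r [_ kr]]]]]]] := phi_etale.1.
set ev := free_desc phi hv in sv kr.
have /choice[w hw] s : exists w, homog (deg s) w /\ q w = g (v s).
  by have [w ? ?] := homog_lift (sq (g (v s))) (dirac_homog g (hv s)); exists w.
(* [F] lifts [g] on the free algebra only: it sends a relation of [B] into the kernel of [q], not
   necessarily to 0. *)
pose F := free_desc f (fun s => (hw s).1).
have FE p : q (F p) = g (ev p).
  suff e : dirac_comp q F = dirac_comp g ev.
    by rewrite -[LHS]/(dirac_comp q F p) e.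
  apply: free_hom_ext => [a|s]; rewrite !dirac_compE.
    by rewrite !free_desc_const.
  by rewrite !free_desc_var (hw s).2.
have [p hp|l [hl gl]] := @fin_gen_seq _ _ (fun y => hom_sqz y /\ q y = 0) r F.
  apply: kq; rewrite FE; have -> : ev p = 0; last exact: rmorph0.
  by apply/kr/list_ideal_mem.
pose I := list_ideal l.
have Iq x : I x -> q x = 0.
  by apply: (gideal_gen_sub_ideal (I := ker_ideal q)) => y /hl[].
(* Modulo the list [l] that supports the images of the relations, [F] factors through [B]; it
   remains to lift along [X -> X / I], whose kernel is generated by [l]. *)
have [p /kr hp|g' hg'] := hom_factor (f := dirac_comp (dproj_hom I) F) sv.
  apply/dproj_eq0; apply: (gideal_gen_sub_ideal (I := preim_ideal F I)) hp.
  exact: gl.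
have [||x /dproj_eq0 //|a|h [hf hg]] :=
  etale_list_lift (l := l) (q := dproj_hom I) (f := f) (g := g').
- by move=> x hx; split; [exact: (hl _ hx).1|apply/dproj_eq0/list_ideal_mem].
- exact: dproj_hom_surj.
- by rewrite -(free_desc_const phi hv) hg' dirac_compE free_desc_const.
exists h; split=> // b; have [p hp] := sv b; rewrite -hp -FE.
apply/eqP; rewrite -subr_eq0 -raddfB; apply/eqP/Iq/dproj_hom_eq.
by rewrite hp hg -hp hg'.
Qed.
End EtaleLifting.

(** * The parity coaction *)

Section Parity.
Variable X : diracRingType.
Implicit Types (x y : X) (b : bool).

Definition par b x : X :=
  hsum (fun d y => if odd (absz d) == b then y else 0) x.

Let parD b x y : par b (x + y) = par b x + par b y.
Proof. by apply: hsumD => d u w; case: ifP; rewrite ?addr0. Qed.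

Lemma par_is_additive b : zmod_morphism (par b).
Proof. by move=> x y; rewrite parD (add_funN (parD b)). Qed.

HB.instance Definition _ b :=
  GRing.isZmodMorphism.Build X X (par b) (par_is_additive b).

Lemma par_homog b d x : homog d x -> par b x = if odd (absz d) == b then x else 0.
Proof.
by move=> hx; rewrite /par (hsum_homog _ hx) // => i u w; case: ifP; rewrite ?addr0.
Qed.

Lemma parE x : par false x + par true x = x.
Proof.
move: x; apply: homog_ext => [x y|x y|d x hx].
- by rewrite !raddfD /= addrACA.
- by [].
- by rewrite !(par_homog _ hx); case: odd; rewrite ?add0r ?addr0.
Qed.

Lemma homog_par d b x : homog d x -> homog d (par b x).
Proof. by move=> hx; rewrite (par_homog _ hx); case: ifP => // _; apply: homog0. Qed.

Lemma par_even x : even_pred (par false x).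
Proof.
elim/homog_ind: x => [|x y hx hy|d x hx].
- by rewrite raddf0; have [] := even_zmod_closed X.
- rewrite raddfD; have [h0 hB] := even_zmod_closed X.
  exact: (addr_of_subr (P := @even_pred X) h0 hB).
rewrite (par_homog _ hx); case: (boolP (odd (absz d))) => hd /=.
  by have [] := even_zmod_closed X.
exact: even_pred_homog hd hx.
Qed.

Lemma par_even_id x : even_pred x -> par false x = x.
Proof.
move=> /asboolP hx; rewrite /par [RHS]hsum_id; apply: eq_bigr => d _.
by case: (boolP (odd (absz d))) => // hd; rewrite hx.
Qed.

Lemma even_par_true x : even_pred x -> par true x = 0.
Proof. by move=> /par_even_id e; apply: (addrI (par false x)); rewrite parE addr0. Qed.

Lemma par_true_even x : par true x = 0 -> even_pred x.
Proof. by move=> e; rewrite -(parE x) e addr0; apply: par_even. Qed.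

Lemma parM b x y :
  par b (x * y) = par false x * par b y + par true x * par (~~ b) y.
Proof.
move: x; apply: homog_ext => [x x'|x x'|d x hx].
- by rewrite mulrDl raddfD.
- by rewrite !raddfD /= !mulrDl addrACA.
move: y; apply: homog_ext => [y y'|y y'|e y hy].
- by rewrite mulrDr raddfD.
- by rewrite !raddfD /= !mulrDr addrACA.
rewrite !(par_homog _ hx) !(par_homog _ hy) (par_homog _ (homogM _ _ _ _ hx hy)).
rewrite oddzD; case: (odd (absz d)); case: (odd (absz e)); case: b;
  by rewrite /= ?(mul0r, mulr0, addr0, add0r).
Qed.

Definition even_proj x : even_part X := EvenPart (par_even x).

Lemma val_even_proj x : even_val (even_proj x) = par false x.
Proof. by []. Qed.

Lemma even_projD x y : even_proj (x + y) = even_proj x + even_proj y.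
Proof. by apply: val_inj; rewrite /= raddfD. Qed.

Lemma even_valK : cancel (@even_val X) even_proj.
Proof. by move=> x; apply: val_inj; rewrite /= par_even_id //; apply: valP. Qed.

Lemma even_projMl (r : even_part X) x :
  even_proj (even_val r * x) = r * even_proj x.
Proof.
apply: val_inj; rewrite /= parM.
by rewrite (par_even_id (valP r)) (even_par_true (valP r)) mul0r addr0.
Qed.

Lemma even_projMr (r : even_part X) x :
  even_proj (x * even_val r) = even_proj x * r.
Proof.
apply: val_inj; rewrite /= parM.
by rewrite (par_even_id (valP r)) (even_par_true (valP r)) mulr0 addr0.
Qed.
End Parity.

Lemma hom_par (X Y : diracRingType) (f : diracHom X Y) b x :
  f (par b x) = par b (f x).
Proof.
move: x; apply: homog_ext => [x y|x y|d x hx]; try by rewrite !raddfD.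
rewrite (par_homog _ hx) (par_homog _ (dirac_homog f hx)).
by case: ifP; rewrite ?raddf0.
Qed.

Lemma hom_even (X Y : diracRingType) (f : diracHom X Y) x :
  even_pred x -> even_pred (f x).
Proof. by move=> hx; apply: par_true_even; rewrite -hom_par even_par_true ?raddf0. Qed.

(* The coefficients [(x, y)] stand for [x + y e], where [e] has degree 0 and
   [e * e = 1]. *)
Section GroupRing.
Variable X : diracRingType.

Definition grp2 : Type := (X * X)%type.
HB.instance Definition _ := GRing.Zmodule.on grp2.
Implicit Types p q : grp2.

Definition grp2_pair (x y : X) : grp2 := (x, y).

Definition grp2_mul p q : grp2 :=
  grp2_pair (p.1 * q.1 + p.2 * q.2) (p.1 * q.2 + p.2 * q.1).

Let pairE (a b c d : X) : a = c -> b = d -> grp2_pair a b = grp2_pair c d.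
Proof. by move=> -> ->. Qed.

Lemma grp2_mulA : associative grp2_mul.
Proof.
move=> [a b] [c d] [e f]; rewrite /grp2_mul /=.
by apply: pairE; rewrite !mulrDl !mulrDr !mulrA [RHS]addrACA;
  congr (_ + _); apply: addrC.
Qed.

Lemma grp2_mul1l : left_id (grp2_pair 1 0) grp2_mul.
Proof. by move=> [a b]; rewrite /grp2_mul /= !mul1r !mul0r !addr0. Qed.

Lemma grp2_mul1r : right_id (grp2_pair 1 0) grp2_mul.
Proof. by move=> [a b]; rewrite /grp2_mul /= !mulr1 !mulr0 add0r addr0. Qed.

Lemma grp2_mulDl : left_distributive grp2_mul +%R.
Proof.
move=> [a b] [c d] [e f]; rewrite /grp2_mul /=.
by apply: pairE; rewrite /= !mulrDl addrACA.
Qed.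

Lemma grp2_mulDr : right_distributive grp2_mul +%R.
Proof.
move=> [a b] [c d] [e f]; rewrite /grp2_mul /=.
by apply: pairE; rewrite /= !mulrDr addrACA.
Qed.

HB.instance Definition _ := GRing.Zmodule_isPzRing.Build grp2
  grp2_mulA grp2_mul1l grp2_mul1r grp2_mulDl grp2_mulDr.

Definition grp2_homog d p : Prop := homog d p.1 /\ homog d p.2.

Lemma grp2_homog0 d : grp2_homog d 0.
Proof. by split; apply: homog0. Qed.

Lemma grp2_homogB d p q : grp2_homog d p -> grp2_homog d q -> grp2_homog d (p - q).
Proof. by move=> [? ?] [? ?]; split; apply: homogB. Qed.

Lemma grp2_homog1 : grp2_homog 0 1.
Proof. by split; [apply: homog1|apply: homog0]. Qed.

Lemma grp2_homogM d e p q :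
  grp2_homog d p -> grp2_homog e q -> grp2_homog (d + e) (p * q).
Proof. by move=> [? ?] [? ?]; split; apply: homogD; apply: homogM. Qed.

Lemma grp2_homogC d e p q :
  grp2_homog d p -> grp2_homog e q -> p * q = (q * p) *~ koszul d e.
Proof.
case: p q => [a b] [a' b'] [/= ha hb] [/= ha' hb'].
have pMz (u w : X) n : grp2_pair u w *~ n = grp2_pair (u *~ n) (w *~ n).
  have h m : grp2_pair u w *+ m = grp2_pair (u *+ m) (w *+ m).
    by elim: m => // m IH; rewrite !mulrS IH.
  case: n => n; first exact: h.
  by rewrite NegzE !mulrNz; apply: (congr1 -%R (h n.+1)).
rewrite pMz; apply: pairE.
  by rewrite /= (homogC _ _ _ _ ha ha') (homogC _ _ _ _ hb hb') -mulrzDl.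
by rewrite /= (homogC _ _ _ _ ha hb') (homogC _ _ _ _ hb ha') -mulrzDl addrC.
Qed.

Lemma grp2_decomp p : exists! c, is_decomposition grp2_homog p c.
Proof.
apply: (decomp_from_proj
  (p := fun d (p : grp2) => grp2_pair (hcomp d p.1) (hcomp d p.2))) => {p}.
- by move=> d [a b] [a' b']; rewrite /= !raddfD.
- by move=> d p; split; apply: homog_comp.
- move=> d e [a b] [/= ha hb]; rewrite (hcomp_homog _ ha) (hcomp_homog _ hb).
  by case: ifP.
move=> P P0 PD Ph [a b].
have -> : (a, b) = grp2_pair a 0 + grp2_pair 0 b by apply: pairE; rewrite /= ?addr0 ?add0r.
apply: (PD).
  elim/homog_ind: a => [|x y hx hy|d x hx]; first exact: P0.
    have -> : grp2_pair (x + y) 0 = grp2_pair x 0 + grp2_pair y 0 by apply: pairE; rewrite //= addr0.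
    exact: PD.
  by apply: (Ph d); split=> //; apply: homog0.
elim/homog_ind: b => [|x y hx hy|d x hx]; first exact: P0.
  have -> : grp2_pair 0 (x + y) = grp2_pair 0 x + grp2_pair 0 y by apply: pairE; rewrite //= addr0.
  exact: PD.
by apply: (Ph d); split=> //; apply: homog0.
Qed.

HB.instance Definition _ := PzRing_isDirac.Build grp2
  grp2_homog0 grp2_homogB grp2_homog1 grp2_homogM grp2_decomp grp2_homogC.

Let constB x y : grp2_pair (x - y) 0 = grp2_pair x 0 - grp2_pair y 0.
Proof. by apply: pairE; rewrite /= ?subr0. Qed.

Let constM x y : grp2_pair (x * y) 0 = grp2_pair x 0 * grp2_pair y 0.
Proof. by apply: pairE; rewrite /= ?mulr0 ?mul0r ?addr0. Qed.

Let consth d x : homog d x -> homog d (grp2_pair x 0).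
Proof. by move=> hx; split=> //; apply: homog0. Qed.

Definition grp2_const : diracHom X grp2 :=
  build_hom (f := grp2_pair^~ 0) constB erefl constM consth.

Let parityB x y : grp2_pair (par false (x - y)) (par true (x - y)) =
  grp2_pair (par false x) (par true x) - grp2_pair (par false y) (par true y).
Proof. by rewrite !raddfB. Qed.

Let parity1 : grp2_pair (par false 1) (par true 1) = 1.
Proof. by rewrite !(par_homog _ (@homog1 X)). Qed.

Let parityM x y : grp2_pair (par false (x * y)) (par true (x * y)) =
  grp2_pair (par false x) (par true x) * grp2_pair (par false y) (par true y).
Proof. by rewrite !parM. Qed.

Let parityh d x : homog d x -> homog d (grp2_pair (par false x) (par true x)).
Proof. by move=> hx; split; apply: homog_par. Qed.

(* The coaction of the group of order 2 that defines the parity grading. *)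
Definition parity : diracHom X grp2 :=
  build_hom (f := fun x => grp2_pair (par false x) (par true x))
    parityB parity1 parityM parityh.

Lemma parityE x : parity x = grp2_pair (par false x) (par true x).
Proof. by []. Qed.

Lemma grp2_constE x : grp2_const x = grp2_pair x 0.
Proof. by []. Qed.

Lemma odd_sqr2 d (x : X) : odd (absz d) -> homog d x -> x * x + x * x = 0.
Proof.
move=> hd hx; rewrite {1}(homogC _ _ _ _ hx hx) koszulE hd /= expr1 mulrN1z.
exact: addNr.
Qed.

Lemma parity_fin_gen x : fin_gen (@hom_sqz grp2) (parity x - grp2_const x).
Proof.
elim/homog_ind: x => [|x y hx hy|d x hx].
- rewrite !rmorph0. rewrite subrr; exact: fin_gen0.
- by rewrite !rmorphD opprD addrACA; apply: fin_genD.
rewrite parityE grp2_constE !(par_homog _ hx); case: (boolP (odd (absz d))) => hd /=.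
  (* This is [(e - 1) x]; its square has the coefficients [2 x^2] and [- 2 x^2]. *)
  have -> : grp2_pair 0 x - grp2_pair x 0 = grp2_pair (- x) x.
    by apply: pairE; rewrite /= ?sub0r ?subr0.
  apply: fin_gen_mem; split; first by exists d; split=> //; apply: homogN.
  have e := odd_sqr2 hd hx.
  by apply: pairE; rewrite /= ?mulrNN ?mulrN ?mulNr ?e // -opprD e oppr0.
rewrite subrr; exact: fin_gen0.
Qed.
End GroupRing.

Section GroupRingMap.
Variables (X Y : diracRingType) (f : diracHom X Y).

Let F (p : grp2 X) : grp2 Y := grp2_pair (f p.1) (f p.2).

Let FB p q : F (p - q) = F p - F q.
Proof. by rewrite /F /= !raddfB. Qed.

Let F1 : F 1 = 1.
Proof. by rewrite /F /= rmorph1 rmorph0. Qed.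

Let FM p q : F (p * q) = F p * F q.
Proof. by rewrite /F /= !rmorphD !rmorphM. Qed.

Let Fh d p : homog d p -> homog d (F p).
Proof. by move=> [h1 h2]; split; apply: dirac_homog. Qed.

Definition grp2_map : diracHom (grp2 X) (grp2 Y) := build_hom FB F1 FM Fh.

Lemma grp2_mapE p : grp2_map p = grp2_pair (f p.1) (f p.2).
Proof. by []. Qed.
End GroupRingMap.

(** [parity] and [grp2_const] agree on the even ring [R], hence on [C]; the coefficient of [e] then
    says that odd parts vanish. *)
Lemma etale_even (R C : diracRingType) (g : diracHom R C) :
  etale g -> (forall r : R, even_pred r) -> forall c : C, even_pred c.
Proof.
move=> eg hR c; apply: par_true_even.
suff /(_ c) : parity C =1 grp2_const C by rewrite parityE grp2_constE => -[].
apply: (etale_uniq eg) => [r|b]; last exact: parity_fin_gen.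
have hr := hom_even g (hR r).
by rewrite parityE grp2_constE (par_even_id hr) (even_par_true hr).
Qed.

(** * Extension of scalars of the even part *)

Lemma fin_gen_map (X Y : diracRingType) (f : diracHom X Y) (G : X -> Prop)
    (G' : Y -> Prop) x :
  (forall y, G y -> G' (f y)) -> fin_gen G x -> fin_gen G' (f x).
Proof.
move=> GG' [l [hl gl]]; exists [seq f y | y <- l]; split.
  by move=> _ /mapP[y /hl hy ->]; apply: GG'.
exact: gideal_gen_map.
Qed.

Section EvenCorestriction.
Variables (X Y : diracRingType) (f : diracHom X Y).
Hypothesis hf : forall x, even_pred (f x).

Let F x : even_part Y := EvenPart (hf x).

Let FB x y : F (x - y) = F x - F y.
Proof. by apply: val_inj; rewrite /= raddfB. Qed.

Let F1 : F 1 = 1.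
Proof. by apply: val_inj; rewrite /= rmorph1. Qed.

Let FM x y : F (x * y) = F x * F y.
Proof. by apply: val_inj; rewrite /= rmorphM. Qed.

Let Fh d x : homog d x -> homog d (F x).
Proof. exact: dirac_homog. Qed.

Definition even_corestr : diracHom X (even_part Y) := build_hom FB F1 FM Fh.

Lemma even_corestrE x : even_val (even_corestr x) = f x.
Proof. by []. Qed.
End EvenCorestriction.

Lemma even_inclE (X : diracRingType) (x : even_part X) : even_incl X x = even_val x.
Proof. by []. Qed.

Lemma even_incl_inj (X : diracRingType) (x y : even_part X) :
  even_incl X x = even_incl X y -> x = y.
Proof. exact: val_inj. Qed.

Lemma even_part_even (X : diracRingType) (x : even_part X) : even_pred x.
Proof.
apply: par_true_even; apply: even_incl_inj.
by rewrite hom_par raddf0 even_inclE even_par_true //; apply: valP.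
Qed.

Lemma even_map_even (X Y : diracRingType) (f : diracHom X Y) (x : even_part X) :
  even_pred (dirac_comp f (even_incl X) x).
Proof. by apply/hom_even/even_part_even. Qed.

Definition even_map (X Y : diracRingType) (f : diracHom X Y) :
    diracHom (even_part X) (even_part Y) :=
  even_corestr (even_map_even f).

Lemma even_mapE (X Y : diracRingType) (f : diracHom X Y) (x : even_part X) :
  even_incl Y (even_map f x) = f (even_incl X x).
Proof. by []. Qed.

Section EvenTensor.
Variables (A C : diracRingType) (g : diracHom (even_part A) C).

Let T := tensor (even_incl A) g.

Let k (a : A) (c : C) : C := g (even_proj a) * c.

Let kDl a a' c : k (a + a') c = k a c + k a' c.
Proof. by rewrite /k even_projD rmorphD mulrDl. Qed.

Let kDr a c c' : k a (c + c') = k a c + k a c'.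
Proof. by rewrite /k mulrDr. Qed.

Let kbal a r c : k (a * even_incl A r) c = k a (g r * c).
Proof. by rewrite /k even_projMr rmorphM mulrA. Qed.

Let krel := tensor_rel_lift kDl kDr kbal.

(** The [A^ev]-linear retraction [even_proj] of [A] onto [A^ev], tensored with [C]. It is additive
    but not multiplicative, and it makes [C -> A (x) C] injective for every [C]. *)
Definition tens_even_part (t : T) : C :=
  pres_lift (fun x => g (even_proj x.1) * x.2) t.

Lemma tens_even_part_tens a c :
  tens_even_part (tens (even_incl A) g a c) = g (even_proj a) * c.
Proof. exact: (pres_lift_gen krel). Qed.

Lemma tens_even_partB t u :
  tens_even_part (t - u) = tens_even_part t - tens_even_part u.
Proof. exact: (pres_liftB krel). Qed.

Lemma tens_even_part0 : tens_even_part 0 = 0.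
Proof. exact: (pres_lift0 krel). Qed.

Lemma tens_even_part_inr c : tens_even_part (tens_inr (even_incl A) g c) = c.
Proof.
rewrite [LHS]tens_even_part_tens.
by rewrite -[1]/(even_val (1 : even_part A)) even_valK rmorph1 mul1r.
Qed.

Lemma tens_inr_inj c c' :
  tens_inr (even_incl A) g c = tens_inr (even_incl A) g c' -> c = c'.
Proof. by move=> e; rewrite -[c]tens_even_part_inr e tens_even_part_inr. Qed.

Hypothesis hC : forall c : C, even_pred c.

(** As [C] is even, the even part of [a (x) c] is [par false a (x) c], and [par false a] lies in
    [A^ev], so it moves to the right factor. *)
Lemma tens_inr_even_part t :
  tens_inr (even_incl A) g (tens_even_part t) = par false t.
Proof.
elim/tensor_ind: t => [|a c|t u ht hu].
- by rewrite tens_even_part0 !rmorph0 raddf0.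
- rewrite tens_even_part_tens -tens1M.
  rewrite -[tens _ _ a 1]/(tens_inl (even_incl A) g a).
  rewrite -[tens _ _ 1 c]/(tens_inr (even_incl A) g c).
  rewrite parM -!hom_par (par_even_id (hC c)) (even_par_true (hC c)).
  by rewrite rmorph0 mulr0 addr0 rmorphM -tens_inlr even_inclE val_even_proj.
- by rewrite tens_even_partB !raddfB /= ht hu.
Qed.

Lemma tens_inr_even t : even_pred t ->
  tens_inr (even_incl A) g (tens_even_part t) = t.
Proof. by move=> ht; rewrite tens_inr_even_part par_even_id. Qed.
End EvenTensor.

Section EvenDescent.
Variables (A B : diracRingType) (phi : diracHom A B).
Hypothesis phi_etale : etale phi.

Let i := even_incl A.
Let phi0 : diracHom (even_part A) B := dirac_comp phi i.
Let E := tensor i phi0.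
Let T := tensor i (even_map phi).
Let inlE : diracHom A E := tens_inl i phi0.
Let inrE : diracHom B E := tens_inr i phi0.
Let inlT : diracHom A T := tens_inl i (even_map phi).
Let inrT : diracHom (even_part B) T := tens_inr i (even_map phi).

Let inlrE a : even_pred a -> inlE a = inrE (phi a).
Proof. by move=> ha; apply: (tens_inlr i phi0 (EvenPart ha)). Qed.

Let tensE a b : tens i phi0 a b = inlE a * inrE b.
Proof. by rewrite -tens1M. Qed.

Let tensT a b : tens i (even_map phi) a b = inlT a * inrT b.
Proof. by rewrite -tens1M. Qed.

Let muE : diracHom E B :=
  tens_desc (fun r => erefl : phi (i r) = dirac_id B (phi0 r)).

Let muE_inl a : muE (inlE a) = phi a.
Proof. exact: tens_desc_inl. Qed.

Let muE_inr b : muE (inrE b) = b.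
Proof. exact: tens_desc_inr. Qed.

Lemma even_counit_bal r : phi (even_incl A r) = even_incl B (even_map phi r).
Proof. by []. Qed.

Definition even_counit : diracHom T B := tens_desc even_counit_bal.

Lemma even_counit_inl a : even_counit (inlT a) = phi a.
Proof. exact: tens_desc_inl. Qed.

Lemma even_counit_inr b : even_counit (inrT b) = even_val b.
Proof. exact: tens_desc_inr. Qed.

Let iota_bal r : inlE (i r) = dirac_comp inrE (even_incl B) (even_map phi r).
Proof. exact: tens_inlr. Qed.

Let iota : diracHom T E := tens_desc iota_bal.

Let iota_inl a : iota (inlT a) = inlE a.
Proof. exact: tens_desc_inl. Qed.

Let iota_inr b : iota (inrT b) = inrE (even_val b).
Proof. exact: tens_desc_inr. Qed.

Let muE_iota t : muE (iota t) = even_counit t.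
Proof.
suff e : dirac_comp muE iota = even_counit by rewrite -e.
apply: tens_hom_ext => [a|b]; rewrite dirac_compE.
  by rewrite iota_inl muE_inl even_counit_inl.
by rewrite iota_inr muE_inr even_counit_inr.
Qed.

Let k (a : A) (b : B) : T := tens i (even_map phi) a (even_proj b).

Let kDl a a' b : k (a + a') b = k a b + k a' b.
Proof. exact: tensDl. Qed.

Let kDr a b b' : k a (b + b') = k a b + k a b'.
Proof. by rewrite /k even_projD tensDr. Qed.

Let kbal a r b : k (a * i r) b = k a (phi0 r * b).
Proof.
rewrite /k tens_bal; congr tens; rewrite -even_projMl; congr even_proj.
Qed.

Let krel := tensor_rel_lift kDl kDr kbal.

(** The additive map [id (x) even_proj] from [A (x) B] to [A (x) B^ev]. *)
Let s : E -> T := pres_lift (fun x => k x.1 x.2).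

Let s_tens a b : s (inlE a * inrE b) = inlT a * inrT (even_proj b).
Proof. by rewrite -tensE -tensT; apply: (pres_lift_gen krel). Qed.

Let sB t u : s (t - u) = s t - s u.
Proof. exact: (pres_liftB krel). Qed.

Let s0 : s 0 = 0.
Proof. exact: (pres_lift0 krel). Qed.

Let tau_bal r : dirac_comp (grp2_const E) inlE (i r) =
  dirac_comp (grp2_map inrE) (parity B) (phi0 r).
Proof.
have hr : even_pred (phi0 r) := even_map_even phi r.
rewrite !dirac_compE grp2_mapE parityE grp2_constE (par_even_id hr).
rewrite (even_par_true hr); congr grp2_pair; first exact: tens_inlr.
by rewrite [RHS]rmorph0.
Qed.

(** The parity coaction of the factor [B] alone, with [A] held fixed. Its coefficient at 1 is [iota]
    after [s], so an element that [tau] fixes comes from [A (x) B^ev]. *)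
Let tau : diracHom E (grp2 E) := tens_desc tau_bal.

Let tau_tens a b : tau (inlE a * inrE b) =
  grp2_const E (inlE a) * grp2_map inrE (parity B b).
Proof. by rewrite rmorphM; congr (_ * _); [apply: tens_desc_inl|apply: tens_desc_inr]. Qed.

Let tau1 t : (tau t).1 = iota (s t).
Proof.
elim/tensor_ind: t => [|a b|t u ht hu].
- by rewrite s0 !rmorph0.
- rewrite tensE s_tens tau_tens rmorphM iota_inl iota_inr.
  by rewrite grp2_constE grp2_mapE parityE /= mul0r addr0.
- by rewrite sB !rmorphB /= ht hu.
Qed.

Let tau_fin_gen t : fin_gen (@hom_sqz (grp2 E)) (tau t - grp2_const E t).
Proof.
elim/tensor_ind: t => [|a b|t u ht hu].
- by rewrite !rmorph0 subrr; apply: fin_gen0.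
- rewrite tensE tau_tens rmorphM -mulrBr; apply: fin_genMl.
  have -> : grp2_const E (inrE b) = grp2_map inrE (grp2_const B b).
    by rewrite grp2_mapE !grp2_constE; congr grp2_pair; rewrite [RHS]rmorph0.
  rewrite -rmorphB; apply: (fin_gen_map (G := @hom_sqz (grp2 B))).
    by move=> y; apply: hom_sqz_map.
  exact: parity_fin_gen.
- by rewrite !rmorphB opprD addrACA -opprD; apply: fin_genB.
Qed.

(** For [t = a (x) b] the difference is [(a (x) 1 - 1 (x) phi a) (1 (x) b)]. The first factor
    vanishes for even [a] and has square zero for odd [a]. *)
Let muE_fin_gen t : fin_gen (fun x => hom_sqz x /\ muE x = 0) (t - inrE (muE t)).
Proof.
elim/tensor_ind: t => [|a b|t u ht hu].
- by rewrite !rmorph0 subrr; apply: fin_gen0.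
- rewrite tensE !rmorphM muE_inl muE_inr -mulrBl; apply: fin_genMr.
  elim/homog_ind: a => [|x y hx hy|d a ha].
  + by rewrite !rmorph0 subrr; apply: fin_gen0.
  + by rewrite !rmorphD opprD addrACA; apply: fin_genD.
  case: (boolP (odd (absz d))) => hd; last first.
    by rewrite inlrE ?subrr; [apply: fin_gen0|apply: even_pred_homog ha].
  apply: fin_gen_mem; split; last by rewrite rmorphB muE_inl muE_inr subrr.
  have hy := dirac_homog inlE ha; have hz := dirac_homog inrE (dirac_homog phi ha).
  (* The square of an odd element is even, hence may cross the tensor sign. *)
  have e : inrE (phi a) * inrE (phi a) = inlE a * inlE a.
    rewrite -[RHS]rmorphM inlrE ?rmorphM //.
    apply: (@even_pred_homog _ (d + d)); last exact: homogM.
    by rewrite oddzD addbb.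
  split; first by exists d; apply: homogB.
  rewrite mulrBl !mulrBr (homogC _ _ _ _ hy hz) koszulE hd /= expr1 mulrN1z opprK.
  by rewrite opprB addrACA subrr addr0 e (odd_sqr2 hd hy).
- by rewrite !rmorphB opprD addrACA -opprD; apply: fin_genB.
Qed.

(* Since [A (x) B -> B] is surjective with locally nilpotent kernel, it has an
   [A]-linear section [rho]; invariance under the parity of the factor [B]
   forces the image of [rho] into [A (x) B^ev]. *)
Lemma even_counit_bij : (forall b, exists t, even_counit t = b) /\
  (forall t, even_counit t = 0 -> t = 0).
Proof.
have [b|t ht|a|rho [rho_phi muE_rho]] :=
  etale_lift phi_etale (q := muE) (f := inlE) (g := dirac_id B).
- by exists (inrE b).
- by have := muE_fin_gen t; rewrite ht rmorph0 subr0.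
- by rewrite muE_inl.
have tau_rho : dirac_comp tau rho =1 dirac_comp (grp2_const E) rho.
  apply: (etale_uniq phi_etale) => [a|b]; rewrite !dirac_compE.
    by rewrite rho_phi; apply: tens_desc_inl.
  exact: tau_fin_gen.
have s_rho b : iota (s (rho b)) = rho b.
  by rewrite -tau1; have := tau_rho b; rewrite !dirac_compE => ->.
(* For even [b] the element [rho b] is even and comes from [A (x) B^ev], whose even part is
   [1 (x) B^ev]; applying [muE] identifies the second factor as [b]. *)
have rho_even b : even_pred b -> rho b = inrE b.
  move=> hb; have e := s_rho b.
  rewrite -(par_even_id (hom_even rho hb)) -{1}e -hom_par.
  rewrite -(tens_inr_even_part (@even_part_even B)).
  set c := tens_even_part _.
  suff ec : even_val c = b by rewrite -ec; apply: iota_inr.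
  rewrite -[RHS]muE_rho -(par_even_id (hom_even rho hb)) -{1}e -hom_par.
  rewrite -(tens_inr_even_part (@even_part_even B)) -/c.
  by rewrite [iota _]iota_inr muE_inr.
split=> [b|t ht].
  by exists (s (rho b)); rewrite -muE_iota s_rho muE_rho.
(* On [a (x) b] with [b] even, [rho] returns [a (x) b] by [A]-linearity and [rho_even], and [s]
   keeps [b]. *)
suff : s (rho (even_counit t)) = t by rewrite ht rmorph0 s0.
elim/tensor_ind: {ht} t => [|a b|t u ht hu].
- by rewrite !rmorph0 s0.
- rewrite tensT !rmorphM even_counit_inl even_counit_inr rho_phi rho_even.
    by rewrite s_tens even_valK.
  exact: valP.
- by rewrite !rmorphB sB ht hu.
Qed.
End EvenDescent.

(** * Finite presentation and base change *)

Lemma gideal_gen_hom0 (X Y : diracRingType) (f : diracHom X Y) (l : seq X) x :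
  (forall y, y \in l -> f y = 0) -> gideal_gen l x -> f x = 0.
Proof. by move=> hl; apply: (gideal_gen_sub_ideal (I := ker_ideal f)). Qed.

(** A map back from [Y] to [X / (l)] bounds the kernel from above. Such maps come from universal
    properties, which avoids computing in free algebras. *)
Lemma kernel_criterion (X Y : diracRingType) (q : diracHom X Y) (l : seq X)
    (h : diracHom Y (dquot (list_ideal l))) :
  (forall x, x \in l -> q x = 0) ->
  dirac_comp h q = dproj_hom (list_ideal l) ->
  forall x, q x = 0 <-> gideal_gen l x.
Proof.
move=> hl hq x; split; last exact: gideal_gen_hom0.
by move=> qx; apply/(dproj_eq0 (list_ideal l)); rewrite -hq dirac_compE qx rmorph0.
Qed.

Section FreeMap.
Variables (R A : diracRingType) (f : diracHom R A) (S : choiceType) (deg : S -> int).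

Definition free_map : diracHom (free_alg R deg) (free_alg A deg) :=
  free_desc (dirac_comp (free_const A deg) f) (@free_var_homog A S deg).

Lemma free_map_const r : free_map (free_const R deg r) = free_const A deg (f r).
Proof. exact: free_desc_const. Qed.

Lemma free_map_var s : free_map (free_var R deg s) = free_var A deg s.
Proof. exact: free_desc_var. Qed.

Lemma free_map_mono r w : free_map (mono deg r w) = mono deg (f r) w.
Proof.
rewrite !monoE rmorphM free_map_const rmorph_prod; congr (_ * _).
by apply: eq_bigr => s _; apply: free_map_var.
Qed.
End FreeMap.

Section BaseChange.
Variables (R A C : diracRingType) (f : diracHom R A) (g : diracHom R C).

Let inl : diracHom A (tensor f g) := tens_inl f g.
Let inr : diracHom C (tensor f g) := tens_inr f g.

(** Generators and relations are kept. The map back to the quotient of [A[S]] is given on [A] by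
    constants and on [C] by its own presentation. *)
Lemma fp_base_change : finitely_presented g -> finitely_presented inl.
Proof.
move=> [S [deg [v [hv [sv [r [hr kr]]]]]]].
set ev := free_desc g hv in sv kr.
pose b := free_map f deg.
exists S, deg, (fun s => inr (v s)), (fun s => dirac_homog inr (hv s)).
set ev' := free_desc _ _.
have ev'b p : ev' (b p) = inr (ev p).
  suff e : dirac_comp ev' b = dirac_comp inr ev.
    by rewrite -[LHS]/(dirac_comp ev' b p) e.
  apply: free_hom_ext => [a|s]; rewrite !dirac_compE.
    by rewrite free_map_const !free_desc_const; apply: tens_inlr.
  by rewrite free_map_var !free_desc_var.
split.
  elim/tensor_ind => [|a c|p q [p' hp] [q' hq]].
  - by exists 0; rewrite rmorph0.
  - have [p <-] := sv c; exists (free_const A deg a * b p).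
    by rewrite rmorphM ev'b free_desc_const; apply: tens1M.
  - by exists (p' - q'); rewrite rmorphB hp hq.
exists [seq b p | p <- r]; split.
  by move=> _ /mapP[p /hr[d hd] ->]; exists d; apply: dirac_homog.
set l := [seq b p | p <- r]; pose pr := dproj_hom (list_ideal l).
have [p /kr hp|u hu] := hom_factor (f := dirac_comp pr b) sv.
  by apply/dproj_eq0; apply: gideal_gen_map.
have bal x : dirac_comp pr (free_const A deg) (f x) = u (g x).
  by rewrite -(free_desc_const g hv) hu !dirac_compE free_map_const.
apply: (kernel_criterion (h := tens_desc bal)).
  move=> _ /mapP[p hp ->]; rewrite ev'b; have -> : ev p = 0; last exact: rmorph0.
  by apply/kr/list_ideal_mem.
apply: free_hom_ext => [a|s]; rewrite dirac_compE.
  by rewrite free_desc_const [LHS]tens_desc_inl.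
rewrite free_desc_var [LHS]tens_desc_inr -(free_desc_var g hv) hu dirac_compE.
by rewrite free_map_var.
Qed.

Lemma etale_base_change : etale g -> etale inl.
Proof.
move=> eg; split; first exact: fp_base_change eg.1.
move=> X I I0 f' g' gf.
have [r|h [[hf hg] hu]] :=
  eg.2 X I I0 (dirac_comp f' f) (dirac_comp g' inr).
  by rewrite !dirac_compE -gf; congr (g' _); apply/esym/tens_inlr.
have bal r : f' (f r) = h (g r) by rewrite hf.
exists (tens_desc bal); split.
  split=> [a|t]; first exact: tens_desc_inl.
  rewrite -[LHS]/(dirac_comp (dproj_hom I) (tens_desc bal) t); congr (_ t).
  congr (dirac_rmorphism _).
  apply: tens_hom_ext => [a|c]; rewrite dirac_compE.
    by rewrite tens_desc_inl -gf.
  by rewrite tens_desc_inr hg.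
move=> h' [hf' hg']; apply: tens_hom_ext => [a|c].
  by rewrite tens_desc_inl hf'.
rewrite tens_desc_inr (hu (dirac_comp h' inr)) //; split=> [r|c'].
  by rewrite !dirac_compE -hf'; congr (h' _); apply/esym/tens_inlr.
by rewrite !dirac_compE hg'.
Qed.
End BaseChange.

Section ChangeGenerators.
Variables (A B : diracRingType) (phi : diracHom A B).
Variables (S : finType) (deg : S -> int) (v : S -> B).
Hypothesis hv : forall s, homog (deg s) (v s).

Let ev := free_desc phi hv.

Lemma fp_change_generators : finitely_presented phi ->
  (forall b, exists p, ev p = b) ->
  exists l : seq (free_alg A deg),
    (forall p, p \in l -> exists d, homog d p) /\
    forall p, ev p = 0 <-> gideal_gen l p.
Proof.
move=> [S' [deg' [v' [hv' [sv' [r [hr kr]]]]]]] sv.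
set ev' := free_desc phi hv' in sv' kr.
have /choice[p hp] s : exists p, homog (deg' s) p /\ ev p = v' s.
  by have [p ? ?] := homog_lift (sv (v' s)) (hv' s); exists p.
have /choice[q hq] s : exists q, homog (deg s) q /\ ev' q = v s.
  by have [q ? ?] := homog_lift (sv' (v s)) (hv s); exists q.
pose al := free_desc (free_const A deg) (fun s => (hp s).1).
have ev_al t : ev (al t) = ev' t.
  suff e : dirac_comp ev al = ev' by rewrite -e.
  apply: free_hom_ext => [a|s]; rewrite dirac_compE.
    by rewrite !free_desc_const.
  by rewrite !free_desc_var (hp s).2.
(* Besides the old relations rewritten in the new generators, each new generator must equal its
   expression through the old ones. *)
pose F s := free_var A deg s - al (q s).
pose l := [seq al t | t <- r] ++ [seq F s | s <- enum S].
have FI s : list_ideal l (F s).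
  by apply: list_ideal_mem; rewrite mem_cat map_f ?mem_enum ?orbT.
pose pr := dproj_hom (list_ideal l).
have [t /kr ht|u hu] := hom_factor (f := dirac_comp pr al) sv'.
  apply/dproj_eq0; apply: gideal_gen_sub (gideal_gen_map (f := al) ht) => y hy.
  by rewrite mem_cat hy.
exists l; split.
  move=> t; rewrite mem_cat => /orP[/mapP[t' /hr[d hd] ->]|/mapP[s _ ->]].
    by exists d; apply: dirac_homog.
  exists (deg s); apply: homogB; first exact: free_var_homog.
  by apply: dirac_homog; apply: (hq s).1.
apply: (kernel_criterion (h := u)).
  move=> t; rewrite mem_cat => /orP[/mapP[t' ht' ->]|/mapP[s _ ->]].
    by rewrite ev_al; apply/kr/list_ideal_mem.
  by rewrite rmorphB ev_al (hq s).2 free_desc_var subrr.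
apply: free_hom_ext => [a|s]; rewrite dirac_compE.
  by rewrite free_desc_const -(free_desc_const phi hv') hu dirac_compE free_desc_const.
rewrite free_desc_var -(hq s).2 hu; apply/esym/dproj_hom_eq; exact: FI.
Qed.
End ChangeGenerators.

(** * Descent to the even part *)

Section ImageIdeal.
Variables (X Y : diracRingType) (f : diracHom X Y) (I : gradedIdeal X).

Definition image_gen (y : Y) : Prop :=
  exists x, [/\ exists d, homog d x, I x & y = f x].

Lemma image_gen_homog y : image_gen y -> exists d, homog d y.
Proof. by move=> [x [[d hd] _ ->]]; exists d; apply: dirac_homog. Qed.

Definition image_ideal : gradedIdeal Y := hom_ideal image_gen_homog.

Lemma image_ideal_mem x : I x -> image_ideal (f x).
Proof.
move=> hx; rewrite [x]hsum_id /hsum rmorph_sum.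
have D := addr_of_subr (gideal0 image_ideal) (@gidealB _ image_ideal).
elim/big_ind: _ => [||d _]; [exact: gideal0|exact: D|].
apply: hom_ideal_gen; exists (hcomp d x); split=> //; last exact: gideal_comp.
by exists d; apply: homog_comp.
Qed.
End ImageIdeal.

(** An element of odd degree in the even part is 0, which also has degree 0. Generators may thus be
    given even degrees. *)
Lemma even_part_homog (X : diracRingType) d (x : even_part X) : homog d x ->
  exists e, ~~ odd (absz e) /\ homog e x.
Proof.
move=> hx; case: (boolP (odd (absz d))) => hd; last by exists d.
have := even_par_true (even_part_even x); rewrite (par_homog _ hx) hd /= => ->.
by exists 0; split=> //; apply: homog0.
Qed.

Section FreeEvenPart.
Variables (A : diracRingType) (S : choiceType) (deg : S -> int).

Let L (x : A * seq S) : free_alg (even_part A) deg := mono deg (even_proj x.1) x.2.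

Let Lrel s t : free_rel deg s t -> \sum_(x <- s) L x = \sum_(x <- t) L x.
Proof.
case=> [a b w|a u x y v]; rewrite !big_cons !big_nil !addr0 /L /=.
  by rewrite even_projD monoD.
by rewrite mono_swap -(add_funMz (@even_projD A)).
Qed.

Definition free_even_part (p : free_alg A deg) : free_alg (even_part A) deg :=
  pres_lift L p.

Lemma free_even_part_mono a w :
  free_even_part (mono deg a w) = mono deg (even_proj a) w.
Proof. exact: (pres_lift_gen Lrel). Qed.

Lemma free_even_partB p q :
  free_even_part (p - q) = free_even_part p - free_even_part q.
Proof. exact: (pres_liftB Lrel). Qed.

Lemma free_even_part0 : free_even_part 0 = 0.
Proof. exact: (pres_lift0 Lrel). Qed.

Let b := free_map (even_incl A) deg.

Lemma free_mapK p : free_even_part (b p) = p.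
Proof.
elim/free_ind: p => [|a w|p q hp hq].
- by rewrite rmorph0 free_even_part0.
- by rewrite free_map_mono free_even_part_mono even_inclE even_valK.
- by rewrite rmorphB free_even_partB hp hq.
Qed.

Hypothesis deg_even : forall s, ~~ odd (absz (deg s)).

Lemma free_prod_even w : even_pred (\prod_(s <- w) free_var A deg s).
Proof.
elim: w => [|s w IH]; first by rewrite big_nil; apply: even_pred_homog (@homog1 _).
rewrite big_cons; apply: even_predM => //.
exact: even_pred_homog (deg_even s) (free_var_homog _ _ _).
Qed.

(** When all variables have even degree, the parity of a monomial is that of its coefficient. *)
Lemma free_map_even_part p : b (free_even_part p) = par false p.
Proof.
elim/free_ind: p => [|a w|p q hp hq].
- by rewrite free_even_part0 !raddf0.
- rewrite free_even_part_mono free_map_mono !monoE parM.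
  rewrite (par_even_id (free_prod_even w)) (even_par_true (free_prod_even w)).
  by rewrite mulr0 addr0 -hom_par.
- by rewrite free_even_partB !raddfB /= hp hq.
Qed.

Lemma free_even_partMr p q : free_even_part (p * b q) = free_even_part p * q.
Proof.
have b_even t : even_pred (b t).
  by rewrite -(congr1 b (free_mapK t)) free_map_even_part; apply: par_even.
apply: (can_inj free_mapK); rewrite -/b rmorphM !free_map_even_part parM.
by rewrite (par_even_id (b_even q)) (even_par_true (b_even q)) mulr0 addr0.
Qed.
End FreeEvenPart.

Lemma seq_map_preim (X Y : eqType) (f : X -> Y) (Q : X -> Prop) (l : seq Y) :
  (forall y, y \in l -> exists2 x, Q x & y = f x) ->
  exists l' : seq X, (forall x, x \in l' -> Q x) /\ l = map f l'.
Proof.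
elim: l => [|y l IH] h; first by exists [::].
have [|x hx ->] := h y; first by rewrite inE eqxx.
have [|l' [hl' ->]] := IH; first by move=> z hz; apply: h; rewrite inE hz orbT.
exists (x :: l'); split=> // z; rewrite inE => /orP[/eqP->|] //; exact: hl'.
Qed.

Section EtaleDescent.
Variables (A B : diracRingType) (phi : diracHom A B).

Let i := even_incl A.
Let phi0 := even_map phi.
Let T := tensor i phi0.
Let inlT : diracHom A T := tens_inl i phi0.
Let inrT : diracHom (even_part B) T := tens_inr i phi0.

Section EvenGenerators.

Let dec (b : B) : Prop := exists l : seq (A * even_part B),
  (forall x, x \in l -> exists d, homog d x.2) /\
  b = \sum_(x <- l) phi x.1 * even_val x.2.

Let dec0 : dec 0.
Proof. by exists [::]; rewrite big_nil. Qed.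

Let decB b b' : dec b -> dec b' -> dec (b - b').
Proof.
move=> [l [hl ->]] [l' [hl' ->]].
exists (l ++ [seq (- x.1, x.2) | x <- l']); split.
  by move=> x; rewrite mem_cat => /orP[/hl|/mapP[y /hl' hy ->]].
rewrite big_cat big_map /= -sumrN; congr (_ + _).
by apply: eq_bigr => x _; rewrite rmorphN mulNr.
Qed.

Let decD := addr_of_subr dec0 decB.

Lemma even_decomposition (b : B) : (exists t, even_counit phi t = b) -> dec b.
Proof.
move=> [t <-]; elim/tensor_ind: t => [|a c|p q hp hq].
- by rewrite rmorph0; apply: dec0.
- rewrite -tens1M rmorphM.
  have -> : even_counit phi (tens i phi0 a 1) = phi a by apply: even_counit_inl.
  have -> : even_counit phi (tens i phi0 1 c) = even_incl B c by apply: even_counit_inr.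
  elim/homog_ind: c => [|x y hx hy|d x hx].
  + by rewrite rmorph0 mulr0; apply: dec0.
  + by rewrite rmorphD mulrDr; apply: decD.
  exists [:: (a, x)]; split; last by rewrite big_seq1.
  by move=> y; rewrite inE => /eqP ->; exists d.
- by rewrite rmorphB; apply: decB.
Qed.

(** By surjectivity of the counit each generator of [B] is a sum of products [phi a * c] with [c] in
    [B^ev]; the finitely many [c] that occur generate [B] over [A]. *)
Lemma even_generators : finitely_presented phi ->
  (forall b, exists t, even_counit phi t = b) ->
  exists (n : nat) (deg : 'I_n -> int) (v : 'I_n -> even_part B)
    (hv : forall s, homog (deg s) (v s)),
    (forall s, ~~ odd (absz (deg s))) /\
    forall b, exists p,
      free_desc phi (fun s => dirac_homog (even_incl B) (hv s)) p = b.
Proof.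
move=> [S [deg' [v' [hv' [sv' _]]]]] sc.
have /choice[L hL] s := even_decomposition (sc (v' s)).
pose l := flatten [seq L s | s <- enum S].
have Ll s x : x \in L s -> x \in l.
  by move=> hx; apply/flatten_mapP; exists s; rewrite ?mem_enum.
(* As [j < size l], the default [(0, 0)] is never reached. *)
pose v (j : 'I_(size l)) := (nth (0, 0) l j).2.
have /choice[deg hdeg] j : exists d, ~~ odd (absz d) /\ homog d (v j).
  have : nth (0, 0) l j \in l by apply: mem_nth.
  by move=> /flatten_mapP[s _ /(hL s).1[d]]; apply: even_part_homog.
exists (size l), deg, v, (fun j => (hdeg j).2); split=> [j|b].
  exact: (hdeg j).1.
set ev := free_desc _ _.
have /choice[p hp] s : exists p, homog (deg' s) p /\ ev p = v' s.
  suff h : exists p, ev p = v' s by have [p ? ?] := homog_lift h (hv' s); exists p.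
  rewrite (hL s).2; have : {subset L s <= l} by move=> x; apply: Ll.
  elim: (L s) => [|x m IH] hm; first by exists 0; rewrite big_nil rmorph0.
  have [|p hp] := IH; first by move=> y hy; apply: hm; rewrite inE hy orbT.
  have /(nthP (0, 0))[j hj ej] : x \in l by apply: hm; rewrite inE eqxx.
  exists (free_const A deg x.1 * free_var A deg (Ordinal hj) + p).
  by rewrite big_cons rmorphD rmorphM hp free_desc_const free_desc_var /v /= ej.
pose al := free_desc (free_const A deg) (fun s => (hp s).1).
have [q <-] := sv' b; exists (al q).
suff e : dirac_comp ev al = free_desc phi hv' by rewrite -e.
apply: free_hom_ext => [a|s]; rewrite dirac_compE.
  by rewrite !free_desc_const.
by rewrite !free_desc_var (hp s).2.
Qed.
End EvenGenerators.

Hypothesis phi_etale : etale phi.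

Let counit_surj := (even_counit_bij phi_etale).1.
Let counit_inj := (even_counit_bij phi_etale).2.

Lemma even_counit_inv : exists c : diracHom B T,
  (forall a, c (phi a) = inlT a) /\ (forall b, c (even_val b) = inrT b).
Proof.
have [c [cK _]] := hom_bij_inv counit_surj counit_inj.
exists c; split=> [a|b].
  by rewrite -(even_counit_inl phi a) cK.
by rewrite -(even_counit_inr phi b) cK.
Qed.

Lemma fp_even_part : finitely_presented phi0.
Proof.
have [n [deg [v [hv [deg_even sv]]]]] := even_generators phi_etale.1 counit_surj.
set evA := free_desc _ _ in sv.
pose ev := free_desc phi0 hv.
pose b := free_map i deg.
have evA_b p : evA (b p) = even_val (ev p).
  suff e : dirac_comp evA b = dirac_comp (even_incl B) ev.
    by rewrite -[LHS]/(dirac_comp evA b p) e.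
  apply: free_hom_ext => [a|s]; rewrite !dirac_compE.
    by rewrite free_map_const !free_desc_const.
  by rewrite free_map_var !free_desc_var.
have sev y : exists p, ev p = y.
  have [p hp] := sv (even_val y); exists (free_even_part p).
  apply: even_incl_inj; rewrite even_inclE -evA_b free_map_even_part //.
  by rewrite hom_par hp par_even_id //; apply: valP.
have [l0 [_ hl0]] := fp_change_generators phi_etale.1 sv.
(* [A[S] / K] is the base change of [A^ev[S] / ker ev = B^ev], hence it is [B]. So [ker evA] is
   generated by the image of [ker ev], before any finiteness is known for the latter. *)
pose K := image_ideal b (ker_ideal ev).
have ker_K p : evA p = 0 -> K p.
  have [x hx|u hu] := hom_factor (f := dirac_comp (dproj_hom K) b) sev.
    by apply/dproj_eq0; apply: (@image_ideal_mem _ _ b (ker_ideal ev)).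
  have bal r : dirac_comp (dproj_hom K) (free_const A deg) (i r) = u (phi0 r).
    by rewrite -(free_desc_const phi0 hv) hu !dirac_compE free_map_const.
  have [c [c_phi c_val]] := even_counit_inv.
  suff e : dirac_comp (dirac_comp (tens_desc bal) c) evA = dproj_hom K.
    by move=> hp; apply/dproj_eq0; rewrite -e dirac_compE hp rmorph0.
  apply: free_hom_ext => [a|s]; rewrite !dirac_compE.
    by rewrite free_desc_const c_phi [LHS]tens_desc_inl.
  rewrite free_desc_var c_val [LHS]tens_desc_inr -(free_desc_var phi0 hv) hu.
  by rewrite dirac_compE free_map_var.
(* Finitely many generators of [ker evA] involve only finitely many elements of that image; these
   come from the list [l2] of relations for [B^ev]. *)
have [p hp|l1 [hl1 gl1]] :=
  @fin_gen_seq _ _ (image_gen b (ker_ideal ev)) l0 id.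
  have hK : K p by apply: ker_K; apply/hl0/list_ideal_mem.
  exact: fin_gen_hom_ideal hK.
have [|l2 [hl2 el1]] := @seq_map_preim _ _ b
    (fun x => (exists d, homog d x) /\ ev x = 0) l1.
  by move=> y /hl1[x [hd hx ->]]; exists x.
exists 'I_n, deg, v, hv; split=> //.
exists l2; split; first by move=> p /hl2[].
move=> p; split; last by apply: gideal_gen_hom0 => y /hl2[].
move=> hp I hI.
have {hp} : gideal_gen l1 (b p).
  apply: (gideal_gen_sub_ideal (I := list_ideal l1)) gl1 _.
  by apply/hl0; have e : ev p = 0 := hp; rewrite evA_b e.
have hG y : (exists2 x, x \in l2 & y = b x) -> exists d, homog d y.
  by move=> [x /hl2[[d hd] _] ->]; exists d; apply: dirac_homog.
move=> /(_ (hom_ideal hG)) h.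
rewrite -[p](free_mapK (A := A)).
(* Writing [b p] as a sum of multiples [a * b x] with [x] in [l2], the retraction [free_even_part]
   turns it into an expression of [p] through [l2]. *)
have : hom_ideal hG (b p).
  apply: h => y; rewrite el1 => /mapP[x hx ->].
  by apply: hom_ideal_gen; exists x.
elim=> [|y [a [g [[x /hI hx ->] ->]]]|y1 y2 _ h1 _ h2].
- by rewrite free_even_part0; apply: gideal0.
- by rewrite free_even_partMr //; apply: gidealMl.
- by rewrite free_even_partB; apply: gidealB.
Qed.
End EtaleDescent.

Section EvenUnit.
Variables (A C : diracRingType) (g : diracHom (even_part A) C).
Hypothesis hC : forall c : C, even_pred c.

Let inr := tens_inr (even_incl A) g.

Lemma even_unit_even c : even_pred (inr c).
Proof. exact: hom_even. Qed.

Definition even_unit : diracHom C (even_part (tensor (even_incl A) g)) :=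
  even_corestr even_unit_even.

Lemma even_unit_bij : (forall y, exists x, even_unit x = y) /\
  (forall x, even_unit x = 0 -> x = 0).
Proof.
split=> [y|x e].
  exists (tens_even_part (even_val y)); apply: even_incl_inj.
  by rewrite !even_inclE even_corestrE [LHS]tens_inr_even //; apply: valP.
apply: (tens_inr_inj (g := g)); rewrite rmorph0.
by rewrite -[LHS](even_corestrE even_unit_even) -/even_unit e.
Qed.

Lemma tens_even_partMr t c :
  tens_even_part (t * inr c) = tens_even_part t * c.
Proof.
apply: (tens_inr_inj (g := g)); rewrite rmorphM !tens_inr_even_part // parM.
rewrite (par_even_id (even_unit_even c)) (even_par_true (even_unit_even c)).
by rewrite mulr0 addr0.
Qed.

(** The extension of [I] to [A (x) C] contracts back to [I], because the retraction [tens_even_part]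
    is [C]-linear. *)
Lemma image_ideal_inr (I : gradedIdeal C) c : image_ideal inr I (inr c) -> I c.
Proof.
have h t : image_ideal inr I t -> I (tens_even_part t).
  elim=> [|y [a [x [[z [_ hz ->] ->]]]]|y1 y2 _ h1 _ h2].
  - by rewrite tens_even_part0; apply: gideal0.
  - by rewrite tens_even_partMr; apply: gidealMl.
  - by rewrite tens_even_partB; apply: gidealB.
by move=> /h; rewrite tens_even_part_inr.
Qed.
End EvenUnit.

Section EtaleDescentLifting.
Variables (A B : diracRingType) (phi : diracHom A B).
Hypothesis phi_etale : etale phi.

Let phi0 := even_map phi.

Variables (X : diracRingType) (I : gradedIdeal X).
Hypothesis I0 : forall x y, I x -> I y -> x * y = 0.
Variables (f : diracHom (even_part A) X) (g : diracHom (even_part B) (dquot I)).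
Hypothesis gf : forall r, g (phi0 r) = dproj_hom I (f r).

Let f_even r : even_pred (f r).
Proof. exact/hom_even/even_part_even. Qed.

Let X0 := even_part X.
Let f0 : diracHom (even_part A) X0 := even_corestr f_even.
Let X0_even (x : X0) : even_pred x.
Proof. exact: even_part_even. Qed.

(** The lifting problem is moved from [A^ev] to [A], where [phi] is known to be etale. Maps out of
    [B^ev] take even values, so [X] may be replaced by [X0], and [X0] is recovered as the even part
    of [TX]. *)
Let TX := tensor (even_incl A) f0.
Let inl : diracHom A TX := tens_inl (even_incl A) f0.
Let inr : diracHom X0 TX := tens_inr (even_incl A) f0.
Let IX0 := preim_ideal (even_incl X) I.
Let J := image_ideal inr IX0.

Let J0 x y : J x -> J y -> x * y = 0.
Proof.
apply: hom_ideal_sq0 => _ _ [u [_ hu ->]] [w [_ hw ->]].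
rewrite -rmorphM; have -> : u * w = 0; last exact: rmorph0.
by apply: even_incl_inj; rewrite rmorphM rmorph0; apply: I0.
Qed.

Let q := even_map (dproj_hom I).

Let q_surj y : exists x, q x = y.
Proof.
have [x hx] := dproj_hom_surj (even_val y); exists (even_proj x).
apply: even_incl_inj; rewrite /q even_mapE !even_inclE val_even_proj.
by rewrite hom_par hx par_even_id //; apply: valP.
Qed.

Let qP x : q x = 0 <-> IX0 x.
Proof.
split=> [e|hx].
  by apply/(dproj_eq0 I); rewrite -even_mapE -/q e rmorph0.
by apply: even_incl_inj; rewrite even_mapE rmorph0; apply/dproj_eq0.
Qed.

Let g_even y : even_pred (g y).
Proof. exact/hom_even/even_part_even. Qed.

Let g0 := even_corestr g_even.

Let g0f r : g0 (phi0 r) = q (f0 r).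
Proof. by apply: even_incl_inj; rewrite even_mapE !even_inclE !even_corestrE gf. Qed.

(* A lift [h] of [g] along [X -> X / I] takes values in [X0]; it corresponds to
   the [A]-linear map [A (x) B^ev -> A (x) X0]. *)
Let ext (h : diracHom (even_part B) X) : (forall r, h (phi0 r) = f r) ->
  exists H : diracHom B TX, (forall a, H (phi a) = inl a) /\
    forall b, exists2 x, H (even_val b) = inr x & even_val x = h b.
Proof.
move=> hf; have h_even b : even_pred (h b) by apply/hom_even/even_part_even.
pose h0 := even_corestr h_even.
have bal r : inl (even_incl A r) = dirac_comp inr h0 (phi0 r).
  rewrite dirac_compE [LHS]tens_inlr; congr (inr _).
  by apply: val_inj; rewrite /= -hf.
have [c [c_phi c_val]] := even_counit_inv phi_etale.
exists (dirac_comp (tens_desc bal) c); split=> [a|b].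
  by rewrite dirac_compE c_phi; apply: tens_desc_inl.
exists (h0 b) => //.
by rewrite dirac_compE c_val; apply: tens_desc_inr.
Qed.

(** Both lifts extend to maps from [B] to [TX] that agree modulo [J]; these are equal, and
    [X0 -> TX] is injective. *)
Lemma even_part_lift_uniq (h h' : diracHom (even_part B) X) :
  (forall r, h (phi0 r) = f r) -> (forall b, dproj_hom I (h b) = g b) ->
  (forall r, h' (phi0 r) = f r) -> (forall b, dproj_hom I (h' b) = g b) ->
  h =1 h'.
Proof.
move=> hf hg hf' hg'; have [H [H_phi H_val]] := ext hf.
have [H' [H'_phi H'_val]] := ext hf'.
have e : H =1 H'.
  apply: (etale_square_uniq phi_etale J0) => [a|b]; first by rewrite H_phi H'_phi.
  have [t <-] := (even_counit_bij phi_etale).1 b; apply/dproj_hom_eq.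
  pose k H := dirac_comp (dproj_hom J) (dirac_comp H (even_counit phi)).
  suff E : k H = k H' by rewrite -[LHS]/(k H t) E.
  apply: tens_hom_ext => [a|y]; rewrite !dirac_compE.
    by rewrite even_counit_inl H_phi H'_phi.
  rewrite even_counit_inr; have [x -> hx] := H_val y; have [x' -> hx'] := H'_val y.
  apply/dproj_hom_eq; rewrite -rmorphB; apply: image_ideal_mem.
  apply/qP; rewrite rmorphB; apply/eqP; rewrite subr_eq0; apply/eqP.
  by apply: even_incl_inj; rewrite !even_mapE !even_inclE hx hx' hg hg'.
move=> b; have [x hx <-] := H_val b; have [x' hx' <-] := H'_val b.
congr even_val; apply: (tens_inr_inj (g := f0)).
by rewrite -[LHS]hx -[RHS]hx' e.
Qed.

Lemma even_part_lift : exists h : diracHom (even_part B) X,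
  (forall r, h (phi0 r) = f r) /\ (forall b, dproj_hom I (h b) = g b).
Proof.
(* [k] carries the even part of [X / I] to [TX / J]; with [g0] it yields the map from [B] that is
   lifted to [TX] below. *)
have [x /qP hx|k hk] := hom_factor (f := dirac_comp (dproj_hom J) inr) q_surj.
  by apply/dproj_eq0; apply: image_ideal_mem.
have bal r : dirac_comp (dproj_hom J) inl (even_incl A r) =
    dirac_comp k g0 (phi0 r).
  by rewrite !dirac_compE g0f hk dirac_compE; rewrite [inl _]tens_inlr.
have [c [c_phi c_val]] := even_counit_inv phi_etale.
have [a|H [[H_phi H_proj] _]] :=
  phi_etale.2 TX J J0 inl (dirac_comp (tens_desc bal) c).
  by rewrite dirac_compE c_phi [LHS]tens_desc_inl.
have [u_surj u_inj] := even_unit_bij f0 X0_even.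
have [w [uK wK]] := hom_bij_inv u_surj u_inj.
pose h0 : diracHom (even_part B) X0 := dirac_comp w (even_map H).
have h0P b : inr (h0 b) = H (even_val b).
  by rewrite -[LHS](even_corestrE (even_unit_even f0 X0_even)) -/(even_unit _) wK.
exists (dirac_comp (even_incl X) h0); split=> [r|b]; rewrite dirac_compE.
  rewrite -[f r](even_corestrE f_even) -/f0 even_inclE; congr even_val.
  apply: (tens_inr_inj (g := f0)); rewrite [LHS]h0P -even_inclE /phi0 even_mapE H_phi.
  exact: tens_inlr.
(* [H] sends [b] to [inr x] modulo [J]; contracting [J] to [X0] shows that [h0 b] and [x] agree
   modulo [I]. *)
have [x hx] := q_surj (g0 b).
have := H_proj (even_val b).
rewrite dirac_compE c_val [RHS]tens_desc_inr dirac_compE -hx hk dirac_compE -h0P.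
move=> /dproj_hom_eq; rewrite -rmorphB => /(image_ideal_inr X0_even).
move=> /qP; rewrite rmorphB => /eqP; rewrite subr_eq0 => /eqP e.
by rewrite -[RHS](even_corestrE g_even) -/g0 -hx -e.
Qed.
End EtaleDescentLifting.

Lemma etale_even_part (A B : diracRingType) (phi : diracHom A B) :
  etale phi -> etale (even_map phi).
Proof.
move=> ep; split; first exact: fp_even_part.
move=> X I I0 f g gf; have [h [hf hg]] := even_part_lift ep I0 gf.
exists h; split=> // h' [hf' hg']; apply: diracHom_ext.
exact: (even_part_lift_uniq ep I0 hf hg hf' hg').
Qed.

(** * The equivalence *)

Lemma natural_iso_exists (C D : category) (F G : functor C D)
    (n : forall X : C, hom (F X) (G X)) :
  (forall (X Y : C) (f : hom X Y),
    compm (n Y) (fmap F f) = compm (fmap G f) (n X)) ->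
  (forall X, exists v, compm v (n X) = idm (F X) /\ compm (n X) v = idm (G X)) ->
  inhabited (natural_iso F G).
Proof.
move=> nat_n /(fun h X => cid (h X)) v.
exact: inhabits (NaturalIso nat_n (fun X => (svalP (v X)).1)
  (fun X => (svalP (v X)).2)).
Qed.

Lemma alg_bij_inv (A : diracRingType) (B C : diracAlg A) (u : algHom B C) :
  (forall y, exists x, u x = y) -> (forall x, u x = 0 -> x = 0) ->
  exists w : algHom C B, alg_comp w u = alg_id B /\ alg_comp u w = alg_id C.
Proof.
move=> su ku; have [w [wu uw]] := hom_bij_inv su ku.
have hw a : w (alg_map C a) = alg_map B a by rewrite -(alg_homE u) wu.
by exists (AlgHom hw); split; apply: algHom_ext => x; [apply: wu|apply: uw].
Qed.

Section EvenFunctor.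
Variable A : diracRingType.

Definition even_alg (B : diracAlg A) : diracAlg (even_part A) :=
  DiracAlg (even_map (alg_map B)).

Lemma even_alg_mapE (B C : diracAlg A) (u : algHom B C) r :
  even_map u (alg_map (even_alg B) r) = alg_map (even_alg C) r.
Proof. by apply: even_incl_inj; rewrite !even_mapE alg_homE. Qed.

Definition even_alg_map (B C : diracAlg A) (u : algHom B C) :
    algHom (even_alg B) (even_alg C) :=
  @AlgHom _ (even_alg B) (even_alg C) (even_map u) (even_alg_mapE u).

Lemma even_alg_map_id (B : diracAlg A) :
  even_alg_map (alg_id B) = alg_id (even_alg B).
Proof. by apply: algHom_ext => x; apply: even_incl_inj. Qed.

Lemma even_alg_map_comp (B C D : diracAlg A) (u : algHom C D) (v : algHom B C) :
  even_alg_map (alg_comp u v) = alg_comp (even_alg_map u) (even_alg_map v).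
Proof. by apply: algHom_ext => x; apply: even_incl_inj. Qed.

Definition even_functor : functor (dirac_alg A) (dirac_alg (even_part A)) :=
  @Functor (dirac_alg A) (dirac_alg (even_part A)) even_alg even_alg_map
    even_alg_map_id even_alg_map_comp.

Lemma etale_ext_scalars (C : dirac_alg (even_part A)) :
  etale_alg C -> etale_alg (ext_scalars (even_incl A) C).
Proof. exact: etale_base_change. Qed.

Lemma etale_even_functor (B : dirac_alg A) :
  etale_alg B -> etale_alg (even_functor B).
Proof. exact: etale_even_part. Qed.

Let F : functor (etale_category (even_part A)) (etale_category A) :=
  functor_restrict (ext_scalars (even_incl A)) etale_ext_scalars.
Let G : functor (etale_category A) (etale_category (even_part A)) :=
  functor_restrict even_functor etale_even_functor.

Lemma etale_alg_even (C : etale_category (even_part A)) :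
  forall c : sval C, even_pred c.
Proof. exact: etale_even (svalP C) (@even_part_even A). Qed.

Lemma even_unit_alg (C : etale_category (even_part A)) r :
  even_unit (alg_map (sval C)) (@etale_alg_even C) (alg_map (sval C) r) =
  alg_map (sval (G (F C))) r.
Proof. by apply: even_incl_inj; apply/esym/tens_inlr. Qed.

Definition etale_unit (C : etale_category (even_part A)) : hom C (G (F C)) :=
  @AlgHom _ (sval C) (sval (G (F C))) _ (even_unit_alg C).

Lemma etale_unit_iso :
  inhabited (natural_iso (functor_id _) (functor_comp G F)).
Proof.
apply: (@natural_iso_exists _ _ (functor_id _) (functor_comp G F) etale_unit) => [C D u|C].
  apply: algHom_ext => c; apply: even_incl_inj.
  by rewrite [RHS](ext_map_tens _ _ 1 c).
have [hs hi] := even_unit_bij (alg_map (sval C)) (@etale_alg_even C).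
exact: (alg_bij_inv (u := etale_unit C)).
Qed.

Definition etale_counit (B : etale_category A) : hom (F (G B)) B :=
  @AlgHom _ (sval (F (G B))) (sval B) (even_counit (alg_map (sval B)))
    (even_counit_inl (alg_map (sval B))).

Lemma etale_counit_iso :
  inhabited (natural_iso (functor_comp F G) (functor_id _)).
Proof.
apply: (@natural_iso_exists _ _ (functor_comp F G) (functor_id _) etale_counit) => [B C u|B].
  apply: algHom_ext => t.
  suff e : dirac_comp (etale_counit C) (fmap F (fmap G u)) =
      dirac_comp u (etale_counit B).
    exact: (congr1 (fun k : diracHom _ _ => k t) e).
  apply: tens_hom_ext => [a|b]; rewrite !dirac_compE.
    rewrite [fmap F (fmap G u) _]tens_desc_inl.
    by rewrite [LHS]tens_desc_inl [etale_counit B _]tens_desc_inl alg_homE.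
  rewrite [fmap F (fmap G u) _]tens_desc_inr dirac_compE.
  by rewrite [LHS]tens_desc_inr [etale_counit B _]tens_desc_inr.
have [hs hi] := even_counit_bij (svalP B).
exact: (alg_bij_inv (u := etale_counit B)).
Qed.
End EvenFunctor.

Theorem theorem4p25 (A : diracRingType) :
  exists h : forall B : dirac_alg (even_part A),
      etale_alg B -> etale_alg (ext_scalars (even_incl A) B),
    is_equivalence
      (functor_restrict (ext_scalars (even_incl A)) h
        : functor (etale_category (even_part A)) (etale_category A)).
Proof.
exists (@etale_ext_scalars A).
exists (functor_restrict (even_functor A) (@etale_even_functor A)).
by split; [apply: etale_unit_iso|apply: etale_counit_iso].
Qed.
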